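(* Fix $a=1$, $\ell(d):=d$, and consider the sequence $(F_n)_{n\ge 2}$ defined by $$F_n(s):=\begin{cases}|s-1| & \text{if } 0\le s\le n,\\ \dfrac{(s-1)^2}{n-1} & \text{if } s>n.\end{cases}$$ Let $\mathsf{D}_{\mathrm{ET},n}$ be the Entropy-Transport cost induced by $F_n$ and $c=\ell(d)=d$ (with power $a=1$), and let $$\mathbf{D}_{\mathrm{ET},n}\big((X_1,d_1,\mu_1),(X_2,d_2,\mu_2)\big):=\inf\ \mathsf{D}_{\mathrm{ET},n}(\psi^1_\sharp\mu_1,\psi^2_\sharp\mu_2),$$ where the infimum is over all complete and separable metric spaces $(\hat X,\hat d)$ with isometric embeddings $\psi^i:\mathsf{supp}(\mu_i)\to\hat X$, $i=1,2$. Then, for all metric measure spaces $(X_1,d_1,\mu_1),(X_2,d_2,\mu_2)\in\mathbf{X}$ the quantity $$\mathbf{BL}\big((X_1,d_1,\mu_1),(X_2,d_2,\mu_2)\big):=\mathbf{D}_{\mathrm{ET},n}\big((X_1,d_1,\mu_1),(X_2,d_2,\mu_2)\big)$$ is well defined (i.e. it does not depend on $n\ge 2$). Moreover, $\mathbf{BL}$ defines a complete metric on $\mathbf{X}$ such that $$\mathbf{BL}\big((X_1,d_1,\mu_1),(X_2,d_2,\mu_2)\big)=\inf\ \mathsf{BL}(\psi^1_\sharp\mu_1,\psi^2_\sharp\mu_2),$$ where the infimum is over all complete and separable metric spaces $(\hat X,\hat d)$ with isometric embeddings $\psi^1:\mathsf{supp}(\mu_1)\to\hat X$ and $\psi^2:\mathsf{supp}(\mu_2)\to\hat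 X$.
   Context: For a complete separable metric space $X$, $\mathscr{M}(X)$ denotes the set of finite nonnegative Borel measures on $X$. For a convex lower semicontinuous $F:[0,\infty)\to[0,\infty]$ with $F(1)=0$ set $F'_\infty:=\lim_{s\to\infty}F(s)/s$; the $F$-divergence is $D_F(\gamma\|\mu):=\int_X F(\sigma)\,d\mu+F'_\infty\,\gamma^\perp(X)$, where $\gamma=\sigma\mu+\gamma^\perp$ is the Lebesgue decomposition of $\gamma$ with respect to $\mu$ (with $\infty\cdot 0=0$). The Entropy-Transport cost induced by $F$ and a lower semicontinuous cost $c:X\times X\to[0,\infty]$ is $$\mathrm{ET}(\mu_1,\mu_2):=\inf_{\gamma\in\mathscr{M}(X\times X)}\Big\{D_F(\gamma_1\|\mu_1)+D_F(\gamma_2\|\mu_2)+\int_{X\times X} c\,d\gamma\Big\},$$ where $\gamma_i=(\pi^i)_\sharp\gamma$ are the marginals of $\gamma$. The Piccoli-Rossi (bounded Lipschitz) distance $\mathsf{BL}$ on $\mathscr{M}(X)$ is the Entropy-Transport cost induced by $F(s)=|s-1|$ and $c(x_1,x_2)=d(x_1,x_2)$. A metric measure space is a triple $(X,d,\mu)$ with $(X,d)$ a complete separable metric space and $\mu\in\mathscr{M}(X)$; $\mathsf{supp}(\mu)$ is the support of $\mu$. Two metric measure spaces are isomorphic if there is an isometry $\psi:\mathsf{supp}(\mu_1)\to\mathsf{supp}(\mu_2)$ with $\psi_\sharp\mu_1=\mu_2$. $\mathbf{X}$ is the family of isomorphism classes. *)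

(* Defs.v *)
(* MathComp / MathComp-Analysis *)
From HB Require Import structures.
From mathcomp Require Import all_boot all_order all_algebra.
From mathcomp Require Import all_classical all_reals all_analysis.

Set Implicit Arguments.
Unset Strict Implicit.
Unset Printing Implicit Defensive.

Import Order.TTheory GRing.Theory Num.Theory.
Import numFieldNormedType.Exports.

Local Open Scope classical_set_scope.
Local Open Scope ring_scope.

HB.mixin Record isSeparable T & Topological T := {
  separable : exists D : set T, countable D /\ dense D }.

(* Measurable types of the library are pointed, hence so are these spaces.
   The distinguished point plays no role in any definition below, and the only
   space excluded is the empty one, which carries the zero measure only. *)
#[short(type="polishMetricType")]
HB.structure Definition PolishMetric (R : numDomainType) :=
  { T of Metric R T & Complete T & isSeparable T }.

(* Equips products with their missing [ptopologicalType] structure. *)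
HB.saturate prod.

Definition borel (T : ptopologicalType) := g_sigma_algebraType (@open T).

Definition fin_borel_measure (R : realType) (T : ptopologicalType) :=
  {finite_measure set (borel T) -> \bar R}.

Lemma open_borel (T : ptopologicalType) (U : set T) :
  open U -> measurable (U : set (borel T)).
Proof. by move=> oU; exact: sub_gen_smallest. Qed.

Lemma closed_borel (T : ptopologicalType) (C : set T) :
  closed C -> measurable (C : set (borel T)).
Proof.
move=> cC; rewrite -[C]setCK; apply: (@measurableC _ (borel T)).
by apply: open_borel; rewrite openC.
Qed.

Lemma continuous_borel (S T : ptopologicalType) (f : S -> T) :
  continuous f -> measurable_fun [set: borel S] (f : borel S -> borel T).
Proof.
move=> /continuousP cf; apply: (@measurability _ _ (borel S) (borel T) _ _ (@open T)) => //.
by move=> _ [U oU <-]; rewrite setTI; apply: open_borel; exact: cf.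
Qed.

(* [image_measure mu mD mf] is the push-forward, under a function f measurable
   on the measurable set D, of the restriction of mu to D. *)
Definition image_measure d1 d2 (T1 : measurableType d1)
    (T2 : measurableType d2) (R : realType)
    (mu : {finite_measure set T1 -> \bar R}) (D : set T1) (mD : measurable D)
    (f : T1 -> T2) (mf : measurable_fun D f) : set T2 -> \bar R :=
  fun A => mu (D `&` f @^-1` A).

Section image_measure.
Context d1 d2 (T1 : measurableType d1) (T2 : measurableType d2) (R : realType).
Context (mu : {finite_measure set T1 -> \bar R}) (D : set T1).
Context (mD : measurable D) (f : T1 -> T2) (mf : measurable_fun D f).
Local Notation nu := (image_measure mu mD mf).

Let nu0 : nu set0 = 0%E.
Proof. by rewrite /image_measure preimage_set0 setI0 measure0. Qed.

Let nu_ge0 A : (0 <= nu A)%E.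
Proof. exact: measure_ge0. Qed.

Let nu_sigma_additive : semi_sigma_additive nu.
Proof.
move=> F mF tF mUF; rewrite /image_measure preimage_bigcup setI_bigcupr.
apply: measure_semi_sigma_additive.
- by move=> n; exact: mf.
- apply/trivIsetP => /= i j _ _ ij; rewrite setIACA -preimage_setI.
  by move/trivIsetP : tF => /(_ _ _ _ _ ij) ->//; rewrite preimage_set0 setI0.
- by rewrite -setI_bigcupr -preimage_bigcup; exact: mf.
Qed.

HB.instance Definition _ := isMeasure.Build _ _ _ nu
  nu0 nu_ge0 nu_sigma_additive.

Let nu_fin : fin_num_fun nu.
Proof. by move=> A mA; apply: fin_num_measure; exact: mf. Qed.

HB.instance Definition _ := Measure_isFinite.Build _ _ _ nu nu_fin.

End image_measure.

Section divergence.
Local Open Scope ereal_scope.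
Context d (T : measurableType d) (R : realType).
Implicit Types gamma mu : {finite_measure set T -> \bar R}.

Definition lebesgue_decomposition gamma mu (sigma : T -> R)
    (gammaS : {finite_measure set T -> \bar R}) : Prop :=
  [/\ measurable_fun [set: T] sigma,
      (forall x, (0 <= sigma x)%R),
      (forall A, measurable A ->
         gamma A = \int[mu]_(x in A) (sigma x)%:E + gammaS A) &
      exists N, [/\ measurable N, mu N = 0 & gammaS (~` N) = 0] ].

Definition recession (F : R -> \bar R) : \bar R :=
  lim ((F s * (s^-1)%:E) @[s --> +oo%R]).

(* Lebesgue decompositions exist and are unique up to mu-null sets, so that
   [xget] selects the only value of the set; its default is irrelevant.
   F is only evaluated on [0, +oo[, as densities are nonnegative. *)
Definition fdivergence (F : R -> \bar R) gamma mu : \bar R :=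
  xget +oo [set v | exists sigma gammaS,
    lebesgue_decomposition gamma mu sigma gammaS /\
    v = \int[mu]_x F (sigma x) + recession F * gammaS [set: T] ].

End divergence.

(* Plans are Borel measures for the product topology of T * T, and not for
   the product sigma-algebra attached by default to a product of measurable
   types. *)
Section entropy_transport.
Local Open Scope ereal_scope.
Context (R : realType) (T : ptopologicalType).

Lemma measurable_fst_borel :
  measurable_fun [set: borel (T * T)%type] (fst : _ -> borel T).
Proof. by apply: continuous_borel => x; exact: cvg_fst. Qed.

Lemma measurable_snd_borel :
  measurable_fun [set: borel (T * T)%type] (snd : _ -> borel T).
Proof. by apply: continuous_borel => x; exact: cvg_snd. Qed.

Definition marginal1 (gamma : fin_borel_measure R (T * T)%type) :
  fin_borel_measure R T := image_measure gamma measurableT measurable_fst_borel.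

Definition marginal2 (gamma : fin_borel_measure R (T * T)%type) :
  fin_borel_measure R T := image_measure gamma measurableT measurable_snd_borel.

Definition entropy_transport (F : R -> \bar R) (c : T -> T -> \bar R)
    (mu1 mu2 : fin_borel_measure R T) : \bar R :=
  ereal_inf (range (fun gamma : fin_borel_measure R (T * T)%type =>
    fdivergence F (marginal1 gamma) mu1 + fdivergence F (marginal2 gamma) mu2
    + \int[gamma]_z c z.1 z.2)).

End entropy_transport.

Definition tv_entropy (R : realType) (s : R) : \bar R := `|s - 1|%:E.

Definition approx_entropy (R : realType) (n : nat) (s : R) : \bar R :=
  (if s <= n%:R then `|s - 1| else (s - 1) ^+ 2 / (n%:R - 1))%:E.

Definition metric_cost (R : realType) (T : polishMetricType R) (x y : T) :
  \bar R := (mdist x y)%:E.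

Definition piccoli_rossi (R : realType) (T : polishMetricType R)
    (mu1 mu2 : fin_borel_measure R T) : \bar R :=
  entropy_transport (@tv_entropy R) (@metric_cost R T) mu1 mu2.

Definition approx_ET (R : realType) (n : nat) (T : polishMetricType R)
    (mu1 mu2 : fin_borel_measure R T) : \bar R :=
  entropy_transport (@approx_entropy R n) (@metric_cost R T) mu1 mu2.

Definition msupport (R : realType) (T : ptopologicalType)
    (mu : fin_borel_measure R T) : set T :=
  [set x | forall U : set T, open U -> U x -> (0 < mu U)%E].

Lemma closed_msupport (R : realType) (T : ptopologicalType)
  (mu : fin_borel_measure R T) : closed (msupport mu).
Proof.
move=> x clx U oU Ux.
by have [y [sy Uy]] := clx U (open_nbhs_nbhs (conj oU Ux)); exact: sy.
Qed.

(* A distance preserving map from D to T is represented by a total function of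
   which only the values on D matter. *)
Definition isometric_on (R : realType) (S T : polishMetricType R) (D : set S)
    (psi : S -> T) : Prop :=
  {in D &, forall x y, mdist (psi x) (psi y) = mdist x y}.

Record isometric_embedding (R : realType) (S T : polishMetricType R)
    (D : set S) := IsometricEmbedding {
  emb_fun :> S -> T ;
  emb_isometric : isometric_on D emb_fun }.

Lemma isometric_on_borel (R : realType) (S T : polishMetricType R) (D : set S)
    (psi : S -> T) : measurable (D : set (borel S)) -> isometric_on D psi ->
  measurable_fun (D : set (borel S)) (psi : borel S -> borel T).
Proof.
move=> mD iso; apply: (@measurability _ _ (borel S) (borel T) _ _ (@open T)) => //.
move=> _ [U oU <-].
pose V := \bigcup_(yr in [set yr : S * R | D yr.1 /\
  ball (psi yr.1) yr.2 `<=` U]) (ball yr.1 yr.2)°.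
have oV : open V by apply: bigcup_open => yr _; exact: open_interior.
rewrite (_ : D `&` psi @^-1` U = D `&` V).
  by apply: measurableI => //; exact: open_borel.
apply/seteqP; split => x [Dx].
- move=> /= Ux; split => //.
  have /nbhs_ballP[r /= r0 rU] := open_nbhs_nbhs (conj oU Ux).
  exists (x, r) => //=.
  exact: nbhsx_ballx.
- move=> [[y r] /= [Dy yrU] /interior_subset yx]; split => //=; apply: yrU.
  move: yx; rewrite !ballEmdist /= iso ?inE//.
Qed.

Section mm_space.
Context (R : realType).

Record mm_space := MMSpace {
  mm_carrier :> polishMetricType R ;
  mm_measure : fin_borel_measure R mm_carrier }.

Definition mm_support (X : mm_space) : set X := msupport (mm_measure X).

Arguments mm_support : clear implicits.

Lemma measurable_mm_support (X : mm_space) :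
  measurable (mm_support X : set (borel X)).
Proof. by apply: closed_borel; exact: closed_msupport. Qed.

Definition mm_push (X : mm_space) (T : polishMetricType R)
    (psi : isometric_embedding T (mm_support X)) : fin_borel_measure R T :=
  image_measure (mm_measure X) (@measurable_mm_support X)
    (isometric_on_borel (@measurable_mm_support X) (emb_isometric psi)).

Definition mm_iso (X Y : mm_space) : Prop :=
  exists psi : isometric_embedding Y (mm_support X),
    psi @` mm_support X = mm_support Y /\
    forall A : set (borel Y), measurable A -> mm_push psi A = mm_measure Y A.

Definition embedding_inf
    (D : forall T : polishMetricType R,
       fin_borel_measure R T -> fin_borel_measure R T -> \bar R)
    (X1 X2 : mm_space) : \bar R :=
  ereal_inf [set e | exists (T : polishMetricType R)
    (psi1 : isometric_embedding T (mm_support X1))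
    (psi2 : isometric_embedding T (mm_support X2)),
    e = D T (mm_push psi1) (mm_push psi2)].

(* Isomorphism classes, as equivalence classes of [mm_iso]. *)
Record mm_class := MMClass {
  mm_members : mm_space -> Prop ;
  mm_membersE : exists X, mm_members = mm_iso X }.

Definition class_of (X : mm_space) : mm_class :=
  MMClass (ex_intro _ X erefl).

End mm_space.

Record is_metric (R : realType) (T : Type) (dist : T -> T -> R) : Prop := {
  dist_ge0 : forall x y, 0 <= dist x y ;
  dist_eq0 : forall x y, dist x y = 0 <-> x = y ;
  dist_sym : forall x y, dist x y = dist y x ;
  dist_triangle : forall x y z, dist x z <= dist x y + dist y z }.

Definition is_complete (R : realType) (T : Type) (dist : T -> T -> R) : Prop :=
  forall u : nat -> T,
    (forall e, 0 < e -> exists N, forall m n,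
       (N <= m)%N -> (N <= n)%N -> dist (u m) (u n) < e) ->
    exists l, forall e, 0 < e -> exists N, forall n,
      (N <= n)%N -> dist (u n) l < e.

(* Main.v *)
(* On [0, 1] all the entropies equal |s - 1|, and beyond 1 they grow with slope
   at least 1. Truncating a plan so that its marginals lie below mu1 and mu2
   loses some mass, but each unit lost was paid for in the divergence; hence the
   infimum may be taken over such subplans, on which every entropy gives the
   cost |mu1| + |mu2| - 2 |gamma| + int d dgamma. This settles the independence
   of n, and the two representation formulas.

   Triangle inequality: two ambient spaces are glued along the middle support,
   and two subplans are glued, up to an arbitrarily small error, by
   conditioning on the cells of a fine countable partition. Spaces are glued by
   taking the supremum of the variations of compatible families of 1-Lipschitz
   functions, and completing.

   Nondegeneracy: a sequence of couplings with vanishing cost identifies each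
   point of one support with a sequence of points of the other, which converges
   along an ultrafilter because neighbourhoods of support points have mass
   bounded below; the limits define the isomorphism.

   Completeness: a fast Cauchy sequence is embedded in a single Polish space by
   gluing the whole chain. The measures, discretised, are then realised
   as images of Lebesgue measure on subsets of the line so that consecutive
   realisations follow the almost optimal subplans. By Borel-Cantelli these maps
   converge almost everywhere, and the image under the limit map is the limit
   measure. *)
Require Import Defs.
From HB Require Import structures.
From mathcomp Require Import all_boot all_order all_algebra.
From mathcomp Require Import all_classical all_reals all_analysis.
From mathcomp Require Import measurable_realfun.
From mathcomp Require Import lra ring.

Set Implicit Arguments.
Unset Strict Implicit.
Unset Printing Implicit Defensive.

Import Order.TTheory GRing.Theory Num.Theory.
Import numFieldNormedType.Exports.

Local Open Scope classical_set_scope.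
Local Open Scope ring_scope.

(** * Borel measurability in Polish metric spaces *)

(** Infima need not be attained by a known plan, so costs enter only through the strict relation
    [coupled mu1 mu2 e], witnessed by any plan that is good enough; an extended real is recovered
    from the reals strictly above it. For gluing plans, the conditional laws of a plan given its
    middle point are replaced by an explicit density on the product of the two plans,
    [gluing_kernel], which only sees the cells. One ultrafilter serves all points of both supports
    at once, in place of a diagonal extraction, and makes the limit maps of the two directions
    inverse to each other. In the completeness part the masses vary along the sequence. Lebesgue
    measure on the whole line leaves an unlabelled part of infinite measure, from which the mass
    that a plan does not reach can always be taken. Consecutive costs are kept below the squares
    4^-k: one factor 2^-k is spent in Markov's inequality at a distance of order 2^-k, and the other
    is left as a summable measure of the exceptional set. *)

Section metric_facts.
Context (R : realType).
Implicit Types T : polishMetricType R.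

(* The library states these over a realFieldType; the inferred instances then
   differ syntactically from those of a realType, which defeats lra. *)
Lemma mdistC (T : metricType R) (x y : T) : mdist x y = mdist y x.
Proof. exact: metric_sym. Qed.

Lemma mdist_tri (T : metricType R) (y x z : T) :
  mdist x z <= mdist x y + mdist y z.
Proof. exact: metric_triangle. Qed.

Lemma mdistrr (T : metricType R) (x : T) : mdist x x = 0.
Proof. exact: mdistxx. Qed.

Lemma vanishing_sequence : exists q : nat -> R,
  (forall k, 0 < q k) /\ forall e, 0 < e -> exists k, q k < e.
Proof.
exists (fun k => k.+1%:R^-1); split=> // e e0.
by have [k _ /(_ k (leqnn k))] := @near_infty_natSinv_lt R (PosNum e0); exists k.
Qed.

Lemma open_mballP (T : metricType R) (U : set T) :
  open U <-> forall x, U x -> exists2 r : R, 0 < r & forall y, mdist x y < r -> U y.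
Proof.
rewrite openE; split=> [oU x /oU /nbhs_ballP[r r0 rU]|h x /h[r r0 rU]].
  by exists r => // y xy; apply: rU; rewrite ballEmdist.
by apply/nbhs_ballP; exists r => // y; rewrite ballEmdist; exact: rU.
Qed.

Lemma open_mball (T : metricType R) (x : T) r : open [set y | mdist x y < r].
Proof.
apply/open_mballP => y /= xy; exists (r - mdist x y); first by rewrite subr_gt0.
by move=> z yz; have := mdist_tri y x z; lra.
Qed.

Lemma dense_sequence T : exists s : nat -> T,
  forall x (e : R), 0 < e -> exists n, mdist (s n) x < e.
Proof.
have [D [/countable_injP[f injf] dD]] := @separable R T.
exists (fun n => xget point [set x | D x /\ f x = n]) => x e e0.
have [|y [/= xy Dy]] := dD [set y | mdist x y < e] _ (open_mball x e).
  by exists x => /=; rewrite mdistrr.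
exists (f y); rewrite mdistC.
suff -> : xget point [set x0 | D x0 /\ f x0 = f y] = y by [].
have [/= Dz fz] : [set x0 | D x0 /\ f x0 = f y] (xget point [set x0 | D x0 /\ f x0 = f y]).
  by apply: (@xgetPex _ point [set x0 | D x0 /\ f x0 = f y]); exists y.
by apply: injf => //; rewrite inE.
Qed.

(** Separability makes every open set of the product a countable union of boxes of balls, with
    centres in a dense sequence and radii in a vanishing one. Measurability for the product topology
    thus reduces to that of the two components. *)
Lemma measurable_pair_borel d (Om : measurableType d) T (h1 h2 : Om -> T) :
  measurable_fun setT (h1 : Om -> borel T) ->
  measurable_fun setT (h2 : Om -> borel T) ->
  measurable_fun setT ((fun x => (h1 x, h2 x)) : Om -> borel (T * T)%type).
Proof.
move=> m1 m2; have [s sd] := dense_sequence T.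
have [q [q0 qe]] := vanishing_sequence.
apply: (@measurability _ _ Om (borel (T * T)%type) _ _ _ erefl).
move=> _ [U oU <-]; rewrite setTI.
pose b i k : set T := [set y | mdist (s i) y < q k].
have mb i k : measurable (b i k : set (borel T)) by apply: open_borel; exact: open_mball.
pose I := [set p : nat * nat * nat | forall x y, b p.1.1 p.2 x -> b p.1.2 p.2 y -> U (x, y)].
have -> : (fun x => (h1 x, h2 x)) @^-1` U =
   \bigcup_(p in I) (h1 @^-1` b p.1.1 p.2 `&` h2 @^-1` b p.1.2 p.2).
  apply/seteqP; split => x /=; last first.
    by move=> [[[i j] k] /= Ip [/= xi xj]]; exact: Ip.
  move=> Ux; have := oU; rewrite openE => /(_ _ Ux).
  move=> [/= [A B] /= [/nbhs_ballP[r /= r0 rA] /nbhs_ballP[r' /= r'0 rB]] AB].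
  pose e := Num.min r r'; have e0 : 0 < e by rewrite lt_min r0.
  have [k ke] := qe (e / 2) ltac:(by rewrite divr_gt0).
  have [i xi] := sd (h1 x) (q k) (q0 k).
  have [j xj] := sd (h2 x) (q k) (q0 k).
  have er : e <= r by rewrite ge_min lexx.
  have er' : e <= r' by rewrite ge_min lexx orbT.
  exists (i, j, k) => //= a b' /= ia jb; apply: AB; split => /=.
    apply: rA; rewrite ballEmdist /=.
    by have := mdist_tri (s i) (h1 x) a; rewrite (mdistC (h1 x) (s i)); rewrite /b /= in ia; lra.
  apply: rB; rewrite ballEmdist /=.
  by have := mdist_tri (s j) (h2 x) b'; rewrite (mdistC (h2 x) (s j)); rewrite /b /= in jb; lra.
rewrite bigcup_mkcond; apply: countable_bigcupT_measurable; first exact: countableP.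
move=> [[i j] k]; case: ifP => // _.
by apply: measurableI; rewrite -[X in measurable X]setTI; [exact: m1|exact: m2].
Qed.

Lemma measurable_mdist d (Om : measurableType d) T (h1 h2 : Om -> T) :
  measurable_fun setT (h1 : Om -> borel T) ->
  measurable_fun setT (h2 : Om -> borel T) ->
  measurable_fun setT (fun x => mdist (h1 x) (h2 x) : R).
Proof.
move=> m1 m2.
have mf : measurable_fun setT ((fun z : T * T => mdist z.1 z.2) : borel (T * T)%type -> R).
  apply: (measurability _ (RGenOInfty.measurableE R)) => // _ [_ [r ->] <-].
  rewrite setTI; apply: open_borel; rewrite openE => -[x y] /=.
  rewrite in_itv/= andbT => rxy.
  pose e := (mdist x y - r) / 2.
  have e0 : 0 < e by rewrite divr_gt0// subr_gt0.
  exists (ball x e, ball y e); first by split; exact: nbhsx_ballx.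
  move=> [a b'] /=; rewrite !ballEmdist /= in_itv/= andbT => -[xa yb].
  have := mdist_tri a x y; have := mdist_tri b' a y.
  by rewrite (mdistC b'); rewrite /e in xa yb; lra.
exact: (measurableT_comp mf (measurable_pair_borel m1 m2)).
Qed.

End metric_facts.

(** * Divergences *)

Section density.
Local Open Scope ereal_scope.
Context d (Om : measurableType d) (R : realType).
Context (P : {measure set Om -> \bar R}) (w : Om -> R).
Hypotheses (mw : measurable_fun setT w) (w0 : forall x, (0 <= w x)%R).
Hypothesis wfin : \int[P]_x (w x)%:E < +oo.

(** The hypotheses are arguments because the measure and finiteness instances attached to this
    constant depend on them. *)
Definition density_measure (_ : measurable_fun setT w) (_ : forall x, (0 <= w x)%R)
  (_ : \int[P]_x (w x)%:E < +oo) (A : set Om) : \bar R := \int[P]_(x in A) (w x)%:E.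

Local Notation nu := (density_measure mw w0 wfin).

Let nu0 : nu set0 = 0.
Proof. by rewrite /density_measure integral_set0. Qed.

Let nu_ge0 A : 0 <= nu A.
Proof. by apply: integral_ge0 => x _; rewrite lee_fin. Qed.

Let nu_sigma_additive : semi_sigma_additive nu.
Proof.
apply: semi_sigma_additive_nng_induced; first exact/measurable_EFinP.
by move=> x; rewrite lee_fin.
Qed.

HB.instance Definition _ := isMeasure.Build _ _ _ nu
  nu0 nu_ge0 nu_sigma_additive.

Let nu_fin : fin_num_fun nu.
Proof.
move=> A mA; rewrite ge0_fin_numE//; apply: le_lt_trans wfin.
by apply: ge0_subset_integral => //;
  [exact/measurable_EFinP|move=> x _; rewrite lee_fin].
Qed.

HB.instance Definition _ := Measure_isFinite.Build _ _ _ nu nu_fin.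

End density.

(** The source of most plans below. The integration formula changes variables twice: along [h], then
    from the density measure to [P], where [w] agrees almost everywhere with the Radon-Nikodym
    derivative. *)
Lemma weighted_pushforward d d' (Om : measurableType d) (Y : measurableType d')
    (R : realType) (P : {sigma_finite_measure set Om -> \bar R}) (w : Om -> R) (h : Om -> Y) :
  measurable_fun setT w -> (forall x, 0 <= w x) ->
  (\int[P]_x (w x)%:E < +oo)%E -> measurable_fun setT h ->
  exists g : {finite_measure set Y -> \bar R},
    (forall A, measurable A -> g A = \int[P]_(x in h @^-1` A) (w x)%:E)%E /\
    (forall f : Y -> \bar R, measurable_fun setT f -> (forall y, 0 <= f y)%E ->
      \int[g]_y f y = \int[P]_x (f (h x) * (w x)%:E))%E.
Proof.
move=> mw w0 wfin mh.
pose nu : {finite_measure set Om -> \bar R} := density_measure mw w0 wfin.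
exists (image_measure nu measurableT mh); split.
  by move=> A mA; rewrite /= /image_measure setTI.
move=> f mf f0.
have -> : (\int[image_measure nu measurableT mh]_y f y = \int[pushforward nu h]_y f y)%E.
  by apply: eq_measure_integral => A mA _ /=; rewrite /image_measure setTI.
rewrite ge0_integral_pushforward// preimage_setT.
have nuP : nu `<< P.
  apply/null_content_dominatesP => A mA PA.
  rewrite /nu /= /density_measure null_set_integral//.
  by apply/measurable_EFinP; exact: measurable_funTS.
rewrite -(Radon_Nikodym_SigmaFinite.change_of_variables nuP)//; last first.
- exact: measurableT_comp.
- by move=> x /=.
have int_w : P.-integrable setT (EFin \o w).
  apply/integrableP; split; first exact/measurable_EFinP.
  by under eq_integral do rewrite gee0_abs ?lee_fin//.
have ae : ae_eq P setT (Radon_Nikodym_SigmaFinite.f nu P) (EFin \o w).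
  apply: integral_ae_eq => //.
  - exact: Radon_Nikodym_SigmaFinite.f_integrable.
  - exact/measurable_EFinP.
  - by move=> E _ mE; rewrite -Radon_Nikodym_SigmaFinite.f_integral.
have mRN : measurable_fun setT (Radon_Nikodym_SigmaFinite.f nu P).
  exact: measurable_int (Radon_Nikodym_SigmaFinite.f_integrable nuP).
apply: ge0_ae_eq_integral => //.
- by apply: emeasurable_funM => //; exact: measurableT_comp.
- apply: emeasurable_funM; first exact: measurableT_comp.
  exact/measurable_EFinP.
- by move=> x _; rewrite mule_ge0//= ?Radon_Nikodym_SigmaFinite.f_ge0.
- by move=> x _; rewrite mule_ge0// lee_fin.
- by move: ae; apply: filterS => x h1 Dx /=; rewrite h1.
Qed.

Section sum_measure.
Context d (T : measurableType d) (R : realType).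
Variables gamma mu : {finite_measure set T -> \bar R}.

Definition sum_measure : set T -> \bar R := measure_add gamma mu.

HB.instance Definition _ := Measure.on sum_measure.

Let sum_measure_fin : fin_num_fun sum_measure.
Proof.
by move=> A mA; rewrite /sum_measure measure_addE fin_numD !fin_num_measure.
Qed.

HB.instance Definition _ :=
  Measure_isFinite.Build _ _ _ sum_measure sum_measure_fin.

End sum_measure.

Section divergence_facts.
Local Open Scope ereal_scope.
Context d (T : measurableType d) (R : realType).
Implicit Types gamma mu : {finite_measure set T -> \bar R}.

Lemma ge0_integral0_null (la : {measure set T -> \bar R}) (A : set T) (f : T -> \bar R) :
  measurable A -> measurable_fun A f -> (forall x, A x -> 0 < f x) ->
  \int[la]_(x in A) f x = 0 -> la A = 0.
Proof.
move=> mA mf f0 I0.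
have : \int[la]_(x in A) `|f x| = 0.
  rewrite -I0; apply: eq_integral => x /[!inE] Ax.
  by rewrite gee0_abs// ltW// f0.
move=> /(ae_eq_integral_abs _ mA mf)[M [mM M0 AM]].
apply: (subset_measure0 mA mM _ M0) => x Ax; apply: AM => /= /(_ Ax) fx0.
by have := f0 x Ax; rewrite fx0 ltxx.
Qed.

(** [f] is the derivative of [mu] with respect to [gamma + mu]. Its zero set is [mu]-null and
    carries the singular part; off it, [mu]-null sets are null for [gamma + mu] too, so that
    Radon-Nikodym applies a second time. *)
Lemma lebesgue_decomposition_exists gamma mu :
  exists sigma gammaS, lebesgue_decomposition gamma mu sigma gammaS.
Proof.
pose la : {finite_measure set T -> \bar R} := sum_measure gamma mu.
have laE A : la A = gamma A + mu A by exact: measure_addE.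
have mula : mu `<< la.
  apply/null_content_dominatesP => A mA la0; have /eqP : gamma A + mu A = 0 by rewrite -laE.
  by rewrite padde_eq0// => /andP[_ /eqP].
have [f [f0 ffin intf fE]] := radon_nikodym_sigma_finite mula.
have mf : measurable_fun setT f by exact: measurable_int intf.
pose N := [set x | f x = 0].
have mN : measurable N.
  have -> : N = setT `&` [set x | f x = cst 0 x] by rewrite setTI.
  exact: measurable_eqe.
have muN : mu N = 0.
  by rewrite fE//; apply: integral0_eq => x.
have mNC : measurable (~` N) by exact: measurableC.
have gNoo : gamma N < +oo by rewrite ltey_eq fin_num_measure.
have gNCoo : gamma (~` N) < +oo by rewrite ltey_eq fin_num_measure.
pose gs : {finite_measure set T -> \bar R} := mfrestr mN gNoo.
pose ga : {finite_measure set T -> \bar R} := mfrestr mNC gNCoo.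
have gamu : ga `<< mu.
  apply/null_content_dominatesP => A mA muA.
  have mAN : measurable (A `&` ~` N) by exact: measurableI.
  have : la (A `&` ~` N) = 0.
    apply: (@ge0_integral0_null _ _ f) => //.
    - exact: measurable_funTS.
    - by move=> x [_ /eqP fx0]; rewrite lt0e fx0/=.
    - by rewrite -fE//; apply: (subset_measure0 mAN mA _ muA) => x [].
  by rewrite [LHS]laE => /eqP; rewrite padde_eq0// => /andP[/eqP + _].
have [g [g0 gfin intg gE]] := radon_nikodym_sigma_finite gamu.
have mg : measurable_fun setT g by exact: measurable_int intg.
exists (fine \o g), gs; split.
- by apply: measurableT_comp.
- by move=> x /=; rewrite fine_ge0.
- move=> A mA; under eq_integral do rewrite /= fineK//.
  rewrite -gE// /ga /gs /= /mfrestr /mrestr addeC -measureU//.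
  + by rewrite -setIUr setUv setIT.
  + exact: measurableI.
  + exact: measurableI.
  + by rewrite setIACA setICr setI0.
- exists N; split => //.
  by rewrite /gs /= /mfrestr /mrestr setICl measure0.
Qed.

(** Existence rules out the default of [xget]; the later estimates are uniform in the decomposition
    that was selected. *)
Lemma fdivergenceP F gamma mu : exists sigma gammaS,
  lebesgue_decomposition gamma mu sigma gammaS /\
  fdivergence F gamma mu =
    \int[mu]_x F (sigma x) + recession F * gammaS [set: T].
Proof.
rewrite /fdivergence; case: xgetP => [v _ [s [S [h ->]]]|h]; first by exists s, S.
have [s [S hs]] := lebesgue_decomposition_exists gamma mu.
by exfalso; apply: (h (\int[mu]_x F (s x) + recession F * S [set: T])); exists s, S.
Qed.

Section divergence_tv.
Variable F : R -> \bar R.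
Hypothesis mF : measurable_fun setT F.
Hypothesis F_ge : forall s, (0 <= s)%R -> `|s - 1|%:E <= F s.

(** Domination forces the singular part to vanish and the density to be at most 1 almost everywhere,
    and there [F sigma + sigma = 1]. *)
Lemma fdivergence_subdensity gamma mu :
  (forall s, (0 <= s <= 1)%R -> F s = (1 - s)%:E) ->
  (forall A, measurable A -> gamma A <= mu A) ->
  fdivergence F gamma mu + gamma setT = mu setT.
Proof.
move=> F1 le_gm.
have [s [S [[ms s0 dec [N [mN N0 SN]]] ->]]] := fdivergenceP F gamma mu.
have SsetT : S setT = 0.
  rewrite -(setUv N) measureU//; [|exact: measurableC|by rewrite setICr].
  rewrite [X in _ + X]SN adde0; apply/eqP; rewrite -measure_le0.
  have := le_gm N mN; rewrite N0 dec// => /(le_trans _) -> //.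
  by rewrite leeDr//; apply: integral_ge0 => x _; rewrite lee_fin.
rewrite SsetT mule0 adde0.
have msE A : measurable A -> measurable_fun A (EFin \o s).
  by move=> mA; apply/measurable_EFinP; exact: measurable_funTS.
pose A := [set x | (1 < s x)%R].
have mA : measurable A.
  rewrite (_ : A = s @^-1` `]1%R, +oo[); last first.
    by apply/seteqP; split=> x; rewrite /A /= in_itv/= andbT.
  by rewrite -[X in measurable X]setTI; exact: ms.
(* By domination, the integral of [s - 1 > 0] over [A], plus [mu A], is at most [mu A]. *)
have A0 : mu A = 0.
  apply: (@ge0_integral0_null mu A (fun x => (s x - 1)%:E)) => //.
  - by apply/measurable_EFinP; apply: measurable_funB => //; exact: measurable_funTS.
  - by move=> x; rewrite /A /= lte_fin subr_gt0.
  have Afin : mu A \is a fin_num by rewrite fin_num_measure.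
  have : \int[mu]_(x in A) (s x - 1)%:E + mu A <= mu A.
    rewrite -{1}[mu A]mul1e -(integral_cst mu mA) -ge0_integralD//.
    - have := le_gm A mA; rewrite dec// => /(le_trans _); apply.
      rewrite (_ : \int[mu]_(x in A) _ = \int[mu]_(x in A) (s x)%:E) ?leeDl//.
      by apply: eq_integral => x _ /=; rewrite -EFinD subrK.
    - by move=> x; rewrite /A /= lee_fin subr_ge0 => /ltW.
    - by apply/measurable_EFinP; apply: measurable_funB => //; exact: measurable_funTS.
  rewrite -[leRHS]add0e leeD2rE// => h; apply/eqP; rewrite eq_le h/=.
  by apply: integral_ge0 => x; rewrite /A /= lee_fin subr_ge0 => /ltW.
rewrite dec// SsetT adde0 -ge0_integralD//; last 4 first.
- by move=> x _; apply: le_trans (F_ge (s0 x)); rewrite lee_fin.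
- exact: measurableT_comp.
- by move=> x _; rewrite lee_fin.
- exact: msE.
rewrite -[RHS]mul1e -(integral_cst mu measurableT).
apply: ge0_ae_eq_integral => //.
- by apply: emeasurable_funD; [exact: measurableT_comp|exact: msE].
- by move=> x _; rewrite adde_ge0 ?lee_fin//; apply: le_trans (F_ge (s0 x)); rewrite lee_fin.
- exists A; split=> // x /=; rewrite /A /= => h; rewrite ltNge; apply/negP => sx1.
  by apply: h => _; rewrite F1 ?s0// -EFinD subrK.
Qed.

(* u = min(1, 1 / sigma) off the singular set truncates gamma below mu. *)
Lemma fdivergence_truncation gamma mu : 1 <= recession F ->
  exists u : T -> R, [/\ measurable_fun setT u, forall x, (0 <= u x <= 1)%R,
    (forall A, measurable A -> \int[gamma]_(x in A) (u x)%:E <= mu A) &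
    mu setT + 2%:E * \int[gamma]_x (1 - u x)%:E <= fdivergence F gamma mu + gamma setT].
Proof.
move=> F1.
have [s [S [[ms s0 dec [N [mN N0 SN]]] ->]]] := fdivergenceP F gamma mu.
pose u x : R := (\1_(~` N) x / Num.max 1 (s x))%R.
have mx1 x : (1 <= Num.max 1 (s x))%R by rewrite le_max lexx.
have mu_ : measurable_fun setT u.
  apply: measurable_funM; first by apply: measurable_indic; exact: measurableC.
  have mmax : measurable_fun setT (fun x => Num.max 1 (s x))%R by exact: measurable_maxr.
  rewrite (_ : (fun x => _) = (fun x => Num.max 1 (s x) `^ (-1))%R).
    by apply: (measurableT_comp (measurable_powR _)).
  by apply/funext => x; rewrite powR_inv1// (le_trans _ (mx1 x)).
have u01 x : (0 <= u x <= 1)%R.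
  rewrite /u indicE; case: (_ \in _); last by rewrite mul0r lexx ler01.
  rewrite mul1r invr_ge0 (le_trans _ (mx1 x))//= invf_le1//.
  by rewrite (lt_le_trans _ (mx1 x)).
have u0 x : (0 <= u x)%R by have /andP[] := u01 x.
have u1 x : (u x <= 1)%R by have /andP[] := u01 x.
have us x : (~` N) x -> ((1 - u x) * s x = Num.max 0 (s x - 1))%R.
  move=> Nx; rewrite /u indicE mem_set// mul1r.
  rewrite /Num.max; case: ifPn => h1; case: ifPn => h2.
  - by rewrite mulrBl mul1r mulVf// gt_eqF// (lt_trans _ h1).
  - by move: h2; rewrite subr_gt0 h1.
  - by move: h1; rewrite -subr_gt0 h2.
  - by rewrite invr1 subrr mul0r.
have sfin : \int[mu]_x (s x)%:E < +oo.
  have := dec setT measurableT => /esym h.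
  by rewrite (le_lt_trans (_ : _ <= gamma setT)) ?ltey_eq ?fin_num_measure// -h leeDl.
have [nu [nuE nuI]] := @weighted_pushforward _ _ T T R mu s id ms s0 sfin (@measurable_id _ _ setT).
have gammaI f : measurable_fun setT f -> (forall x, 0 <= f x) ->
    \int[gamma]_x f x = \int[mu]_x (f x * (s x)%:E) + \int[S]_x f x.
  move=> mf f0; rewrite -nuI//.
  rewrite -(ge0_integral_measure_add nu S measurableT)//.
  apply: eq_measure_integral => A mA _; rewrite [LHS]dec//.
  transitivity (nu A + S A); first by rewrite nuE.
  exact/esym/measure_addE.
exists u; split => //.
- move=> A mA; rewrite integral_mkcond.
  have mg : measurable_fun setT ((fun x => (u x)%:E) \_ A).
    by apply/(measurable_restrictT _ mA)/measurable_EFinP; exact: measurable_funTS.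
  have ug x : ((fun x => (u x)%:E) \_ A) x = (u x * \1_A x)%:E.
    by rewrite patchE indicE; case: ifP; rewrite ?mulr1 ?mulr0.
  have ug0 x : setT x -> 0 <= ((fun x => (u x)%:E) \_ A) x.
    by move=> _; rewrite ug lee_fin mulr_ge0.
  rewrite gammaI//; last by move=> x; rewrite ug lee_fin mulr_ge0.
  rewrite [X in _ + X](_ : _ = 0) ?adde0; last first.
    rewrite (ge0_negligible_integral (measurableC mN) measurableT mg ug0 SN).
    apply: integral0_eq => x [_ /contrapT Nx]; rewrite ug /u indicE memNset ?mul0r//.

  rewrite -[mu A]mul1e -(integral_cst mu mA) [leRHS]integral_mkcond.
  apply: ge0_le_integral => //.
  + by move=> x Dx; apply: mule_ge0; [exact: ug0|rewrite lee_fin].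
  + by apply: emeasurable_funM => //; exact/measurable_EFinP.
  + by apply/(measurable_restrictT _ mA); exact: measurable_cst.
  move=> x _; rewrite ug patchE -EFinM indicE; case: ifP => // _; last first.
    by rewrite mulr0 mul0r lee_fin.
  rewrite mulr1 lee_fin /u indicE; case: (_ \in _); last by rewrite !mul0r ler01.
  rewrite mul1r mulrC ler_pdivrMr ?(lt_le_trans _ (mx1 x))// mul1r.
  by rewrite le_max lexx orbT.
- have m1u : measurable_fun setT (fun x => (1 - u x)%:E).
    by apply/measurable_EFinP; apply: measurable_funB.
  have u1' x : 0 <= (1 - u x)%:E by rewrite lee_fin subr_ge0.
  rewrite gammaI// muleDr//; last first.
    by rewrite ge0_adde_def// inE ?integral_ge0//; move=> x _; rewrite mule_ge0// lee_fin.
  have hS : \int[S]_x (1 - u x)%:E <= S setT.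
    rewrite -[leRHS]mul1e -(integral_cst S measurableT).
    by apply: ge0_le_integral => // x _; rewrite lee_fin lerBlDr lerDl.
  have hF : \int[mu]_x `|s x - 1|%:E <= \int[mu]_x F (s x).
    apply: ge0_le_integral => //.
    + by apply/measurable_EFinP/measurableT_comp => //; exact: measurable_funB.
    + exact: measurableT_comp.
    + by move=> x _; exact: F_ge.
  have hrec : S setT <= recession F * S setT by rewrite -{1}[S setT]mul1e lee_wpmul2r.
  rewrite dec// addeA -(addeA _ _ (2%:E * _)).
  (* Off [N] this holds pointwise with equality: 1 + 2 max(0, s - 1) = |s - 1| + s. *)
  have key : mu setT + 2%:E * \int[mu]_x ((1 - u x)%:E * (s x)%:E) <=
      \int[mu]_x `|s x - 1|%:E + \int[mu]_x (s x)%:E.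
    have mabs : measurable_fun setT (fun x => `|s x - 1|%:E).
      by apply/measurable_EFinP/measurableT_comp => //; exact: measurable_funB.
    have msE : measurable_fun setT (fun x => (s x)%:E) by exact/measurable_EFinP.
    have sE0 x : setT x -> 0 <= (s x)%:E by rewrite lee_fin.
    have mus : measurable_fun setT (fun x => (1 - u x)%:E * (s x)%:E).
      exact: emeasurable_funM.
    have us0 x : setT x -> 0 <= (1 - u x)%:E * (s x)%:E.
      by move=> Dx; apply: mule_ge0 => //; exact: sE0.
    have m2us : measurable_fun setT (fun x => 2%:E * ((1 - u x)%:E * (s x)%:E)).
      exact: measurable_funeM.
    have us20 x : setT x -> 0 <= 2%:E * ((1 - u x)%:E * (s x)%:E).
      by move=> Dx; apply: mule_ge0 => //; exact: us0.
    rewrite -[mu setT]mul1e -(integral_cst mu measurableT).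
    rewrite -ge0_integralZl// -!ge0_integralD//.
    apply: ae_ge0_le_integral => //.
    - by move=> x Dx; apply: adde_ge0 => //; exact: us20.
    - exact: emeasurable_funD.
    - by move=> x Dx; apply: adde_ge0 => //; exact: sE0.
    - exact: emeasurable_funD.
    exists N; split=> // x /= h; apply: contrapT => Nx; apply: h => _.
    rewrite -!EFinM us// -!EFinD lee_fin.
    have := s0 x; rewrite /Num.max; case: ifPn => hh _.
      by rewrite gtr0_norm//; lra.
    by rewrite ler0_norm; lra.
  (* Of these two copies of the singular mass, one is paid by the recession term and the other is
     part of the mass of [gamma]. *)
  have key2 : 2%:E * \int[S]_x (1 - u x)%:E <= S setT + S setT.
    rewrite -[leRHS](mule_natl _ 2).
    exact: lee_wpmul2l.
  rewrite addeA; apply: (le_trans (leeD key key2)).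
  rewrite addeACA; apply: leeD; apply: leeD => //.
Qed.

End divergence_tv.
End divergence_facts.

Definition mass d (T : measurableType d) (R : realType)
  (mu : {finite_measure set T -> \bar R}) : R := fine (mu setT).

(** * Subplans and transport costs *)

Section mass.
Context d (T : measurableType d) (R : realType) (mu : {finite_measure set T -> \bar R}).

Lemma massE : mu setT = (mass mu)%:E.
Proof. by rewrite /mass fineK// fin_num_measure. Qed.

Lemma mass_ge0 : 0 <= mass mu.
Proof. by rewrite /mass fine_ge0. Qed.

Lemma fin_measureE A : measurable A -> mu A = (fine (mu A))%:E.
Proof. by move=> mA; rewrite fineK// fin_num_measure. Qed.

End mass.

Lemma integral_one d (T : measurableType d) (R : realType)
    (P : {measure set T -> \bar R}) A : measurable A ->
  (\int[P]_(x in A) (cst 1 x : R)%:E = P A)%E.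
Proof. by move=> mA; rewrite -[RHS]mul1e -integral_cst. Qed.

Section plans.
Context (R : realType) (T : polishMetricType R).
Implicit Types (mu nu : fin_borel_measure R T) (g : fin_borel_measure R (T * T)%type).

Definition subplan g mu1 mu2 :=
  (forall A, measurable A -> marginal1 g A <= mu1 A)%E /\
  (forall A, measurable A -> marginal2 g A <= mu2 A)%E.

(* For plans with marginals below mu1 and mu2, the divergences of all the
   entropies considered are the masses left untransported: this says that the
   transport cost between mu1 and mu2 is less than e. *)
Definition coupled mu1 mu2 (e : R) := exists g, subplan g mu1 mu2 /\
  exists2 c : R, (\int[g]_z metric_cost z.1 z.2 <= c%:E)%E &
    mass mu1 + mass mu2 - 2 * mass g + c < e.

Lemma measurable_cost :
  measurable_fun setT ((fun z => metric_cost z.1 z.2) : borel (T * T)%type -> \bar R).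
Proof.
apply/measurable_EFinP.
apply: (@measurable_mdist _ _ (borel (T * T)%type) T fst snd).
  exact: measurable_fst_borel.
exact: measurable_snd_borel.
Qed.

Lemma cost_ge0 (z : T * T) : (0 <= metric_cost z.1 z.2)%E.
Proof. by rewrite lee_fin mdist_ge0. Qed.

Lemma marginal1E g A : marginal1 g A = g (fst @^-1` A).
Proof. by rewrite /marginal1 /= /image_measure setTI. Qed.

Lemma marginal2E g A : marginal2 g A = g (snd @^-1` A).
Proof. by rewrite /marginal2 /= /image_measure setTI. Qed.

Lemma integral_marginal1 g A (f : T -> \bar R) : measurable (A : set (borel T)) ->
  measurable_fun setT (f : borel T -> \bar R) -> (forall x, 0 <= f x)%E ->
  (\int[marginal1 g]_(x in A) f x = \int[g]_(z in fst @^-1` A) f z.1)%E.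
Proof.
move=> mA mf f0; transitivity (\int[pushforward g (fst : _ -> borel T)]_(x in A) f x)%E.
  apply: eq_measure_integral; first exact: measurable_fst_borel.
  by move=> B mB _ /=; rewrite /image_measure setTI.
rewrite ge0_integral_pushforward//; first exact: measurable_fst_borel.
exact: measurable_funTS.
Qed.

Lemma integral_marginal2 g A (f : T -> \bar R) : measurable (A : set (borel T)) ->
  measurable_fun setT (f : borel T -> \bar R) -> (forall x, 0 <= f x)%E ->
  (\int[marginal2 g]_(x in A) f x = \int[g]_(z in snd @^-1` A) f z.2)%E.
Proof.
move=> mA mf f0; transitivity (\int[pushforward g (snd : _ -> borel T)]_(x in A) f x)%E.
  apply: eq_measure_integral; first exact: measurable_snd_borel.
  by move=> B mB _ /=; rewrite /image_measure setTI.
rewrite ge0_integral_pushforward//; first exact: measurable_snd_borel.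
exact: measurable_funTS.
Qed.

(** A plan is presented by two maps from a weighted space; only a lower bound [m] of its mass and an
    upper bound [c] of its cost have to be known. *)
Lemma weighted_coupling d (Om : measurableType d) (P : {sigma_finite_measure set Om -> \bar R})
    (w : Om -> R) (h1 h2 : Om -> T) mu1 mu2 (m c e : R) :
  measurable_fun setT w -> (forall x, 0 <= w x) ->
  measurable_fun setT (h1 : Om -> borel T) ->
  measurable_fun setT (h2 : Om -> borel T) ->
  (forall A, measurable (A : set (borel T)) ->
    \int[P]_(x in h1 @^-1` A) (w x)%:E <= mu1 A)%E ->
  (forall A, measurable (A : set (borel T)) ->
    \int[P]_(x in h2 @^-1` A) (w x)%:E <= mu2 A)%E ->
  (m%:E <= \int[P]_x (w x)%:E)%E ->
  (\int[P]_x (mdist (h1 x) (h2 x) * w x)%:E <= c%:E)%E ->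
  mass mu1 + mass mu2 - 2 * m + c < e ->
  coupled mu1 mu2 e.
Proof.
move=> mw w0 m1 m2 le1 le2 mI cI lte.
have mh := measurable_pair_borel m1 m2.
have wfin : (\int[P]_x (w x)%:E < +oo)%E.
  have := le1 setT measurableT; rewrite preimage_setT => /le_lt_trans; apply.
  by rewrite massE ltry.
have [g [gE gI]] := weighted_pushforward mw w0 wfin mh.
exists g; split; first split.
- by move=> A mA; rewrite marginal1E gE; [exact: le1|rewrite -[X in measurable X]setTI; exact: measurable_fst_borel].
- by move=> A mA; rewrite marginal2E gE; [exact: le2|rewrite -[X in measurable X]setTI; exact: measurable_snd_borel].
exists c.
  rewrite gI; [|exact: measurable_cost|exact: cost_ge0].
  by rewrite (le_trans _ cI)//; under eq_integral do rewrite /= /metric_cost -EFinM.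
apply: le_lt_trans lte; rewrite lerD2r lerB// ler_pM2l//.
by rewrite -lee_fin -massE gE// preimage_setT.
Qed.

Lemma coupled_ext mu1 mu2 nu1 nu2 e :
  (forall A, measurable A -> mu1 A = nu1 A) ->
  (forall A, measurable A -> mu2 A = nu2 A) ->
  coupled mu1 mu2 e -> coupled nu1 nu2 e.
Proof.
move=> E1 E2 [g [[g1 g2] [c gc lte]]]; exists g; split.
  by split=> A mA; [rewrite -E1|rewrite -E2]; [exact: g1|by []|exact: g2|by []].
by exists c => //; move: lte; rewrite /mass E1// E2.
Qed.

Lemma coupled_mono mu1 mu2 e e' : e <= e' -> coupled mu1 mu2 e -> coupled mu1 mu2 e'.
Proof.
by move=> ee' [g [sg [c gc lte]]]; exists g; split => //; exists c => //; exact: lt_le_trans ee'.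
Qed.

Lemma subplan_mass g mu1 mu2 : subplan g mu1 mu2 ->
  mass g <= mass mu1 /\ mass g <= mass mu2.
Proof.
move=> [g1 g2]; split; rewrite -lee_fin -!massE.
  by have := g1 setT measurableT; rewrite marginal1E preimage_setT.
by have := g2 setT measurableT; rewrite marginal2E preimage_setT.
Qed.

Lemma cost_integral_ge0 g (c : R) : (\int[g]_z metric_cost z.1 z.2 <= c%:E)%E -> 0 <= c.
Proof.
by rewrite -lee_fin; apply: le_trans; apply: integral_ge0 => z _; exact: cost_ge0.
Qed.

Lemma coupled_gt0 mu1 mu2 e : coupled mu1 mu2 e -> 0 < e.
Proof.
move=> [g [/subplan_mass[g1 g2] [c /cost_integral_ge0 c0]]]; apply: le_lt_trans; lra.
Qed.

Lemma coupled_mass mu1 mu2 e : coupled mu1 mu2 e -> `|mass mu1 - mass mu2| < e.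
Proof.
move=> [g [/subplan_mass[g1 g2] [c /cost_integral_ge0 c0]]]; apply: le_lt_trans.
by rewrite ler_norml; apply/andP; split; lra.
Qed.

(** The zero plan; the summand 1 makes the inequality strict. *)
Lemma coupled_exists mu1 mu2 : coupled mu1 mu2 (mass mu1 + mass mu2 + 1).
Proof.
apply: (@weighted_coupling _ (borel T) mu1 (cst 0) id id _ _ 0 0) => //.
- by move=> A mA; rewrite integral0_eq.
- by move=> A mA; rewrite integral0_eq.
- by rewrite integral0.
- by rewrite integral0_eq// => x _; rewrite mulr0.
- by lra.
Qed.

Lemma coupled_refl mu e : 0 < e -> coupled mu mu e.
Proof.
move=> e0; apply: (@weighted_coupling _ (borel T) mu (cst 1) id id _ _ (mass mu) 0) => //.
- by move=> A mA; rewrite integral_one.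
- by move=> A mA; rewrite integral_one.
- by rewrite integral_one// -massE.
- by rewrite integral0_eq// => x _; rewrite mdistrr mul0r.
- by lra.
Qed.

Lemma coupled_sym mu1 mu2 e : coupled mu1 mu2 e -> coupled mu2 mu1 e.
Proof.
move=> [g [[g1 g2] [c gc lte]]].
apply: (@weighted_coupling _ (borel (T * T)%type) g (cst 1) snd fst _ _ (mass g) c) => //.
- exact: measurable_snd_borel.
- exact: measurable_fst_borel.
- move=> A mA; have := g2 A mA; rewrite marginal2E integral_one//.
  by rewrite -[X in measurable X]setTI; exact: measurable_snd_borel.
- move=> A mA; have := g1 A mA; rewrite marginal1E integral_one//.
  by rewrite -[X in measurable X]setTI; exact: measurable_fst_borel.
- by rewrite integral_one// -massE.
- by under eq_integral do rewrite mulr1 mdistC.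
- by lra.
Qed.

Lemma cost_markov g (c r : R) : (\int[g]_z metric_cost z.1 z.2 <= c%:E)%E -> 0 < r ->
  let far := [set z : T * T | r <= mdist z.1 z.2] in
  measurable (far : set (borel (T * T)%type)) /\ (g far <= (c / r)%:E)%E.
Proof.
move=> gc r0 far.
have farE : far = setT `&` [set z | (r%:E <= `|metric_cost z.1 z.2|)%E].
  rewrite setTI; apply/seteqP.
  by split=> z; rewrite /far /= lee_fin ger0_norm ?mdist_ge0.
have mfar : measurable (far : set (borel (T * T)%type)).
  rewrite farE; apply: (@measurable_lee _ (borel (T * T)%type)) => //.
  by apply: measurableT_comp => //; exact: measurable_cost.
split=> //; rewrite EFinM lee_pdivlMr// muleC.
have := le_integral_abse g measurableT measurable_cost r0.
rewrite -farE => /le_trans; apply; apply: le_trans gc.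
rewrite le_eqVlt; apply/orP; left; apply/eqP; apply: eq_integral => z _.
by rewrite gee0_abs// cost_ge0.
Qed.

Section entropy.
Variable F : R -> \bar R.
Hypothesis mF : measurable_fun setT F.
Hypothesis F_ge : forall s, 0 <= s -> (`|s - 1|%:E <= F s)%E.
Hypothesis F1 : forall s, 0 <= s <= 1 -> F s = (1 - s)%:E.
Hypothesis Frec : (1 <= recession F)%E.

(** A plan [g] becomes a subplan when weighted by [u1 z.1 * u2 z.2], the truncations of its two
    marginals. The mass lost is at most [l1 + l2], and the divergences pay for each of these twice.
    Conversely a subplan is itself a competitor, whose divergences are the missing masses. *)
Lemma entropy_transport_ltP mu1 mu2 e :
  (entropy_transport F (@metric_cost R T) mu1 mu2 < e%:E)%E <-> coupled mu1 mu2 e.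
Proof.
split.
- move=> /ereal_inf_lt[_ [g _ <-]] lte.
  have [u1 [mu1_ u1_01 u1_le u1_key]] := fdivergence_truncation mF F_ge (marginal1 g) mu1 Frec.
  have [u2 [mu2_ u2_01 u2_le u2_key]] := fdivergence_truncation mF F_ge (marginal2 g) mu2 Frec.
  have mf1 : measurable_fun setT (fst : borel (T * T)%type -> borel T).
    exact: measurable_fst_borel.
  have mf2 : measurable_fun setT (snd : borel (T * T)%type -> borel T).
    exact: measurable_snd_borel.
  have u10 x : 0 <= u1 x by have /andP[] := u1_01 x.
  have u11 x : u1 x <= 1 by have /andP[] := u1_01 x.
  have u20 x : 0 <= u2 x by have /andP[] := u2_01 x.
  have u21 x : u2 x <= 1 by have /andP[] := u2_01 x.
  pose w (z : T * T) := u1 z.1 * u2 z.2.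
  have mv1 : measurable_fun setT ((fun z => u1 z.1) : borel (T * T)%type -> R).
    exact: (measurableT_comp mu1_ mf1).
  have mv2 : measurable_fun setT ((fun z => u2 z.2) : borel (T * T)%type -> R).
    exact: (measurableT_comp mu2_ mf2).
  have mw : measurable_fun setT (w : borel (T * T)%type -> R) by exact: measurable_funM.
  have w0 z : 0 <= w z by rewrite mulr_ge0.
  pose l1 := (\int[marginal1 g]_x (1 - u1 x)%:E)%E.
  pose l2 := (\int[marginal2 g]_x (1 - u2 x)%:E)%E.
  have l10 : (0 <= l1)%E by apply: integral_ge0 => x _; rewrite lee_fin subr_ge0.
  have l20 : (0 <= l2)%E by apply: integral_ge0 => x _; rewrite lee_fin subr_ge0.
  (* Pointwise this is 1 <= u1 u2 + (1 - u1) + (1 - u2), that is, (1 - u1)(1 - u2) >= 0. *)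
  have gw : (g setT <= \int[g]_z (w z)%:E + l1 + l2)%E.
    rewrite /l1 /l2 integral_marginal1//; last 2 first.
      by apply/measurable_EFinP; exact: measurable_funB.
      by move=> x; rewrite lee_fin subr_ge0.
    rewrite integral_marginal2//; last 2 first.
      by apply/measurable_EFinP; exact: measurable_funB.
      by move=> x; rewrite lee_fin subr_ge0.
    have n0 (z : borel (T * T)%type) : setT z -> (0 <= (w z)%:E)%E by rewrite lee_fin.
    have n1 (z : borel (T * T)%type) : setT z -> (0 <= (1 - u1 z.1)%:E)%E.
      by rewrite lee_fin subr_ge0.
    have n2 (z : borel (T * T)%type) : setT z -> (0 <= (1 - u2 z.2)%:E)%E.
      by rewrite lee_fin subr_ge0.
    have n3 (z : borel (T * T)%type) : setT z -> (0 <= (w z)%:E + (1 - u1 z.1)%:E)%E.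
      by move=> Dz; apply: adde_ge0; [exact: n0|exact: n1].
    have n4 (z : borel (T * T)%type) :
        setT z -> (0 <= (w z)%:E + (1 - u1 z.1)%:E + (1 - u2 z.2)%:E)%E.
      by move=> Dz; apply: adde_ge0; [exact: n3|exact: n2].
    have e0 : measurable_fun setT ((fun z => (w z)%:E) : borel (T * T)%type -> \bar R).
      exact/measurable_EFinP.
    have e1 : measurable_fun setT ((fun z => (1 - u1 z.1)%:E) : borel (T * T)%type -> \bar R).
      by apply/measurable_EFinP; exact: measurable_funB.
    have e2 : measurable_fun setT ((fun z => (1 - u2 z.2)%:E) : borel (T * T)%type -> \bar R).
      by apply/measurable_EFinP; exact: measurable_funB.
    have e3 := emeasurable_funD e0 e1.
    have e4 := emeasurable_funD e3 e2.
    rewrite !preimage_setT -[leLHS]mul1e -integral_cst// -!ge0_integralD//.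
    apply: ge0_le_integral => //.
    move=> z _; rewrite lee_fin /w.
    have := u10 z.1; have := u11 z.1; have := u20 z.2; have := u21 z.2; nra.
  have cost0 : (0 <= \int[g]_z metric_cost z.1 z.2)%E.
    by apply: integral_ge0 => z _; exact: cost_ge0.
  have D0 (mu : fin_borel_measure R T) nu : (0 <= fdivergence F nu mu)%E.
    have [s [S [[_ s0 _ _] ->]]] := fdivergenceP F nu mu.
    apply: adde_ge0; last by apply: mule_ge0 => //; exact: le_trans Frec.
    by apply: integral_ge0 => x _; apply: le_trans (F_ge (s0 x)); rewrite lee_fin.
  have WT : (\int[g]_z (w z)%:E <= (mass g)%:E)%E.
    rewrite -massE -[leRHS]mul1e -integral_cst//; apply: ge0_le_integral => //.
    - by move=> z _; rewrite lee_fin.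
    - exact/measurable_EFinP.
    - by move=> z _; rewrite lee_fin /w mulr_ile1.
  have W0 : (0 <= \int[g]_z (w z)%:E)%E by apply: integral_ge0 => z _; rewrite lee_fin.
  move: lte u1_key u2_key gw (D0 mu1 (marginal1 g)) (D0 mu2 (marginal2 g)).
  rewrite marginal1E marginal2E !preimage_setT !massE -/l1 -/l2.
  case W : (\int[g]_z (w z)%:E)%E WT W0 => [W_| |] // WT W0.
  case C : (\int[g]_z metric_cost z.1 z.2)%E cost0 => [c| |] // c0; last first.
    by case: (fdivergence F _ mu1) => [a| |]; case: (fdivergence F _ mu2) => [b| |].
  case: (fdivergence F _ mu1) => [a| |]; case: (fdivergence F _ mu2) => [b| |] //.
  rewrite -!EFinD !lte_fin => lte.
  case: l1 l10 => [l1_| |] // l10; last by rewrite gt0_muley// addey.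
  case: l2 l20 => [l2_| |] // l20; last by move=> _; rewrite gt0_muley// addey.
  rewrite -!EFinM -!EFinD !lee_fin => k1 k2 gw _ _.
  apply: (@weighted_coupling _ (borel (T * T)%type) g w fst snd _ _ W_ c) => //.
  + move=> A mA; apply: le_trans (u1_le A mA).
    rewrite integral_marginal1//; last exact/measurable_EFinP.
    apply: ge0_le_integral => //.
    * by rewrite -[X in measurable X]setTI; exact: mf1.
    * by move=> z _; rewrite lee_fin.
    * by apply/measurable_EFinP; exact: measurable_funTS.
    * by apply/measurable_EFinP; exact: measurable_funTS.
    * by move=> z _; rewrite lee_fin /w ler_piMr.
  + move=> A mA; apply: le_trans (u2_le A mA).
    rewrite integral_marginal2//; last exact/measurable_EFinP.
    apply: ge0_le_integral => //.
    * by rewrite -[X in measurable X]setTI; exact: mf2.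
    * by move=> z _; rewrite lee_fin.
    * by apply/measurable_EFinP; exact: measurable_funTS.
    * by apply/measurable_EFinP; exact: measurable_funTS.
    * by move=> z _; rewrite lee_fin /w ler_piMl.
  + by rewrite W.
  + rewrite -C; apply: ge0_le_integral => //.
    * by move=> z _; rewrite lee_fin mulr_ge0// mdist_ge0.
    * apply/measurable_EFinP; apply: measurable_funM => //.
      exact: (@measurable_mdist _ _ (borel (T * T)%type) T fst snd).
    * exact: measurable_cost.
    * by move=> z _; rewrite lee_fin ler_piMr ?mdist_ge0// mulr_ile1.
  + by lra.
- move=> [g [[g1 g2] [c gc lte]]].
  apply: (@le_lt_trans _ _ (fdivergence F (marginal1 g) mu1 + fdivergence F (marginal2 g) mu2
    + \int[g]_z metric_cost z.1 z.2)%E).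
    by apply: ereal_inf_lbound; exists g.
  have := fdivergence_subdensity mF F_ge F1 g1.
  have := fdivergence_subdensity mF F_ge F1 g2.
  rewrite marginal1E marginal2E !preimage_setT !massE.
  move: (fdivergence F _ mu1) (fdivergence F _ mu2) => [a| |] [b| |] //.
  rewrite -!EFinD => -[hb] [ha].
  apply: (@le_lt_trans _ _ ((a + b)%:E + c%:E)%E); first by rewrite leeD2l.
  by rewrite -EFinD lte_fin; lra.
Qed.
End entropy.
End plans.

(** * The two entropies *)

Section entropies.
Context (R : realType).

Lemma measurable_tv_entropy : measurable_fun setT (@tv_entropy R).
Proof.
by apply/measurable_EFinP/measurableT_comp => //; exact: measurable_funB.
Qed.

Lemma recession_tv_entropy : (1 <= recession (@tv_entropy R))%E.
Proof.
rewrite /recession (_ : lim _ = 1%E) //; apply: cvg_lim => //.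
apply: (@cvg_trans _ ((1 - s^-1)%:E @[s --> +oo%R])).
  apply: near_eq_cvg; near=> s.
  have s1 : 1 < s by near: s; apply: nbhs_pinfty_gt; exact: num_real.
  by rewrite /tv_entropy -EFinM gtr0_norm ?subr_gt0// mulrBl mul1r divff// gt_eqF// (lt_trans _ s1).
apply/cvg_EFin; first by near=> s.
apply/cvgrPdist_lt => e e0; near=> s.
have s0 : 0 < s by near: s; apply: nbhs_pinfty_gt; exact: num_real.
rewrite /= opprB addrC subrK gtr0_norm ?invr_gt0// invf_plt ?posrE//.
Unshelve. all: by end_near. Qed.

Context (n : nat) (n2 : (2 <= n)%N).

Let n1 : (1 : R) < n%:R. Proof. by rewrite ltr1n. Qed.

Lemma approx_entropy_ge (s : R) : 0 <= s -> (`|s - 1|%:E <= approx_entropy n s)%E.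
Proof.
move=> s0; rewrite /approx_entropy lee_fin; case: ifPn => //.
rewrite -ltNge => ns; rewrite ler_pdivlMr ?subr_gt0// gtr0_norm ?subr_gt0 ?(lt_trans n1)//.
by rewrite expr2 ler_pM2l ?subr_gt0 ?(lt_trans n1)// lerD2r ltW.
Qed.

Lemma approx_entropy_le1 (s : R) : 0 <= s <= 1 -> approx_entropy n s = (1 - s)%:E.
Proof.
move=> /andP[s0 s1]; rewrite /approx_entropy (le_trans s1 (ltW n1)).
by rewrite ler0_norm ?subr_le0// opprB.
Qed.

Lemma measurable_approx_entropy : measurable_fun setT (@approx_entropy R n).
Proof.
apply/measurable_EFinP; apply: measurable_fun_ifT.
- exact: measurable_fun_ler.
- by apply: measurableT_comp => //; exact: measurable_funB.
- by apply: measurable_funM => //; apply: measurable_funX; exact: measurable_funB.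
Qed.

Lemma recession_approx_entropy : (1 <= recession (@approx_entropy R n))%E.
Proof.
rewrite /recession (_ : lim _ = +oo%E) ?leey //; apply: cvg_lim => //.
apply/cvgeyPge => A; near=> s.
have sn : n%:R < s by near: s; apply: nbhs_pinfty_gt; exact: num_real.
have s0 : 0 < s by rewrite (lt_trans _ sn)// (lt_trans _ n1).
(* As (s - 1)^2 >= s (s - 2), this threshold yields (s - 1)^2 >= A s (n - 1). *)
have sA : A * (n%:R - 1) + 2 <= s.
  by near: s; apply: nbhs_pinfty_ge; exact: num_real.
rewrite /approx_entropy; case: ifPn => [|_]; first by move=> /le_lt_trans/(_ sn); rewrite ltxx.
rewrite -EFinM lee_fin ler_pdivlMr// ler_pdivlMr ?subr_gt0//.
by nra.
Unshelve. all: by end_near. Qed.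

End entropies.

Section cost_comparison.
Context (R : realType) (T : polishMetricType R).
Implicit Types mu : fin_borel_measure R T.

Lemma piccoli_rossi_ltP mu1 mu2 e :
  (piccoli_rossi mu1 mu2 < e%:E)%E <-> coupled mu1 mu2 e.
Proof.
apply: entropy_transport_ltP => //.
- exact: measurable_tv_entropy.
- by move=> s /andP[s0 s1]; rewrite /tv_entropy ler0_norm ?subr_le0// opprB.
- exact: recession_tv_entropy.
Qed.

Lemma approx_ET_ltP n mu1 mu2 e : (2 <= n)%N ->
  (approx_ET n mu1 mu2 < e%:E)%E <-> coupled mu1 mu2 e.
Proof.
move=> n2; apply: entropy_transport_ltP => //.
- exact: measurable_approx_entropy.
- exact: approx_entropy_ge.
- exact: approx_entropy_le1.
- exact: recession_approx_entropy.
Qed.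

End cost_comparison.

(** * Countable labels and fine partitions *)

Lemma measurable_preimage_nat d (Om : measurableType d) (h : Om -> nat) (B : set nat) :
  measurable_fun setT h -> measurable (h @^-1` B).
Proof. by move=> mh; rewrite -[X in measurable X]setTI; exact: mh. Qed.

Lemma measurable_fun_nat d (Om : measurableType d) (h : Om -> nat) :
  (forall n, measurable (h @^-1` [set n])) -> measurable_fun setT h.
Proof.
move=> mh _ B _; rewrite setTI.
rewrite (_ : h @^-1` B = \bigcup_(n in B) h @^-1` [set n]).
  by apply: bigcup_measurable.
by apply/seteqP; split=> [x Bx|x [n Bn /= ->]] //; exists (h x).
Qed.

Lemma measurable_fun_nat2 d d' (Om : measurableType d) (Y : measurableType d')
    (h1 h2 : Om -> nat) (f : nat -> nat -> Y) :
  measurable_fun setT h1 -> measurable_fun setT h2 ->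
  measurable_fun setT (fun x => f (h1 x) (h2 x)).
Proof.
move=> m1 m2 _ B _; rewrite setTI.
rewrite (_ : _ @^-1` B = \bigcup_(p in [set p : nat * nat | B (f p.1 p.2)])
    (h1 @^-1` [set p.1] `&` h2 @^-1` [set p.2])); last first.
  apply/seteqP; split=> [x Bx|x [[i j] /= Bij [/= -> ->]]] //.
  by exists (h1 x, h2 x).
rewrite bigcup_mkcond; apply: countable_bigcupT_measurable; first exact: countableP.
move=> [i j]; case: ifP => // _.
by apply: measurableI; exact: measurable_preimage_nat.
Qed.

Lemma measurable_fun_nat1 d d' (Om : measurableType d) (Y : measurableType d')
    (h : Om -> nat) (f : nat -> Y) :
  measurable_fun setT h -> measurable_fun setT (fun x => f (h x)).
Proof. by move=> mh; exact: (measurable_fun_nat2 (fun i _ => f i) mh mh). Qed.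

(** The label of [x] is the first index of a dense sequence within [e] of it, so a cell is a ball
    minus finitely many earlier ones. Two points with the same label are less than [2 * e] apart. *)
Lemma fine_labelling (R : realType) (T : polishMetricType R) (e : R) : 0 < e ->
  exists (s : nat -> T) (q : T -> nat),
    measurable_fun setT (q : borel T -> nat) /\ forall x, mdist (s (q x)) x < e.
Proof.
move=> e0; have [s sd] := dense_sequence T.
have ex x : exists n, mdist (s n) x < e by exact: sd.
exists s, (fun x => ex_minn (ex x)); split; last by move=> x; case: ex_minnP.
apply: measurable_fun_nat => n.
have mb m : measurable ([set x | mdist (s m) x < e] : set (borel T)).
  by apply: open_borel; exact: open_mball.
rewrite (_ : _ @^-1` _ = [set x | mdist (s n) x < e] `\`
   \bigcup_(m in [set m | (m < n)%N]) [set x | mdist (s m) x < e]).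
  by apply: (@measurableD _ (borel T)) => //; exact: (@bigcup_measurable _ (borel T)).
apply/seteqP; split => x /=.
  case: ex_minnP => m mx mmin <-; split=> // -[k /= km kx].
  by move: km; rewrite ltnNge mmin.
case: ex_minnP => m mx mmin [nx kx]; apply/eqP; rewrite eqn_leq mmin//= leqNgt.
by apply/negP => mn; apply: kx; exists m.
Qed.

Section plan_gluing.
Context (R : realType) (T : polishMetricType R).
Context (mu2 : fin_borel_measure R T) (q : T -> nat).
Hypothesis mq : measurable_fun setT (q : borel T -> nat).

Definition cell_mass i : R := fine (mu2 (q @^-1` [set i])).
(** As a weight on the product of two plans, it makes their middle coordinates independent given a
    common cell. The inverse of 0 being 0, cells of mass 0 receive no weight. *)
Definition gluing_kernel i j : R := if i == j then (cell_mass i)^-1 else 0.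

Local Notation K := gluing_kernel.
Local Notation M := cell_mass.

Lemma cell_mass_ge0 i : 0 <= M i.
Proof. by rewrite /M fine_ge0. Qed.

Lemma gluing_kernel_ge0 i j : 0 <= K i j.
Proof. by rewrite /K; case: ifP => // _; rewrite invr_ge0 cell_mass_ge0. Qed.

Lemma gluing_kernelC i j : K i j = K j i.
Proof. by rewrite /K eq_sym; case: eqP => // ->. Qed.

Lemma cell_massE i : mu2 (q @^-1` [set i]) = (M i)%:E.
Proof. by rewrite /M -fin_measureE//; exact: measurable_preimage_nat. Qed.

Lemma integral_gluing_kernel d (Om : measurableType d)
    (P : {finite_measure set Om -> \bar R}) (l : Om -> nat) i : measurable_fun setT l ->
  (\int[P]_z (K i (l z))%:E = ((M i)^-1 * fine (P (l @^-1` [set i])))%:E)%E.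
Proof.
move=> ml; have mi : measurable (l @^-1` [set i]) by exact: measurable_preimage_nat.
rewrite EFinM -fin_measureE// -(setIT (l @^-1` [set i])) -integral_indic//.
rewrite -ge0_integralZl//; last 2 first.
  by apply/measurable_EFinP; exact: measurable_indic.
  by rewrite lee_fin invr_ge0 cell_mass_ge0.
apply: eq_integral => z _; rewrite -EFinM /K indicE.
by case: eqP => [->|il]; [rewrite mem_set ?mulr1|rewrite memNset ?mulr0// => /esym].
Qed.

Lemma mass_fraction d (Om : measurableType d)
    (P : {finite_measure set Om -> \bar R}) (l : Om -> nat) i :
  (P (l @^-1` [set i]) <= mu2 (q @^-1` [set i]))%E -> measurable_fun setT l ->
  0 <= (M i)^-1 * fine (P (l @^-1` [set i])) <= 1.
Proof.
move=> le ml; rewrite mulr_ge0 ?invr_ge0 ?cell_mass_ge0 ?fine_ge0//=.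
move: le; rewrite cell_massE [X in (X <= _)%E]fin_measureE ?lee_fin; last exact: measurable_preimage_nat.
have [->|M0] := eqVneq (M i) 0; first by rewrite invr0 mul0r ler01.
by move=> le; rewrite mulrC ler_pdivrMr ?mul1r// lt_neqAle eq_sym M0 cell_mass_ge0.
Qed.

(** Each cell contributes [M i] times the ratio of its [g]-mass to [M i]; the sum over the cells is
    carried out by Fubini for the kernel. *)
Lemma integral_cell_fraction (g : fin_borel_measure R (T * T)%type) :
  (forall A, measurable A -> marginal1 g A <= mu2 A)%E ->
  (\int[mu2]_y ((M (q y))^-1 * fine (g ((fun z => q z.1) @^-1` [set q y])))%:E
    = g setT)%E.
Proof.
move=> g1.
have ml : measurable_fun setT ((fun z => q z.1) : borel (T * T)%type -> nat).
  by apply: (measurableT_comp mq); exact: measurable_fst_borel.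
transitivity (\int[mu2]_y \int[g]_z (K (q y) (q z.1))%:E)%E.
  by apply: eq_integral => y _; rewrite integral_gluing_kernel.
rewrite (@fubini_tonelli _ _ (borel T) (borel (T * T)%type) R mu2 g (fun w => (K (q w.1) (q w.2.1))%:E))/=; last 2 first.
- apply/measurable_EFinP; apply: measurable_fun_nat2.
    by apply: (measurableT_comp mq); exact: measurable_fst.
  by apply: (measurableT_comp ml); exact: measurable_snd.
- by move=> w; rewrite lee_fin gluing_kernel_ge0.
transitivity (\int[g]_z ((M (q z.1))^-1 * M (q z.1))%:E)%E.
  apply: eq_integral => z _; under eq_integral do rewrite gluing_kernelC.
  by rewrite integral_gluing_kernel.
have mI : measurable_fun setT ((fun z => ((M (q z.1))^-1 * M (q z.1))%:E) : borel (T * T)%type -> \bar R).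
  by apply/measurable_EFinP; exact: (measurable_fun_nat1 (fun i => (M i)^-1 * M i)).
rewrite -[RHS]integral_one//; apply: ge0_ae_eq_integral => //.
- exact/measurable_EFinP.
- by move=> z _; rewrite lee_fin mulr_ge0 ?invr_ge0 ?cell_mass_ge0.
(* The product of [M] and its inverse differs from 1 only on cells of mass 0. Their union is
   [mu2]-null, hence null for the first marginal of [g]. *)
pose Z := q @^-1` [set i | M i = 0].
have mZ : measurable (Z : set (borel T)) by exact: measurable_preimage_nat.
have Z0 : mu2 Z = 0%E.
  rewrite (_ : Z = \bigcup_(i in [set i | M i = 0]) q @^-1` [set i]); last first.
    by apply/seteqP; split=> [x Zx|x [i Mi /= qi]]; [exists (q x)|rewrite /Z /= qi].
  rewrite measure_bigcup//.
  - by apply: eseries0 => i _; rewrite inE /= => Mi; rewrite cell_massE Mi.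
  - by move=> i _; exact: measurable_preimage_nat.
  - by apply/trivIsetP => i j _ _ ij; apply/seteqP; split=> // x [/= qi qj]; move: ij; rewrite -qi -qj eqxx.
exists (fst @^-1` Z); split.
- by rewrite -[X in measurable X]setTI; exact: measurable_fst_borel.
- by apply/eqP; rewrite -measure_le0; have := g1 Z mZ; rewrite marginal1E Z0.
- move=> z /= h; apply: contrapT => /eqP M0; apply: h => _.
  by rewrite mulVf.
Qed.

End plan_gluing.

Lemma indic_ge0 (R : realType) T (A : set T) x : 0 <= \1_A x :> R.
Proof. by rewrite indicE. Qed.

(** * Gluing of plans *)

Section finite_product.
Local Open Scope ereal_scope.
Context d1 d2 (T1 : measurableType d1) (T2 : measurableType d2) (R : realType).
Variable m1 : {finite_measure set T1 -> \bar R}.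
Variable m2 : {finite_measure set T2 -> \bar R}.

(* The library makes products of finite measures sigma-finite only. *)
Definition finite_product : set (T1 * T2) -> \bar R := m1 \x m2.

HB.instance Definition _ := Measure.on finite_product.

Let finite_product_fin : fin_num_fun finite_product.
Proof.
move=> A mA; rewrite ge0_fin_numE//.
apply: (@le_lt_trans _ _ (finite_product setT)).
  by apply: le_measure; rewrite ?inE.
rewrite /finite_product -setXTT product_measure1E//.
by rewrite ltey_eq fin_numM ?fin_num_measure.
Qed.

HB.instance Definition _ :=
  Measure_isFinite.Build _ _ _ finite_product finite_product_fin.

End finite_product.

Section coupled_triangle.
Context (R : realType) (T : polishMetricType R).
Context (mu1 mu2 mu3 : fin_borel_measure R T) (g12 g23 : fin_borel_measure R (T * T)%type).
Hypothesis sub12 : subplan g12 mu1 mu2.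
Hypothesis sub23 : subplan g23 mu2 mu3.
Context (q : T -> nat).
Hypothesis mq : measurable_fun setT (q : borel T -> nat).

Local Notation M := (cell_mass mu2 q).
Local Notation K := (gluing_kernel mu2 q).

Let H12 i : R := (M i)^-1 * fine (g12 ((fun z => q z.2) @^-1` [set i])).
Let H23 i : R := (M i)^-1 * fine (g23 ((fun z => q z.1) @^-1` [set i])).

Let mq1 : measurable_fun setT ((fun z => q z.1) : borel (T * T)%type -> nat).
Proof. by apply: (measurableT_comp mq); exact: measurable_fst_borel. Qed.

Let mq2 : measurable_fun setT ((fun z => q z.2) : borel (T * T)%type -> nat).
Proof. by apply: (measurableT_comp mq); exact: measurable_snd_borel. Qed.

Let H12_01 i : 0 <= H12 i <= 1.
Proof.
apply: mass_fraction => //.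
have := sub12.2 (q @^-1` [set i]) (measurable_preimage_nat [set i] mq).
by rewrite marginal2E.
Qed.

Let H23_01 i : 0 <= H23 i <= 1.
Proof.
apply: mass_fraction => //.
have := sub23.1 (q @^-1` [set i]) (measurable_preimage_nat [set i] mq).
by rewrite marginal1E.
Qed.

Let P := (g12 \x g23)%E.
Let w (x : borel (T * T)%type * borel (T * T)%type) : R := K (q x.1.2) (q x.2.1).

Let w0 x : 0 <= w x. Proof. exact: gluing_kernel_ge0. Qed.

Let mw : measurable_fun setT w.
Proof.
apply: measurable_fun_nat2.
  by apply: (measurableT_comp mq2); exact: measurable_fst.
by apply: (measurableT_comp mq1); exact: measurable_snd.
Qed.

(** Integrating out the second plan leaves the factor [H23], the share of the middle cell that [g23]
    transports. *)
Lemma glued_integral1 (f : T * T -> R) :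
  measurable_fun setT (f : borel (T * T)%type -> R) -> (forall z, 0 <= f z) ->
  (\int[P]_x (f x.1 * w x)%:E = \int[g12]_z (f z * H23 (q z.2))%:E)%E.
Proof.
move=> mf f0.
rewrite (@fubini_tonelli1 _ _ (borel (T * T)%type) (borel (T * T)%type) R g12 g23)//; last 2 first.
- apply/measurable_EFinP; apply: measurable_funM => //.
  by apply: (measurableT_comp mf); exact: measurable_fst.
- by move=> x; rewrite lee_fin mulr_ge0.
apply: eq_integral => z _; rewrite /fubini_F /= /w /=.
under eq_integral do rewrite EFinM.
rewrite ge0_integralZl_EFin//; last 2 first.
- by move=> y _; rewrite lee_fin gluing_kernel_ge0.
- by apply/measurable_EFinP; exact: (measurable_fun_nat1 (fun i => K (q z.2) i) mq1).
by rewrite integral_gluing_kernel.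
Qed.

Lemma glued_integral2 (f : T * T -> R) :
  measurable_fun setT (f : borel (T * T)%type -> R) -> (forall z, 0 <= f z) ->
  (\int[P]_x (f x.2 * w x)%:E = \int[g23]_z (f z * H12 (q z.1))%:E)%E.
Proof.
move=> mf f0.
rewrite (@fubini_tonelli2 _ _ (borel (T * T)%type) (borel (T * T)%type) R g12 g23)//; last 2 first.
- apply/measurable_EFinP; apply: measurable_funM => //.
  by apply: (measurableT_comp mf); exact: measurable_snd.
- by move=> x; rewrite lee_fin mulr_ge0.
apply: eq_integral => z _; rewrite /fubini_G /= /w /=.
under eq_integral do rewrite gluing_kernelC EFinM.
rewrite ge0_integralZl_EFin//; last 2 first.
- by move=> y _; rewrite lee_fin gluing_kernel_ge0.
- by apply/measurable_EFinP; exact: (measurable_fun_nat1 (fun i => K (q z.1) i) mq2).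
by rewrite integral_gluing_kernel.
Qed.

Lemma glued_integral1_le (f : T * T -> R) :
  measurable_fun setT (f : borel (T * T)%type -> R) -> (forall z, 0 <= f z) ->
  (\int[P]_x (f x.1 * w x)%:E <= \int[g12]_z (f z)%:E)%E.
Proof.
move=> mf f0; rewrite glued_integral1//; apply: ge0_le_integral => //.
- by move=> z _; rewrite lee_fin mulr_ge0//; have /andP[] := H23_01 (q z.2).
- by apply/measurable_EFinP; apply: measurable_funM => //; exact: (measurable_fun_nat1 H23 mq2).
- exact/measurable_EFinP.
- by move=> z _; rewrite lee_fin ler_piMr//; have /andP[] := H23_01 (q z.2).
Qed.

Lemma glued_integral2_le (f : T * T -> R) :
  measurable_fun setT (f : borel (T * T)%type -> R) -> (forall z, 0 <= f z) ->
  (\int[P]_x (f x.2 * w x)%:E <= \int[g23]_z (f z)%:E)%E.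
Proof.
move=> mf f0; rewrite glued_integral2//; apply: ge0_le_integral => //.
- by move=> z _; rewrite lee_fin mulr_ge0//; have /andP[] := H12_01 (q z.1).
- by apply/measurable_EFinP; apply: measurable_funM => //; exact: (measurable_fun_nat1 H12 mq1).
- exact/measurable_EFinP.
- by move=> z _; rewrite lee_fin ler_piMr//; have /andP[] := H12_01 (q z.1).
Qed.

(** Inclusion-exclusion inside [mu2]: the part of [g12] that is not continued is the integral of
    [1 - H23], which is at most the integral against [mu2], namely [mass mu2 - mass g23]. *)
Lemma glued_mass_ge : ((mass g12 + mass g23 - mass mu2)%:E <= \int[P]_x (w x)%:E)%E.
Proof.
have -> : (\int[P]_x (w x)%:E = \int[g12]_z (H23 (q z.2))%:E)%E.
  transitivity (\int[P]_x (cst 1 x.1 * w x)%:E)%E.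
    by apply: eq_integral => x _; rewrite mul1r.
  rewrite glued_integral1//; by apply: eq_integral => x _; rewrite mul1r.
have mH : measurable_fun setT ((fun y => (H23 (q y))%:E) : borel T -> \bar R).
  by apply/measurable_EFinP; exact: (measurable_fun_nat1 H23 mq).
have mH2 : measurable_fun setT ((fun z => (H23 (q z.2))%:E) : borel (T * T)%type -> \bar R).
  by apply/measurable_EFinP; exact: (measurable_fun_nat1 H23 mq2).
have m1H : measurable_fun setT ((fun y => (1 - H23 (q y))%:E) : borel T -> \bar R).
  by apply/measurable_EFinP; exact: (measurable_fun_nat1 (fun i => 1 - H23 i) mq).
have m1H2 : measurable_fun setT ((fun z => (1 - H23 (q z.2))%:E) : borel (T * T)%type -> \bar R).
  by apply/measurable_EFinP; exact: (measurable_fun_nat1 (fun i => 1 - H23 i) mq2).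
have n0 i : (0 <= (H23 i)%:E)%E by rewrite lee_fin; have /andP[] := H23_01 i.
have n1 i : (0 <= (1 - H23 i)%:E)%E by rewrite lee_fin subr_ge0; have /andP[] := H23_01 i.
have E1 : (\int[g12]_z (1 - H23 (q z.2))%:E + \int[g12]_z (H23 (q z.2))%:E = g12 setT)%E.
  rewrite -ge0_integralD// -[RHS]integral_one//.
  by apply: eq_integral => z _; rewrite -EFinD subrK.
have E2 : (\int[mu2]_y (1 - H23 (q y))%:E + \int[mu2]_y (H23 (q y))%:E = mu2 setT)%E.
  rewrite -ge0_integralD// -[RHS]integral_one//.
  by apply: eq_integral => z _; rewrite -EFinD subrK.
have E3 : (\int[g12]_z (1 - H23 (q z.2))%:E <= \int[mu2]_y (1 - H23 (q y))%:E)%E.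
  have := @integral_marginal2 _ _ g12 setT (fun y => (1 - H23 (q y))%:E) measurableT m1H (fun y => n1 (q y)).
  rewrite preimage_setT => <-.
  by apply: ge0_le_measure_integral => //; exact: sub12.2.
have := integral_cell_fraction mq sub23.1; rewrite -/(H23 _) => E4.
rewrite E4 in E2; move: E1 E2 E3; rewrite !massE.
have : (0 <= \int[g12]_z (H23 (q z.2))%:E)%E by apply: integral_ge0.
have : (0 <= \int[g12]_z (1 - H23 (q z.2))%:E)%E by apply: integral_ge0.
have : (0 <= \int[mu2]_y (1 - H23 (q y))%:E)%E by apply: integral_ge0.
case: (\int[mu2]_y (1 - H23 (q y))%:E)%E => [a| |] //.
case: (\int[g12]_z (1 - H23 (q z.2))%:E)%E => [b| |] //.
case: (\int[g12]_z (H23 (q z.2))%:E)%E => [c| |] // _ _ _.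
rewrite -!EFinD => -[E1] [E2]; rewrite !lee_fin; lra.
Qed.

End coupled_triangle.

(** By the bound on the glued mass, the masses left untransported by the two plans add up. So do the
    costs, up to the distance of two middle points in a common cell, less than [2 * eps]. *)
Lemma coupled_triangle (R : realType) (T : polishMetricType R)
    (mu1 mu2 mu3 : fin_borel_measure R T) a b :
  coupled mu1 mu2 a -> coupled mu2 mu3 b -> coupled mu1 mu3 (a + b).
Proof.
move=> [g12 [sub12 [c12 c12P lta]]] [g23 [sub23 [c23 c23P ltb]]].
(* The slack of the two strict inequalities, which pays for the cell diameters. The [+ 1] in the
   definition of [eps] allows for a zero plan. *)
pose dl := (a - (mass mu1 + mass mu2 - 2 * mass g12 + c12)) +
  (b - (mass mu2 + mass mu3 - 2 * mass g23 + c23)).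
have dl0 : 0 < dl by rewrite addr_gt0// subr_gt0.
pose eps := dl / (4 * (mass g12 + 1)).
have g0 := mass_ge0 g12.
have eps0 : 0 < eps by rewrite divr_gt0// mulr_gt0//; lra.
have eps_lt : 2 * eps * mass g12 < dl.
  have e : eps * (4 * (mass g12 + 1)) = dl.
    by rewrite /eps divfK// mulf_neq0// gt_eqF//; lra.
  by rewrite -e; nra.
have [s [q [mq sq]]] := fine_labelling T eps0.
pose w (x : borel (T * T)%type * borel (T * T)%type) : R := gluing_kernel mu2 q (q x.1.2) (q x.2.1).
have mf1 : measurable_fun setT (fst : borel (T * T)%type -> borel T).
  exact: measurable_fst_borel.
have mf2 : measurable_fun setT (snd : borel (T * T)%type -> borel T).
  exact: measurable_snd_borel.
have w0 x : 0 <= w x by exact: gluing_kernel_ge0.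
have mw : measurable_fun setT w.
  apply: measurable_fun_nat2.
    by apply: (measurableT_comp mq); apply: (measurableT_comp mf2); exact: measurable_fst.
  by apply: (measurableT_comp mq); apply: (measurableT_comp mf1); exact: measurable_snd.
have mdz : measurable_fun setT ((fun z => mdist z.1 z.2) : borel (T * T)%type -> R).
  exact: (@measurable_mdist _ _ (borel (T * T)%type) T fst snd).
have mh1 : measurable_fun setT ((fun x => x.1.1) : (borel (T * T)%type * borel (T * T)%type)%type -> borel T).
  by apply: (measurableT_comp mf1); exact: measurable_fst.
have mh2 : measurable_fun setT ((fun x => x.2.2) : (borel (T * T)%type * borel (T * T)%type)%type -> borel T).
  by apply: (measurableT_comp mf2); exact: measurable_snd.
pose Om : measurableType _ := (borel (T * T)%type * borel (T * T)%type)%type.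
pose P : {finite_measure set Om -> \bar R} :=
  finite_product g12 g23.
apply: (@weighted_coupling _ _ _ _ P w (fun x => x.1.1) (fun x => x.2.2)
  _ _ (mass g12 + mass g23 - mass mu2) (c12 + c23 + 2 * eps * mass g12)) => //.
- move=> A mA; rewrite integral_mkcond.
  have mA1 : measurable ((fst : borel (T * T)%type -> borel T) @^-1` A).
    by rewrite -[X in measurable X]setTI; exact: mf1.
  rewrite (eq_integral (fun x : Om => (\1_(fst @^-1` A) x.1 * w x)%:E)); last first.
    move=> x _; rewrite patchE indicE.
    have -> : (x.1 \in fst @^-1` A) = (x \in (fun y : Om => y.1.1) @^-1` A) by [].
    by case: ifP => _; rewrite ?mul1r ?mul0r.
  have h := glued_integral1_le g12 sub23 mq (measurable_indic mA1) (fun z => indic_ge0 _ _ z).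
  apply: (le_trans h).
  by rewrite integral_indic// setIT; have := sub12.1 A mA; rewrite marginal1E.
- move=> A mA; rewrite integral_mkcond.
  have mA1 : measurable ((snd : borel (T * T)%type -> borel T) @^-1` A).
    by rewrite -[X in measurable X]setTI; exact: mf2.
  rewrite (eq_integral (fun x : Om => (\1_(snd @^-1` A) x.2 * w x)%:E)); last first.
    move=> x _; rewrite patchE indicE.
    have -> : (x.2 \in snd @^-1` A) = (x \in (fun y : Om => y.2.2) @^-1` A) by [].
    by case: ifP => _; rewrite ?mul1r ?mul0r.
  have h := glued_integral2_le g23 sub12 mq (measurable_indic mA1) (fun z => indic_ge0 _ _ z).
  apply: (le_trans h).
  by rewrite integral_indic// setIT; have := sub23.2 A mA; rewrite marginal2E.
- exact: (glued_mass_ge sub12 sub23 mq).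
- have e1 : measurable_fun setT (fun x : Om =>
      (mdist x.1.1 x.1.2 * w x)%:E).
    apply/measurable_EFinP; apply: measurable_funM => //.
    by apply: (measurableT_comp mdz); exact: measurable_fst.
  have e2 : measurable_fun setT (fun x : Om =>
      (mdist x.2.1 x.2.2 * w x)%:E).
    apply/measurable_EFinP; apply: measurable_funM => //.
    by apply: (measurableT_comp mdz); exact: measurable_snd.
  have e3 : measurable_fun setT (fun x => (2 * eps * w x)%:E).
    by apply/measurable_EFinP; apply: measurable_funM.
  apply: (@le_trans _ _ (\int[P]_x ((mdist x.1.1 x.1.2 * w x)%:E +
      (mdist x.2.1 x.2.2 * w x)%:E + (2 * eps * w x)%:E))%E).
    apply: ge0_le_integral => //.
    + by move=> x _; rewrite lee_fin mulr_ge0// mdist_ge0.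
    + apply/measurable_EFinP; apply: measurable_funM => //.
      exact: measurable_mdist.
    + by apply: emeasurable_funD => //; apply: emeasurable_funD.
    move=> x _; rewrite -!EFinD lee_fin -!mulrDl.
    rewrite /w /gluing_kernel; case: eqP => [qx|_]; last by rewrite !mulr0.
    rewrite ler_wpM2r ?invr_ge0 ?cell_mass_ge0//.
    have := mdist_tri x.1.2 x.1.1 x.2.2; have := mdist_tri x.2.1 x.1.2 x.2.2.
    have := mdist_tri (s (q x.1.2)) x.1.2 x.2.1.
    have := sq x.1.2; have := sq x.2.1; rewrite -qx (mdistC x.1.2 (s _)); lra.
  have n1 (x : Om) : setT x -> (0 <= (mdist x.1.1 x.1.2 * w x)%:E)%E.
    by rewrite lee_fin mulr_ge0// mdist_ge0.
  have n2 (x : Om) : setT x -> (0 <= (mdist x.2.1 x.2.2 * w x)%:E)%E.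
    by rewrite lee_fin mulr_ge0// mdist_ge0.
  have n12 (x : Om) : setT x ->
      (0 <= (mdist x.1.1 x.1.2 * w x)%:E + (mdist x.2.1 x.2.2 * w x)%:E)%E.
    by move=> Dx; apply: adde_ge0; [exact: n1|exact: n2].
  have n3 (x : Om) : setT x -> (0 <= (2 * eps * w x)%:E)%E.
    by move=> _; rewrite lee_fin; apply: mulr_ge0 => //; apply: mulr_ge0 => //; exact: ltW.
  have e12 := emeasurable_funD e1 e2.
  rewrite !ge0_integralD//.
  rewrite !EFinD; apply: leeD; first apply: leeD.
  + exact: le_trans (glued_integral1_le g12 sub23 mq mdz (fun z => mdist_ge0 _ _)) c12P.
  + exact: le_trans (glued_integral2_le g23 sub12 mq mdz (fun z => mdist_ge0 _ _)) c23P.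
  + apply: (le_trans (glued_integral1_le g12 sub23 mq (f := cst (2 * eps)) _ _)) => //.
      by move=> _ /=; rewrite mulr_ge0// ltW.
    have -> : (\int[g12]_z (cst (2 * eps) z)%:E = (2 * eps)%:E * g12 setT)%E.
      exact: (integral_cst g12 measurableT (2 * eps)%:E).
    by rewrite massE.
- rewrite /dl in eps_lt; lra.
Qed.

(** * Gluing of metric spaces *)

Section completion.
Context (R : realType) (I : Type) (i0 : I) (p : I -> I -> R).
Hypothesis prr : forall i, p i i = 0.
Hypothesis psym : forall i j, p i j = p j i.
Hypothesis ptri : forall j i k, p i k <= p i j + p j k.
Hypothesis psep : exists s : nat -> I, forall i (e : R), 0 < e -> exists n, p i (s n) < e.

Let plip i i' j : `|p i j - p i' j| <= p i i'.
Proof.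
have h1 := ptri i' i j; have h2 := ptri i i' j; rewrite (psym i' i) in h2.
by rewrite ler_distl; lra.
Qed.

(* Completion: the uniform closure of the distance functions p i. *)
Record kuratowski := Kuratowski {
  kur_fun :> I -> R ;
  kur_close : forall e : R, 0 < e -> exists i, forall j, `|kur_fun j - p i j| <= e }.

HB.instance Definition _ := gen_eqMixin kuratowski.
HB.instance Definition _ := gen_choiceMixin kuratowski.

Lemma kur_embed_close i (e : R) : 0 < e -> exists i', forall j, `|p i j - p i' j| <= e.
Proof. by move=> e0; exists i => j; rewrite subrr normr0 ltW. Qed.

Definition kur_embed i := Kuratowski (kur_embed_close i).

HB.instance Definition _ := isPointed.Build kuratowski (kur_embed i0).

Definition kur_dist (f g : kuratowski) : R := sup (range (fun j => `|f j - g j|)).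

Let kur_has_sup (f g : kuratowski) : has_sup (range (fun j => `|f j - g j|)).
Proof.
split; first by exists `|f i0 - g i0|, i0.
have [i fi] := kur_close f ltr01; have [i' gi] := kur_close g ltr01.
exists (2 + p i i') => _ [j _ <-].
have := fi j; have := gi j; have := plip i i' j; rewrite !ler_distl; lra.
Qed.

Lemma kur_dist_ge (f g : kuratowski) j : `|f j - g j| <= kur_dist f g.
Proof. by apply: (ub_le_sup (kur_has_sup f g).2); exists j. Qed.

Lemma kur_dist_le (f g : kuratowski) c :
  (forall j, `|f j - g j| <= c) -> kur_dist f g <= c.
Proof. by move=> h; apply: ge_sup; [exact: (kur_has_sup f g).1|move=> _ [j _ <-]]. Qed.

Let kur_distrr f : kur_dist f f = 0.
Proof.
apply/eqP; rewrite eq_le; apply/andP; split.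
  by apply: kur_dist_le => j; rewrite subrr normr0.
exact: le_trans (kur_dist_ge f f i0).
Qed.

Let kur_dist_eq0 f g : kur_dist f g = 0 -> f = g.
Proof.
move=> fg0; case: f g fg0 => [f fP] [g gP] fg0.
have fg : f = g.
  apply/funext => j; apply/eqP; rewrite -subr_eq0 -normr_le0 -fg0.
  exact: (kur_dist_ge (Kuratowski fP) (Kuratowski gP) j).
by subst g; congr Kuratowski; exact: Prop_irrelevance.
Qed.

Let kur_distC f g : kur_dist f g = kur_dist g f.
Proof. by rewrite /kur_dist; congr sup; apply: eq_imagel => j _ /=; rewrite distrC. Qed.

Let kur_dist_tri g f h : kur_dist f h <= kur_dist f g + kur_dist g h.
Proof.
apply: kur_dist_le => j; apply: le_trans (ler_distD (g j) _ _) _.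
by apply: lerD; exact: kur_dist_ge.
Qed.

HB.instance Definition _ := @isMetric.Build R kuratowski kur_dist
  kur_distrr kur_dist_eq0 kur_distC kur_dist_tri.

Let kur_mdist (f g : kuratowski) : mdist f g = kur_dist f g. Proof. by []. Qed.

Let kur_complete (F : set_system kuratowski) :
  ProperFilter F -> cauchy F -> cvg F.
Proof.
move=> FF Fc.
have Fex (e : R) : 0 < e -> exists f : kuratowski, F [set g | kur_dist f g < e].
  by move=> e0; have [f Ff] := (cauchyP F).1 Fc e e0; exists f; move: Ff; rewrite ballEmdist.
have Fj j : cvg ((fun f : kuratowski => f j) @ F).
  apply/cauchy_cvgP/cauchy_exP => e e0; have [f Ff] := Fex e e0.
  exists (f j); change (F [set g : kuratowski | ball (f j) e (g j)]).
  apply: filterS Ff => g /= fg.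
  by rewrite -ball_normE /=; exact: le_lt_trans (kur_dist_ge f g j) fg.
pose l j := lim ((fun f : kuratowski => f j) @ F).
(* The bound is uniform in [j], which turns pointwise limits into limits for [kur_dist]. *)
have l_close (f : kuratowski) e : F [set g | kur_dist f g < e] -> forall j, `|f j - l j| <= e.
  move=> Ff j; apply/ler_addgt0Pl => d d0.
  have Fd : F [set g : kuratowski | `|l j - g j| < d].
    by have /cvgrPdist_lt/(_ _ d0) := Fj j.
  have [g [/= fg gl]] := @filter_ex _ F FF _ (@filterI _ F FF _ _ Ff Fd).
  have := kur_dist_ge f g j; rewrite distrC in gl.
  have := ler_distD (g j) (f j) (l j); lra.
have lP e : 0 < e -> exists i, forall j, `|l j - p i j| <= e.
  move=> e0; have e20 : 0 < e / 2 by rewrite divr_gt0.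
  have [f Ff] := Fex _ e20; have [i fi] := kur_close f e20.
  exists i => j; have := l_close _ _ Ff j; rewrite distrC.
  have := fi j; have := ler_distD (f j) (l j) (p i j); lra.
apply/cvg_ex; exists (Kuratowski lP).
apply/metricType_numDomainType.fcvgrPdist_lt => e e0.
have e30 : 0 < e / 3 by rewrite divr_gt0.
have [f Ff] := Fex _ e30.
have h : kur_dist (Kuratowski lP) f <= e / 3.
  by apply: kur_dist_le => j /=; rewrite distrC; exact: (l_close f (e / 3) Ff j).
apply: filterS Ff => g /= fg.
by rewrite kur_mdist; have := kur_dist_tri f (Kuratowski lP) g; lra.
Qed.

HB.instance Definition _ := Uniform_isComplete.Build kuratowski kur_complete.

Lemma kur_embedE i j : mdist (kur_embed i) (kur_embed j) = p i j.
Proof.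
rewrite kur_mdist; apply/eqP; rewrite eq_le; apply/andP; split.
  by apply: kur_dist_le => k /=; exact: plip.
by apply: le_trans (kur_dist_ge _ _ j) => /=; rewrite prr subr0 ler_norm.
Qed.

Let kur_separable : exists D : set kuratowski, countable D /\ dense D.
Proof.
have [s sd] := psep; exists (range (kur_embed \o s)); split.
  exact: card_le_trans (card_image_le _ _) (countableP _).
move=> O [f Of] oO.
have /open_mballP := oO => /(_ f Of)[r r0 rO].
have r30 : 0 < r / 3 by rewrite divr_gt0.
have [i fi] := kur_close f r30; have [n sn] := sd i _ r30.
exists (kur_embed (s n)); split; last by exists n.
apply: rO; have h : mdist f (kur_embed i) <= r / 3 by apply: kur_dist_le.
have := mdist_tri (kur_embed i) f (kur_embed (s n)); rewrite (kur_embedE i) => h2.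
by apply: (le_lt_trans h2); lra.
Qed.

HB.instance Definition _ := isSeparable.Build kuratowski kur_separable.

(** [p] is only a pseudometric: points at distance 0 have the same distance function, so the
    embedding identifies them. *)
Lemma polish_completion : exists (Z : polishMetricType R) (e : I -> Z),
  forall i j, mdist (e i) (e j) = p i j.
Proof. by exists kuratowski, kur_embed; exact: kur_embedE. Qed.

End completion.

Definition lip1 (R : realType) (T : metricType R) (f : T -> R) :=
  forall x y, f x <= f y + mdist x y.

Lemma lip1_dist (R : realType) (T : metricType R) (a : T) : lip1 (mdist a).
Proof. by move=> x y; have := mdist_tri y a x; rewrite (mdistC y x). Qed.

Lemma lip1_norm (R : realType) (T : metricType R) (f : T -> R) x y :
  lip1 f -> `|f x - f y| <= mdist x y.
Proof.
by move=> lf; have := lf x y; have := lf y x; rewrite (mdistC y x) ler_distl; lra.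
Qed.

(** McShane's formula: the infimum over [s] in [D] of [g (a s) + mdist (b s) y]. It takes the
    prescribed values because [a] and [b] induce the same distances on [D]. *)
Lemma mcshane_extension (R : realType) (A B : metricType R) (S : Type) (D : set S)
    (a : S -> A) (b : S -> B) (g : A -> R) : D !=set0 ->
  (forall s t, D s -> D t -> mdist (a s) (a t) = mdist (b s) (b t)) -> lip1 g ->
  exists g' : B -> R, lip1 g' /\ forall s, D s -> g (a s) = g' (b s).
Proof.
move=> [s0 Ds0] iso lg.
pose E y := [set g (a s) + mdist (b s) y | s in D].
have Einf y : has_inf (E y).
  split; first by exists (g (a s0) + mdist (b s0) y), s0.
  exists (g (a s0) - mdist (b s0) y) => _ [s Ds <-].
  have := lg (a s0) (a s); rewrite iso//.
  by have := mdist_tri y (b s0) (b s); rewrite (mdistC y); lra.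
exists (fun y => inf (E y)); split.
  move=> x y; rewrite -lerBlDr; apply: lb_le_inf; first exact: (Einf y).1.
  move=> _ [s Ds <-]; rewrite lerBlDr.
  apply: (@le_trans _ _ (g (a s) + mdist (b s) x)).
    by apply: ge_inf; [exact: (Einf x).2|exists s].
  by have := mdist_tri y (b s) x; rewrite (mdistC y x); lra.
move=> s Ds; apply/eqP; rewrite eq_le; apply/andP; split.
  apply: lb_le_inf; first exact: (Einf _).1.
  by move=> _ [t Dt <-]; have := lg (a s) (a t); rewrite iso// mdistC.
apply: (@le_trans _ _ (g (a s) + mdist (b s) (b s))).
  by apply: ge_inf; [exact: (Einf _).2|exists s].
by rewrite mdistrr addr0.
Qed.

Section compatible_families.
Context (R : realType).

(** The 1-Lipschitz functions of the glued space, seen on its pieces. *)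
Definition compatible (T : nat -> polishMetricType R) (S : nat -> Type)
    (D : forall k, set (S k)) (psi : forall k, S k -> T k) (phi : forall k, S k -> T k.+1)
    (f : forall k, T k -> R) :=
  (forall k, lip1 (f k)) /\ forall k s, D k s -> f k (psi k s) = f k.+1 (phi k s).

(** To the right of [k], spaces are added one at a time by recursion. To the left, the induction
    treats the shifted chain, and one more extension goes backwards into the initial space. *)
Lemma compatible_extension (T : nat -> polishMetricType R) (S : nat -> Type)
    (D : forall k, set (S k)) (psi : forall k, S k -> T k) (phi : forall k, S k -> T k.+1) :
  (forall k, D k !=set0) ->
  (forall k s t, D k s -> D k t ->
     mdist (psi k s) (psi k t) = mdist (phi k s) (phi k t)) ->
  forall k (g : T k -> R), lip1 g -> exists f, compatible D psi phi f /\ f k = g.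
Proof.
move=> D0 iso k; elim: k => [|k IH] in T S D psi phi D0 iso *.
- move=> g lg.
  have step k (h : {h : T k -> R | lip1 h}) : {h' : {h' : T k.+1 -> R | lip1 h'} |
      forall s, D k s -> sval h (psi k s) = sval h' (phi k s)}.
    have [h' [lh' hh']] := cid (mcshane_extension (D0 k) (iso k) (svalP h)).
    by exists (exist _ h' lh').
  pose F := nat_rect (fun k => {h : T k -> R | lip1 h}) (exist _ g lg)
    (fun k h => sval (step k h)).
  exists (fun k => sval (F k)); split => //; split.
    by move=> k; exact: svalP.
  by move=> k s Ds /=; exact: (svalP (step k (F k))).
- move=> g lg.
  have [f [[lf cf] fg]] := IH (fun k => T k.+1) (fun k => S k.+1) (fun k => D k.+1)
    (fun k => psi k.+1) (fun k => phi k.+1) (fun k => D0 k.+1) (fun k => iso k.+1) g lg.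
  have [f0 [lf0 cf0]] := mcshane_extension (D0 0%N)
    (fun s t Ds Dt => esym (iso 0%N s t Ds Dt)) (lf 0%N).
  exists (fun k => match k return T k -> R with 0%N => f0 | k'.+1 => f k' end).
  split=> //; split; first by case.
  by case=> [s Ds|k' s Ds]; [rewrite -cf0|exact: cf].
Qed.

End compatible_families.

Unset Implicit Arguments.

Section chain_gluing.
Context (R : realType) (T : nat -> polishMetricType R) (S : nat -> Type).
Context (D : forall k, set (S k)) (psi : forall k, S k -> T k) (phi : forall k, S k -> T k.+1).
Hypothesis D0 : forall k, D k !=set0.
Hypothesis iso : forall k s t, D k s -> D k t ->
  mdist (psi k s) (psi k t) = mdist (phi k s) (phi k t).

Let I := {k : nat & T k}.
Let ev (f : forall k, T k -> R) (i : I) := f (projT1 i) (projT2 i).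
Let E (i j : I) := [set `|ev f i - ev f j| | f in compatible D psi phi].
(** By this dual definition the triangle inequality is immediate, and [p] is at most [mdist] on each
    space; the reverse bound is where the extension of compatible families is used. *)
Let p i j := sup (E i j).

Let compatible0 : compatible D psi phi (fun k _ => 0).
Proof. by split=> // k x y; rewrite add0r mdist_ge0. Qed.

(** Makes the suprema finite: identified points lead from [i] to the initial space in finitely many
    steps of bounded variation. *)
Let bounded0 (i : I) : exists C : R, forall f, compatible D psi phi f ->
  `|ev f i - f 0%N point| <= C.
Proof.
case: i => k x; elim: k x => [|k IH] x.
  by exists (mdist x point) => f [lf _]; exact: lip1_norm.
have [s Ds] := D0 k; have [C hC] := IH (psi k s).
exists (mdist x (phi k s) + C) => f cf; have := hC f cf; rewrite /ev /=.
have := lip1_norm x (phi k s) (cf.1 k.+1); rewrite (cf.2 k s Ds).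
have := ler_distD (f k.+1 (phi k s)) (f k.+1 x) (f 0%N point); lra.
Qed.

Let E_sup i j : has_sup (E i j).
Proof.
split; first by exists `|ev (fun k _ => 0) i - ev (fun k _ => 0) j|, (fun k _ => 0).
have [C hC] := bounded0 i; have [C' hC'] := bounded0 j.
exists (C + C') => _ [f cf <-]; have := hC f cf; have := hC' f cf.
rewrite (distrC (ev f j)); have := ler_distD (f 0%N point) (ev f i) (ev f j); lra.
Qed.

Let p_ge i j f : compatible D psi phi f -> `|ev f i - ev f j| <= p i j.
Proof. by move=> cf; apply: (ub_le_sup (E_sup i j).2); exists f. Qed.

Let p_le i j c : (forall f, compatible D psi phi f -> `|ev f i - ev f j| <= c) -> p i j <= c.
Proof. by move=> h; apply: ge_sup; [exact: (E_sup i j).1|move=> _ [f cf <-]; exact: h]. Qed.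

Let p0 i : p i i = 0.
Proof.
apply/eqP; rewrite eq_le; apply/andP; split.
  by apply: p_le => f _; rewrite subrr normr0.
exact: le_trans (normr_ge0 _) (p_ge i i _ compatible0).
Qed.

Let pC i j : p i j = p j i.
Proof. by rewrite /p /E; congr sup; apply: eq_imagel => f _; rewrite distrC. Qed.

Let p_tri j i k : p i k <= p i j + p j k.
Proof.
apply: p_le => f cf; apply: le_trans (ler_distD (ev f j) _ _) _.
by apply: lerD; exact: p_ge.
Qed.

Let inT {k} (x : T k) : I := existT (fun k => T k : Type) k x.

Let p_iso k (x y : T k) : p (inT x) (inT y) = mdist x y.
Proof.
apply/eqP; rewrite eq_le; apply/andP; split.
  by apply: p_le => f [lf _]; exact: lip1_norm.
have [f [cf fE]] := compatible_extension D0 iso (lip1_dist x).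
apply: le_trans (p_ge (inT x) (inT y) _ cf).
by rewrite /ev /= fE mdistrr sub0r normrN ler_norm.
Qed.

Lemma nonempty_chain_gluing : exists (Z : polishMetricType R) (e : forall k, T k -> Z),
  (forall k x y, mdist (e k x) (e k y) = mdist x y) /\
  forall k s, D k s -> e k (psi k s) = e k.+1 (phi k s).
Proof.
have [s sd] : exists s : forall k, nat -> T k,
    forall k (x : T k) (e : R), 0 < e -> exists n, mdist (s k n) x < e.
  exists (fun k => sval (cid (dense_sequence (T k)))) => k x e.
  by case: cid => s /= ; apply.
have [] := @polish_completion R I (inT (point : T 0%N)) p p0 pC p_tri _.
  exists (fun n => if @choice.unpickle (nat * nat)%type n is Some km then inT (s km.1 km.2)
    else inT (point : T 0%N)).
  move=> [k x] e e0; have [n sn] := sd k x e e0.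
  exists (choice.pickle (k, n)); rewrite choice.pickleK /=.
  by rewrite (p_iso _ x (s k n)) mdistC.
move=> Z [e eE]; exists Z, (fun k x => e (inT x)); split.
  by move=> k x y; rewrite eE p_iso.
move=> k t Dt; apply: mdist_positivity; rewrite eE.
apply/eqP; rewrite eq_le; apply/andP; split.
  by apply: p_le => f cf; rewrite /ev /= (cf.2 k t Dt) subrr normr0.
exact: le_trans (normr_ge0 _) (p_ge _ _ _ compatible0).
Qed.

End chain_gluing.

Set Implicit Arguments.

Lemma chain_gluing (R : realType) (T : nat -> polishMetricType R) (S : nat -> Type)
    (D : forall k, set (S k)) (psi : forall k, S k -> T k) (phi : forall k, S k -> T k.+1) :
  (forall k s t, D k s -> D k t ->
     mdist (psi k s) (psi k t) = mdist (phi k s) (phi k t)) ->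
  exists (Z : polishMetricType R) (e : forall k, T k -> Z),
  (forall k x y, mdist (e k x) (e k y) = mdist x y) /\
  forall k s, D k s -> e k (psi k s) = e k.+1 (phi k s).
Proof.
move=> iso.
(* Spaces with nothing to identify are glued along an arbitrary point. *)
pose D' k : set (option (S k)) :=
  [set o | if o is Some s then D k s else ~ (D k !=set0)].
pose psi' k o := if o is Some s then psi k s else point.
pose phi' k o := if o is Some s then phi k s else point.
have [||Z [e [iso_e ee]]] := @nonempty_chain_gluing R T _ D' psi' phi'.
- move=> k; have [[s Ds]|nD] := pselect (D k !=set0); first by exists (Some s).
  by exists None.
- move=> k [s|] [u|] //=; [exact: iso|by move=> Ds []; exists s|by move=> nD Du; case: nD; exists u|].
  by rewrite !mdistrr.
by exists Z, e; split=> // k s; exact: (ee k (Some s)).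
Qed.

Lemma pair_gluing (R : realType) (A B : polishMetricType R) (S : Type) (D : set S)
    (psi : S -> A) (phi : S -> B) :
  (forall s t, D s -> D t -> mdist (psi s) (psi t) = mdist (phi s) (phi t)) ->
  exists (Z : polishMetricType R) (eA : A -> Z) (eB : B -> Z),
  [/\ forall x y, mdist (eA x) (eA y) = mdist x y,
      forall x y, mdist (eB x) (eB y) = mdist x y &
      forall s, D s -> eA (psi s) = eB (phi s)].
Proof.
move=> iso.
(* The chain is [A], [B], [B], ..., and only its first link prescribes identifications. *)
pose T k : polishMetricType R := if k is 0%N then A else B.
pose D' k : set S := if k is 0%N then D else set0.
pose psi' k : S -> T k := match k return S -> T k with 0%N => psi | _ => phi end.
have [|Z [e [iso_e ee]]] := @chain_gluing R T (fun _ => S) D' psi' (fun _ => phi).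
  by case=> [|k] s u //=; exact: iso.
exists Z, (e 0%N), (e 1%N); split; [exact: (iso_e 0%N)|exact: (iso_e 1%N)|exact: (ee 0%N)].
Qed.

(** * Transport between metric measure spaces *)

Section measure_bounds.
Context (R : realType) (T : polishMetricType R).
Implicit Types mu : fin_borel_measure R T.

Lemma coupled_map (T' : polishMetricType R) (e : T -> T') mu1 mu2
    (nu1 nu2 : fin_borel_measure R T') a :
  (forall x y, mdist (e x) (e y) = mdist x y) ->
  (forall A, measurable A -> nu1 A = mu1 (e @^-1` A)) ->
  (forall A, measurable A -> nu2 A = mu2 (e @^-1` A)) ->
  coupled mu1 mu2 a -> coupled nu1 nu2 a.
Proof.
move=> iso E1 E2 [g [[g1 g2] [c gc lta]]].
have me : measurable_fun setT (e : borel T -> borel T').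
  by apply: isometric_on_borel => // x y _ _; exact: iso.
have mf1 : measurable_fun setT ((e \o fst) : borel (T * T)%type -> borel T').
  by apply: (measurableT_comp me); exact: measurable_fst_borel.
have mf2 : measurable_fun setT ((e \o snd) : borel (T * T)%type -> borel T').
  by apply: (measurableT_comp me); exact: measurable_snd_borel.
apply: (@weighted_coupling _ _ _ (borel (T * T)%type) g (cst 1) (e \o fst) (e \o snd)
  _ _ (mass g) c) => //.
- move=> A mA; rewrite integral_one; last by rewrite -[X in measurable X]setTI; exact: mf1.
  have meA : measurable ((e : borel T -> borel T') @^-1` A).
    by rewrite -[X in measurable X]setTI; exact: me.
  by rewrite E1//; have := g1 _ meA; rewrite marginal1E.
- move=> A mA; rewrite integral_one; last by rewrite -[X in measurable X]setTI; exact: mf2.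
  have meA : measurable ((e : borel T -> borel T') @^-1` A).
    by rewrite -[X in measurable X]setTI; exact: me.
  by rewrite E2//; have := g2 _ meA; rewrite marginal2E.
- by rewrite integral_one// -massE.
- by under eq_integral do rewrite mulr1 /= iso.
- by move: lta; rewrite /mass E1// E2// !preimage_setT.
Qed.

Definition thickening (r : R) (A : set T) : set T :=
  \bigcup_(x in A) [set y | mdist x y < r].

Lemma open_thickening r A : open (thickening r A).
Proof. by apply: bigcup_open => x _; exact: open_mball. Qed.

Lemma measurable_thickening r A : measurable (thickening r A : set (borel T)).
Proof. by apply: open_borel; exact: open_thickening. Qed.

(** The mass of [mu1] in the thickening is not transported (less than [e]), or moves by at least [r]
    (at most [e / r], by Markov), or lands in the larger thickening. *)
Lemma coupled_thickening mu1 mu2 e r A : coupled mu1 mu2 e -> 0 < r ->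
  (mu1 (thickening r A) <= mu2 (thickening (2 * r) A) + (e + e / r)%:E)%E.
Proof.
move=> [g [sub [c gc lte]]] r0; have [g1 g2] := sub.
have [gm1 gm2] := subplan_mass sub.
have c0 := cost_integral_ge0 gc.
set U := thickening r A; set V := thickening (2 * r) A.
have mU : measurable (U : set (borel T)) by exact: measurable_thickening.
have mUC : measurable (~` U : set (borel T)) by exact: measurableC.
have mV : measurable (V : set (borel T)) by exact: measurable_thickening.
have mfU : measurable (fst @^-1` U : set (borel (T * T)%type)).
  by rewrite -[X in measurable X]setTI; exact: measurable_fst_borel.
have mfUC : measurable (fst @^-1` (~` U) : set (borel (T * T)%type)).
  by rewrite -[X in measurable X]setTI; exact: measurable_fst_borel.
have msV : measurable (snd @^-1` V : set (borel (T * T)%type)).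
  by rewrite -[X in measurable X]setTI; exact: measurable_snd_borel.
have [mZ gZ] := cost_markov gc r0.
set Z := [set z : T * T | _] in mZ gZ.
have gU : (g (fst @^-1` U) <= g (snd @^-1` V) + g Z)%E.
  apply: (@le_trans _ _ (g (snd @^-1` V `|` Z))).
    apply: le_measure; rewrite ?inE//; first exact: measurableU.
    move=> z [x Ax /= xz]; have [zr|rz] := ltP (mdist z.1 z.2) r.
      left; exists x => //=; have := mdist_tri z.1 x z.2; lra.
    by right.
  by apply: le_trans (measureU2 _ _ _) _.
have gT : (g setT = g (fst @^-1` U) + g (fst @^-1` (~` U)))%E.
  rewrite -measureU//; first by rewrite -preimage_setU setUv preimage_setT.
  by rewrite -preimage_setI setICr preimage_set0.
have mT : (mu1 setT = mu1 U + mu1 (~` U))%E.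
  by rewrite -measureU// ?setUv// setICr.
have h1 := g1 _ mUC; rewrite marginal1E in h1.
have h2 := g2 _ mV; rewrite marginal2E in h2.
move: gT mT h1 h2 gU gZ; rewrite !massE.
rewrite (fin_measureE mu1 mU) (fin_measureE mu1 mUC) (fin_measureE mu2 mV).
rewrite (fin_measureE g mfU) (fin_measureE g mfUC) (fin_measureE g msV) (fin_measureE g mZ).
rewrite -!EFinD !lee_fin => -[gT] [mT] h1 h2 gU gZ.
have : c / r <= e / r by rewrite ler_pM2r ?invr_gt0//; lra.
lra.
Qed.

(** The complement of the support is covered by null balls, and countably many suffice: centres in a
    dense sequence, radii in a vanishing one. *)
Lemma msupport_conull mu : mu (~` msupport mu) = 0%E.
Proof.
have mS : measurable (~` msupport mu : set (borel T)).
  by apply: (@measurableC _ (borel T)); apply: closed_borel; exact: closed_msupport.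
have [s sd] := dense_sequence T; have [q [q0 qe]] := @vanishing_sequence R.
pose b (p : nat * nat) : set T := [set y | mdist (s p.1) y < q p.2].
pose F n : set T := if @choice.unpickle (nat * nat)%type n is Some p then
  (if mu (b p) == 0%E then b p else set0) else set0.
have : mu.-negligible (\bigcup_n F n).
  apply: negligible_bigcup => n; rewrite /F.
  case: choice.unpickle => [p|]; last exact: negligible_set0.
  case: eqP => [b0|_]; last exact: negligible_set0.
  by apply/negligibleP => //; apply: open_borel; exact: open_mball.
move=> /(@negligibleS _ _ _ mu _ (~` msupport mu)) h; apply/negligibleP => //; apply: h.
move=> x /= /existsNP[U /not_implyP[oU /not_implyP[Ux /negP]]].
rewrite -leNgt measure_le0 => /eqP U0.
have [r r0 rU] := (open_mballP U).1 oU x Ux.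
have r20 : 0 < r / 2 by rewrite divr_gt0.
have [k kr] := qe _ r20; have [i ix] := sd x (q k) (q0 k).
exists (choice.pickle (i, k)) => //; rewrite /F choice.pickleK.
suff -> : mu (b (i, k)) = 0%E by rewrite eqxx.
apply: (subset_measure0 _ _ _ U0); [by apply: open_borel; exact: open_mball|exact: open_borel|].
move=> y; rewrite /b /= => iy; apply: rU.
by have := mdist_tri (s i) x y; rewrite (mdistC x (s i)); lra.
Qed.

End measure_bounds.

(** * Closeness of metric measure spaces *)

Section mm_close.
Context (R : realType).
Implicit Types (X Y Z : mm_space R) (T : polishMetricType R).

Definition mm_close X Y (e : R) := exists T
  (psi1 : isometric_embedding T (mm_support (X := X)))
  (psi2 : isometric_embedding T (mm_support (X := Y))),
  coupled (mm_push psi1) (mm_push psi2) e.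
End mm_close.

Section mm_close_theory.
Context (R : realType).
Implicit Types (X Y Z : mm_space R) (T : polishMetricType R).

Lemma embedding_inf_ltP (D : forall T : polishMetricType R,
    fin_borel_measure R T -> fin_borel_measure R T -> \bar R) X Y e :
  (forall T mu1 mu2, (D T mu1 mu2 < e%:E)%E <-> coupled mu1 mu2 e) ->
  (embedding_inf D X Y < e%:E)%E <-> mm_close X Y e.
Proof.
move=> DP; split.
  by move=> /ereal_inf_lt[_ [T [psi1 [psi2 ->]]] /DP lte]; exists T, psi1, psi2.
move=> [T [psi1 [psi2 /DP lte]]]; apply: le_lt_trans lte.
by apply: ereal_inf_lbound; exists T, psi1, psi2.
Qed.

Definition isometric_comp X T T' (psi : isometric_embedding T (mm_support (X := X)))
    (e : T -> T') (iso : forall x y, mdist (e x) (e y) = mdist x y) :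
  isometric_on (mm_support (X := X)) (e \o psi).
Proof. by move=> x y Dx Dy /=; rewrite iso; exact: emb_isometric. Qed.

Definition emb_comp X T T' (psi : isometric_embedding T (mm_support (X := X)))
    (e : T -> T') (iso : forall x y, mdist (e x) (e y) = mdist x y) :=
  IsometricEmbedding (isometric_comp psi iso).

Lemma mm_pushE X T (psi : isometric_embedding T (mm_support (X := X))) A :
  mm_push psi A = mm_measure X (mm_support (X := X) `&` psi @^-1` A).
Proof. by []. Qed.

Lemma measurable_emb_preimage X T (psi : isometric_embedding T (mm_support (X := X)))
    (U : set T) : open U ->
  measurable (mm_support (X := X) `&` psi @^-1` U : set (borel X)).
Proof.
move=> oU; apply: (isometric_on_borel (@measurable_mm_support R X) (emb_isometric psi)).
  exact: measurable_mm_support.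
exact: open_borel.
Qed.

Lemma mm_support_conull X : mm_measure X (~` mm_support (X := X)) = 0%E.
Proof. exact: msupport_conull. Qed.

Lemma mm_measure_setI_support X (A : set (borel X)) : measurable A ->
  mm_measure X (mm_support (X := X) `&` A) = mm_measure X A.
Proof.
move=> mA; have mS := @measurable_mm_support R X.
rewrite -[in RHS](setIT A) -(setUv (mm_support (X := X))) setIUr measureU//.
- rewrite setIC [X in _ = (_ + X)%E](_ : _ = 0%E) ?adde0//.
  apply: (subset_measure0 _ _ _ (mm_support_conull X)).
  + by apply: measurableI => //; exact: measurableC.
  + exact: measurableC.
  + by move=> x [].
- exact: measurableI.
- by apply: measurableI => //; exact: measurableC.
- by rewrite setIACA setICr setI0.
Qed.

Lemma isometric_id X : isometric_on (mm_support (X := X)) (id : X -> X).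
Proof. by []. Qed.

Definition emb_id X := IsometricEmbedding (@isometric_id X).

Lemma mm_push_id X A : measurable A -> mm_push (emb_id X) A = mm_measure X A.
Proof. by move=> mA; rewrite mm_pushE mm_measure_setI_support. Qed.

Lemma mass_mm_push X T (psi : isometric_embedding T (mm_support (X := X))) :
  mass (mm_push psi) = mass (mm_measure X).
Proof. by rewrite /mass mm_pushE preimage_setT mm_measure_setI_support. Qed.

Lemma mm_close_gt0 X Y e : mm_close X Y e -> 0 < e.
Proof. by move=> [T [psi1 [psi2 /coupled_gt0]]]. Qed.

Lemma mm_close_mono X Y e e' : e <= e' -> mm_close X Y e -> mm_close X Y e'.
Proof. by move=> ee [T [psi1 [psi2 h]]]; exists T, psi1, psi2; exact: coupled_mono h. Qed.

Lemma mm_close_sym X Y e : mm_close X Y e -> mm_close Y X e.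
Proof. by move=> [T [psi1 [psi2 /coupled_sym h]]]; exists T, psi2, psi1. Qed.

Lemma mm_close_mass X Y e : mm_close X Y e -> `|mass (mm_measure X) - mass (mm_measure Y)| < e.
Proof. by move=> [T [psi1 [psi2 /coupled_mass]]]; rewrite !mass_mm_push. Qed.

(** Two spaces always embed in a common one, by gluing with nothing to identify, and there the zero
    plan is available. *)
Lemma mm_close_exists X Y :
  mm_close X Y (mass (mm_measure X) + mass (mm_measure Y) + 1).
Proof.
have [Z [eX [eY [isoX isoY _]]]] := @pair_gluing R X Y X set0 (fun _ => point) (fun _ => point)
  (fun s t F => False_ind _ F).
exists Z, (emb_comp (emb_id X) isoX), (emb_comp (emb_id Y) isoY).
rewrite -(mass_mm_push (emb_comp (emb_id X) isoX)) -(mass_mm_push (emb_comp (emb_id Y) isoY)).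
exact: coupled_exists.
Qed.

Lemma mm_close_triangle X Y Z a b :
  mm_close X Y a -> mm_close Y Z b -> mm_close X Z (a + b).
Proof.
move=> [T1 [f1 [f2 c1]]] [T2 [g2 [g3 c2]]].
have [|W [e1 [e2 [iso1 iso2 glue]]]] :=
  @pair_gluing R T1 T2 Y (mm_support (X := Y)) f2 g2.
  by move=> s t Ds Dt; rewrite !emb_isometric ?inE.
exists W, (emb_comp f1 iso1), (emb_comp g3 iso2).
apply: (@coupled_triangle _ _ _ (mm_push (emb_comp f2 iso1))).
  by apply: (coupled_map iso1 _ _ c1).
apply: (coupled_map iso2 _ _ c2) => // A mA.
rewrite !mm_pushE /=; congr (mm_measure Y _); apply/seteqP.
by split => y [Dy] /=; rewrite glue.
Qed.

Lemma mm_iso_close X Y e : mm_iso X Y -> 0 < e -> mm_close X Y e.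
Proof.
move=> [psi [_ psiE]] e0; exists Y, psi, (emb_id Y).
apply: (coupled_ext _ _ (coupled_refl (mm_measure Y) e0)).
  by move=> A mA; rewrite psiE.
by move=> A mA; rewrite mm_push_id.
Qed.

(** The ambient space changes with [e]. What nondegeneracy retains of it is the cross distance
    [rho], with its triangle inequalities and the comparison of the masses of sets that are close
    for [rho]. *)
Lemma mm_close_thickening X Y e : mm_close X Y e ->
  exists rho : X -> Y -> R,
  [/\ forall x x' y, mm_support x -> mm_support x' -> mm_support y ->
        mdist x x' <= rho x y + rho x' y /\ rho x y <= mdist x x' + rho x' y,
      forall x y y', mm_support x -> mm_support y -> mm_support y' ->
        mdist y y' <= rho x y + rho x y' /\ rho x y <= rho x y' + mdist y' y,
      forall r A B, 0 < r -> measurable (A : set (borel X)) -> measurable (B : set (borel Y)) ->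
        (forall x y, A x -> mm_support x -> mm_support y -> rho x y < 2 * r -> B y) ->
        (mm_measure X A <= mm_measure Y B + (e + e / r)%:E)%E &
      forall r A B, 0 < r -> measurable (A : set (borel X)) -> measurable (B : set (borel Y)) ->
        (forall x y, B y -> mm_support x -> mm_support y -> rho x y < 2 * r -> A x) ->
        (mm_measure Y B <= mm_measure X A + (e + e / r)%:E)%E].
Proof.
move=> [T [f [g c]]]; exists (fun x y => mdist (f x) (g y)); split.
- move=> x x' y Dx Dx' Dy; rewrite -(emb_isometric f) ?inE//.
  have := mdist_tri (g y) (f x) (f x'); have := mdist_tri (f x') (f x) (g y).
  by rewrite (mdistC (g y)).
- move=> x y y' Dx Dy Dy'; rewrite -!(emb_isometric g) ?inE//.
  have := mdist_tri (f x) (g y) (g y'); have := mdist_tri (g y') (f x) (g y).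
  by rewrite (mdistC (g y) (f x)).
- move=> r A B r0 mA mB AB.
  have := coupled_thickening (f @` (mm_support (X := X) `&` A)) c r0.
  rewrite !mm_pushE => h; rewrite -(mm_measure_setI_support mA) -(mm_measure_setI_support mB).
  apply: (le_trans _ (le_trans h _)).
    apply: le_measure; rewrite ?inE.
    + exact: (@measurableI _ (borel X) _ _ (@measurable_mm_support R X) mA).
    + exact: (measurable_emb_preimage f (@open_thickening _ _ _ _)).
    + by move=> x [Dx Ax]; split=> //; exists (f x); [exists x|rewrite /= mdistrr].
  apply: leeD => //; apply: le_measure; rewrite ?inE.
  + exact: (measurable_emb_preimage g (@open_thickening _ _ _ _)).
  + exact: (@measurableI _ (borel Y) _ _ (@measurable_mm_support R Y) mB).
  + by move=> y [Dy [_ [x [Dx Ax] <-] /= xy]]; split=> //; exact: (AB x).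
- move=> r A B r0 mA mB AB.
  have := coupled_thickening (g @` (mm_support (X := Y) `&` B)) (coupled_sym c) r0.
  rewrite !mm_pushE => h; rewrite -(mm_measure_setI_support mA) -(mm_measure_setI_support mB).
  apply: (le_trans _ (le_trans h _)).
    apply: le_measure; rewrite ?inE.
    + exact: (@measurableI _ (borel Y) _ _ (@measurable_mm_support R Y) mB).
    + exact: (measurable_emb_preimage g (@open_thickening _ _ _ _)).
    + by move=> x [Dx Ax]; split=> //; exists (g x); [exists x|rewrite /= mdistrr].
  apply: leeD => //; apply: le_measure; rewrite ?inE.
  + exact: (measurable_emb_preimage f (@open_thickening _ _ _ _)).
  + exact: (@measurableI _ (borel X) _ _ (@measurable_mm_support R X) mA).
  + by move=> x [Dx [_ [y [Dy By] <-] /= yx]]; split=> //; apply: (AB x y) => //; rewrite mdistC.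
Qed.

End mm_close_theory.

Lemma near_invS_lt (R : realType) (e : R) : 0 < e -> \forall k \near \oo, k.+1%:R^-1 < e.
Proof. by move=> e0; exact: (@near_infty_natSinv_lt R (PosNum e0)). Qed.

Lemma ge0_mule_finite_bound (R : realType) (a m : R) :
  0 < a -> ~ forall n : nat, n%:R * a <= m.
Proof.
move=> a0 /(_ (Num.truncn (m / a)).+1); rewrite -ler_pdivlMr// leNgt.
by rewrite Num.Theory.truncnS_gt.
Qed.

(** * Nondegeneracy *)

Section separated_mass.
Context (R : realType) (Y : polishMetricType R) (nu : fin_borel_measure R Y).
Context (U : set_system nat) (UU : UltraFilter U).

(* Infinitely many far apart points would carry infinite mass. *)
Lemma ultrafilter_cluster (y : nat -> Y) (r a : R) : 0 < a ->
  U [set k | (a%:E <= nu [set z | (mdist (y k) z < r)%R])%E] ->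
  exists z, U [set k | mdist z (y k) < 2 * r].
Proof.
move=> a0 Ua; apply: contrapT => /forallNP noz.
have far z : U [set k | 2 * r <= mdist z (y k)].
  have [//|] := in_ultra_setVsetC [set k | mdist z (y k) < 2 * r] UU.
    by move/noz.
  by apply: filterS => k /= /negP; rewrite -leNgt.
pose B (l : seq Y) : set (borel Y) := \big[setU/set0]_(z <- l) [set x | mdist z x < r].
have mball z : measurable ([set x | mdist z x < r] : set (borel Y)).
  by apply: open_borel; exact: open_mball.
have mB l : measurable (B l) by apply: bigsetU_measurable.
have Uall (l : seq Y) : U [set k | forall z, z \in l -> 2 * r <= mdist z (y k)].
  elim: l => [|z l IH]; first by apply: filterS (@filterT _ U _).
  apply: filterS (filterI (far z) IH) => k [/= hz hl] z'.
  by rewrite inE => /orP[/eqP -> //|/hl].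
(* The new centre is at least [2 * r] away from the earlier ones, so its ball is disjoint from
   theirs and adds a mass of at least [a]. *)
have mass_l n : exists l, ((n%:R * a)%:E <= nu (B l))%E.
  elim: n => [|n [l IH]]; first by exists [::]; rewrite mul0r.
  have [k [/= ka kl]] := filter_ex (filterI Ua (Uall l)).
  exists (y k :: l).
  have -> : B (y k :: l) = [set x | mdist (y k) x < r] `|` B l by rewrite /B big_cons.
  rewrite measureU; [|exact: mball|exact: mB|].
    by rewrite -natr1 mulrDl mul1r addrC EFinD leeD.
  apply/seteqP; split => // x [/= kx]; rewrite /B -bigcup_seq.
  move=> [z /= zl zx]; have := kl z zl; have := mdist_tri x z (y k).
  by rewrite (mdistC x (y k)); lra.
apply: (@ge0_mule_finite_bound R a (mass nu)) => // n.
have [l hl] := mass_l n; rewrite -lee_fin -massE; apply: le_trans hl _.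
by apply: le_measure; rewrite ?inE.
Qed.

Lemma ultrafilter_cauchy_cvg (y : nat -> Y) :
  (forall r : R, 0 < r -> exists z, U [set k | mdist z (y k) < r]) ->
  exists z, forall e : R, 0 < e -> U [set k | mdist z (y k) < e].
Proof.
move=> h.
have : cvg (y @ U).
  apply/cauchy_cvgP/cauchy_exP => e e0; have [z Uz] := h e e0.
  exists z; change (U [set k | ball z e (y k)]).
  by apply: filterS Uz => k /=; rewrite ballEmdist.
move=> /cvg_ex[z zP]; exists z => e e0.
by have /metricType_numDomainType.fcvgrPdist_lt/(_ e e0) := zP.
Qed.

End separated_mass.

Section vanishing_couplings.
Context (R : realType).

(** The bound is [e + e / r] with [r] the inverse of [k + 1] and [e] its square. The conditions are
    symmetric in [X] and [Y], so that limits can be taken in both directions. *)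
Definition vanishing_couplings (X Y : mm_space R) (rho : nat -> X -> Y -> R) :=
  forall k,
  [/\ forall x x' y, mm_support x -> mm_support x' -> mm_support y ->
        mdist x x' <= rho k x y + rho k x' y /\ rho k x y <= mdist x x' + rho k x' y,
      forall x y y', mm_support x -> mm_support y -> mm_support y' ->
        mdist y y' <= rho k x y + rho k x y' /\ rho k x y <= rho k x y' + mdist y' y,
      forall A B, measurable (A : set (borel X)) -> measurable (B : set (borel Y)) ->
        (forall x y, A x -> mm_support x -> mm_support y ->
           rho k x y < 2 * k.+1%:R^-1 -> B y) ->
        (mm_measure X A <= mm_measure Y B + (2 * k.+1%:R^-1)%:E)%E &
      forall A B, measurable (A : set (borel X)) -> measurable (B : set (borel Y)) ->
        (forall x y, B y -> mm_support x -> mm_support y ->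
           rho k x y < 2 * k.+1%:R^-1 -> A x) ->
        (mm_measure Y B <= mm_measure X A + (2 * k.+1%:R^-1)%:E)%E].

Lemma vanishing_couplings_exist (X Y : mm_space R) :
  (forall e, 0 < e -> mm_close X Y e) -> exists rho, vanishing_couplings (X := X) (Y := Y) rho.
Proof.
move=> h.
have q0 k : 0 < (k.+1%:R^-1 : R) by [].
have q20 k : 0 < (k.+1%:R^-1 : R) ^+ 2 by rewrite exprn_gt0.
have [rho rhoP] := choice (fun k => mm_close_thickening (h _ (q20 k))).
exists rho => k; have [r1 r2 r3 r4] := rhoP k; split => //.
- move=> A B mA mB AB; apply: le_trans (r3 _ A B (q0 k) mA mB AB) _.
  rewrite leeD2l// lee_fin expr2 mulfK ?gt_eqF//.
  have : (k.+1%:R^-1 : R) <= 1 by rewrite invf_le1// ler1n.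
  by move: (q0 k); move: (k.+1%:R^-1 : R) => t; nra.
- move=> A B mA mB AB; apply: le_trans (r4 _ A B (q0 k) mA mB AB) _.
  rewrite leeD2l// lee_fin expr2 mulfK ?gt_eqF//.
  have : (k.+1%:R^-1 : R) <= 1 by rewrite invf_le1// ler1n.
  by move: (q0 k); move: (k.+1%:R^-1 : R) => t; nra.
Qed.

Lemma vanishing_couplings_flip (X Y : mm_space R) (rho : nat -> X -> Y -> R) :
  vanishing_couplings rho -> vanishing_couplings (fun k y x => rho k x y).
Proof.
move=> h k; have [r1 r2 r3 r4] := h k; split.
- move=> y y' x sy sy' sx; have [h1 h2] := r2 x y y' sx sy sy'.
  by split => //; rewrite addrC (mdistC y).
- move=> y x x' sy sx sx'; have [h1 h2] := r1 x x' y sx sx' sy.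
  by split => //; rewrite addrC (mdistC x').
- by move=> A B mA mB AB; apply: r4 => // x y Ay sx sy; exact: AB.
- by move=> A B mA mB AB; apply: r3 => // x y Bx sx sy; exact: AB.
Qed.

Context (U : set_system nat) (UU : UltraFilter U).
Hypothesis Uoo : \oo `<=` U.

Lemma U_invS_lt (e : R) : 0 < e -> U [set k | k.+1%:R^-1 < e].
Proof. by move=> e0; apply: Uoo; exact: near_invS_lt. Qed.

(** [y k] almost minimises [rho k x]. A ball around [x], of mass [p > 0], is mostly transported into
    a ball around [y k], which thus has mass at least [p / 2]. Masses bounded below make the [y k]
    cluster at every scale along [U], hence converge. *)
Lemma coupling_limit_point (X Y : mm_space R) (rho : nat -> X -> Y -> R) x :
  vanishing_couplings rho -> mm_support x ->
  exists y : Y, mm_support y /\ forall e : R, 0 < e -> U [set k | rho k x y < e].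
Proof.
move=> h sx.
have mball (r : R) : measurable ([set x' | mdist x x' < r] : set (borel X)).
  by apply: open_borel; exact: open_mball.
have mballY y (r : R) : measurable ([set y' | mdist y y' < r] : set (borel Y)).
  by apply: open_borel; exact: open_mball.
have ball_pos (r : R) : 0 < r -> (0 < mm_measure X [set x' | (mdist x x' < r)%R])%E.
  by move=> r0; apply: sx; [exact: open_mball|rewrite /= mdistrr].
(* Were no support point within [r], a ball around [x] would be compared with the empty set, and its
   mass would be at most twice the inverse of [k + 1]. *)
have near_y (r : R) : 0 < r -> U [set k | exists2 y, mm_support y & rho k x y < r].
  move=> r0; have r20 : 0 < r / 2 by rewrite divr_gt0.
  have r40 : 0 < r / 4 by rewrite divr_gt0.
  have := ball_pos _ r20; rewrite (fin_measureE (mm_measure X) (mball _)) lte_fin.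
  set p := fine _ => p0; have p20 : 0 < p / 2 by rewrite divr_gt0.
  apply: filterS (filterI (U_invS_lt r40) (U_invS_lt p20)) => k [/= kr kp].
  apply: contrapT => /forall2NP noy.
  have [r1 _ r3 _] := h k.
  have := r3 _ set0 (mball (r / 2)) measurable0.
  rewrite measure0 add0e (fin_measureE (mm_measure X) (mball _)) lee_fin -/p => h3.
  suff : p <= 2 * k.+1%:R^-1.
    by move: kp; move: (k.+1%:R^-1 : R) => t tp; lra.
  apply: h3 => x' y /= xx' sx' sy xy; have [] := noy y; first by move/(_ sy).
  apply; have [_ h2] := r1 x x' y sx sx' sy.
  by move: kr xy; move: (k.+1%:R^-1 : R) => t; lra.
have [y0 sy0] : exists y : Y, mm_support y.
  by have [k [y sy _]] := filter_ex (near_y 1 ltr01); exists y.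
pose E k := [set rho k x y | y in mm_support (X := Y)].
have rho0 k y : mm_support y -> 0 <= rho k x y.
  move=> sy; have [r1 _ _ _] := h k; have [h1 _] := r1 x x y sx sx sy.
  by move: h1; rewrite mdistrr; lra.
have Einf k : has_inf (E k).
  split; first by exists (rho k x y0), y0.
  by exists 0 => _ [y sy <-]; exact: rho0.
have /choice[y yP] : forall k, exists y, mm_support y /\ rho k x y < inf (E k) + k.+1%:R^-1.
  move=> k; have k0 : 0 < (k.+1%:R^-1 : R) by [].
  by have [_ [y sy <-] yk] := inf_adherent k0 (Einf k); exists y.
have y_near (r : R) : 0 < r -> U [set k | rho k x (y k) < r].
  move=> r0; have r20 : 0 < r / 2 by rewrite divr_gt0.
  apply: filterS (filterI (U_invS_lt r20) (near_y _ r20)) => k [/= kr [y' sy' xy']].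
  have [_ yk] := yP k; have : inf (E k) <= rho k x y'.
    by apply: ge_inf; [exact: (Einf k).2|exists y'].
  by move: kr yk; move: (k.+1%:R^-1 : R) => t; lra.
have [|z zP] := @ultrafilter_cauchy_cvg R Y U UU y.
  move=> r r0; have r40 : 0 < r / 4 by rewrite divr_gt0.
  have r80 : 0 < r / 8 by rewrite divr_gt0.
  have r160 : 0 < r / 16 by rewrite divr_gt0.
  have := ball_pos _ r80; rewrite (fin_measureE (mm_measure X) (mball _)) lte_fin.
  set p := fine _ => p0; have p20 : 0 < p / 2 by rewrite divr_gt0.
  have p40 : 0 < p / 4 by rewrite divr_gt0.
  have [|w hw] := @ultrafilter_cluster R Y (mm_measure Y) U UU y (r / 2) (p / 2) p20.
    apply: filterS (filterI (U_invS_lt p40) (filterI (U_invS_lt r160) (y_near _ r40))).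
    move=> k [/= kp [kr yr]]; have [sy _] := yP k.
    have [r1 r2 r3 _] := h k.
    have := r3 _ _ (mball (r / 8)) (mballY (y k) (r / 2)).
    rewrite (fin_measureE (mm_measure X) (mball _)) (fin_measureE (mm_measure Y) (mballY _ _)).
    rewrite -EFinD !lee_fin -/p => h3.
    suff : p <= fine (mm_measure Y [set z | mdist (y k) z < r / 2]) + 2 * k.+1%:R^-1.
      by move: kp; move: (k.+1%:R^-1 : R) => t; lra.
    (* Here [rho k x y'] is below r/8 + r/8 and [rho k x (y k)] below r/4, so [y'] is within r/2 of
       [y k]. *)
    apply: h3 => x' y' /= xx' sx' sy' xy'.
    have [_ a1] := r1 x x' y' sx sx' sy'.
    have [a2 _] := r2 x (y k) y' sx sy sy'.
    by move: kr xy'; move: (k.+1%:R^-1 : R) => t; lra.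
  by exists w; apply: filterS hw => k /=; lra.
have sz : mm_support z.
  move=> V oV Vz; have [r r0 rV] := (open_mballP V).1 oV z Vz.
  have [k /= zk] := filter_ex (zP r r0).
  by have [sy _] := yP k; apply: sy => //; exact: rV.
exists z; split=> // e e0; have e20 : 0 < e / 2 by rewrite divr_gt0.
apply: filterS (filterI (zP _ e20) (y_near _ e20)) => k [/= zk xk].
have [_ r2 _ _] := h k; have [sy _] := yP k.
have [_ a] := r2 x z (y k) sx sz sy; rewrite (mdistC (y k)) in a; lra.
Qed.

End vanishing_couplings.

(** A closed set is the decreasing intersection of its thickenings, along which a finite measure is
    continuous. *)
Lemma closed_thickening_cvg (R : realType) (Y : polishMetricType R)
    (nu : fin_borel_measure R Y) (C : set Y) (a : \bar R) : closed C ->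
  (forall e : R, 0 < e -> (a <= nu (thickening e C))%E) -> (a <= nu C)%E.
Proof.
move=> cC h.
pose F k := thickening (k.+1%:R^-1 : R) C.
have mF k : measurable (F k : set (borel Y)) by exact: measurable_thickening.
have FC : \bigcap_k F k = C.
  apply/seteqP; split=> [y Fy|y Cy k _]; last by exists y => //=; rewrite mdistrr.
  apply: contrapT => nCy.
  have [r r0 rC] := (open_mballP (~` C)).1 (closed_openC cC) y nCy.
  have [k _ /(_ k (leqnn k)) kr] := near_invS_lt r0.
  have [x Cx /= xy] := Fy k I; apply: (rC x) => //.
  by rewrite mdistC; exact: lt_trans kr.
have cv : nu \o F @ \oo --> nu C.
  rewrite -[in X in _ --> X]FC; apply: (@nonincreasing_cvg_mu _ (borel Y)) => //.
  - by rewrite /= ltey_eq fin_num_measure.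
  - by apply: (@bigcapT_measurable _ (borel Y)).
  move=> m n mn; apply/subsetPset => y [x Cx /= xy]; exists x => //=.
  by apply: lt_le_trans xy _; rewrite lef_pV2 ?posrE// ler_nat ltnS.
rewrite -(cvg_lim _ cv)//; apply: lime_ge; first by apply/cvg_ex; exists (nu C).
by apply: nearW => k; exact: h.
Qed.

Section limit_isometry.
Context (R : realType) (U : set_system nat) (UU : UltraFilter U).
Hypothesis Uoo : \oo `<=` U.
Implicit Types X Y : mm_space R.

Definition coupling_limit X Y (rho : nat -> X -> Y -> R) (psi : X -> Y) :=
  forall x, mm_support x ->
    mm_support (psi x) /\ forall e : R, 0 < e -> U [set k | rho k x (psi x) < e].

Lemma coupling_limit_exists X Y (rho : nat -> X -> Y -> R) :
  vanishing_couplings rho -> exists psi, coupling_limit rho psi.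
Proof.
move=> h; have [|psi psiP] := @choice X Y (fun x y => mm_support x ->
    mm_support y /\ forall e : R, 0 < e -> U [set k | rho k x y < e]).
  move=> x; have [sx|nsx] := pselect (mm_support x); last by exists point.
  by have [y yP] := coupling_limit_point UU Uoo h sx; exists y.
by exists psi.
Qed.

Lemma coupling_limit_isometric X Y (rho : nat -> X -> Y -> R) psi :
  vanishing_couplings rho -> coupling_limit rho psi ->
  isometric_on (mm_support (X := X)) psi.
Proof.
move=> h psiP x x' /[!inE] sx sx'; have [sy xU] := psiP x sx; have [sy' xU'] := psiP x' sx'.
suff H (e : R) : 0 < e -> `|mdist (psi x) (psi x') - mdist x x'| <= 2 * e.
  apply/eqP; rewrite -subr_eq0 -normr_le0; apply/ler_addgt0Pl => e e0.
  by have := H (e / 2) ltac:(by rewrite divr_gt0); lra.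
move=> e0; have [k [/= k1 k2]] := filter_ex (filterI (xU e e0) (xU' e e0)).
have [r1 r2 _ _] := h k.
have [_ a] := r1 x x' (psi x') sx sx' sy'.
have [b _] := r2 x (psi x) (psi x') sx sy sy'.
have [c _] := r1 x x' (psi x) sx sx' sy.
have [_ d] := r2 x' (psi x) (psi x') sx' sy sy'.
rewrite (mdistC (psi x') (psi x)) in d.
by rewrite ler_distl; lra.
Qed.

(** For each [x] the couplings bring [x] close to [psi x], but a priori not uniformly in [x]. As
    [psi] is an isometry, uniformity holds on finitely many small balls; such unions exhaust the
    set, and [eta] absorbs the error of the couplings. *)
Lemma coupling_limit_measure_le X Y (rho : nat -> X -> Y -> R) psi (C : set Y) :
  vanishing_couplings rho -> coupling_limit rho psi -> closed C ->
  (mm_measure X (mm_support (X := X) `&` psi @^-1` C) <= mm_measure Y C)%E.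
Proof.
move=> h psiP cC; have iso := coupling_limit_isometric h psiP.
have mS := @measurable_mm_support R X.
have mA : measurable (mm_support (X := X) `&` psi @^-1` C : set (borel X)).
  by apply: (isometric_on_borel mS iso) => //; exact: closed_borel.
apply: closed_thickening_cvg => // e e0.
have e80 : 0 < e / 8 by rewrite divr_gt0.
have e160 : 0 < e / 16 by rewrite divr_gt0.
have [s sd] := dense_sequence X.
pose b i : set (borel X) := [set x | mdist (s i) x < e / 8].
have mb i : measurable (b i) by apply: open_borel; exact: open_mball.
pose A n := (mm_support (X := X) `&` psi @^-1` C) `&` \bigcup_(i in [set i | (i < n)%N]) b i.
have mAn n : measurable (A n : set (borel X)).
  by apply: measurableI => //; exact: bigcup_measurable.
have Alim : \bigcup_n A n = mm_support (X := X) `&` psi @^-1` C.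
  apply/seteqP; split=> [x [n _ []]//|x Ax]; have [i ix] := sd x _ e80.
  by exists i.+1 => //; split=> //; exists i => /=.
suff An n : (mm_measure X (A n) <= mm_measure Y (thickening e C))%E.
  rewrite -Alim.
  have cv : mm_measure X \o A @ \oo --> mm_measure X (\bigcup_n A n).
    apply: (@nondecreasing_cvg_mu _ (borel X)) => //.
      exact: (@bigcupT_measurable _ (borel X)).
    move=> m n mn; apply/subsetPset => x [Ax [i /= im bi]]; split => //.
    by exists i => //=; exact: leq_trans mn.
  rewrite -(cvg_lim _ cv)//; apply: lime_le; first by apply/cvg_ex; eexists; exact: cv.
  by apply: nearW => k; exact: An.
apply/lee_addgt0Pr => eta eta0.
have eta20 : 0 < eta / 2 by rewrite divr_gt0.
(* the couplings bring psi within e of the identity uniformly on finitely many balls *)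
have Unear : U [set k | forall i x, (i < n)%N -> mm_support x -> b i x -> rho k x (psi x) <= 5 / 8 * e].
  elim: n => [|n IH]; first by apply: filterS (@filterT _ U _).
  have [[x0 [sx0 bx0]]|none] := pselect (exists x, mm_support x /\ b n x).
    have [sy0 Ux0] := psiP x0 sx0.
    apply: filterS (filterI IH (Ux0 _ e80)) => k [/= hk kx0] i x.
    rewrite ltnS leq_eqVlt => /orP[/eqP -> sx bx|]; last exact: hk.
    have [sy _] := psiP x sx; have [r1 r2 _ _] := h k.
    (* The sum e/4 + e/8 + e/4: the diameter of the ball, the value at [x0], and the diameter again,
       carried over by [psi]. *)
    have [_ a] := r1 x x0 (psi x) sx sx0 sy.
    have [_ a'] := r2 x0 (psi x) (psi x0) sx0 sy sy0.
    have isoE : mdist (psi x0) (psi x) = mdist x0 x by apply: iso; rewrite inE.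
    have := mdist_tri (s n) x0 x; rewrite (mdistC x0 (s n)) (mdistC x x0) in a *.
    by move: bx0 bx; rewrite /b /= => bx0 bx; lra.
  apply: filterS IH => k hk i x; rewrite ltnS leq_eqVlt => /orP[/eqP -> sx bx|]; last exact: hk.
  by exfalso; apply: none; exists x.
have [k [/= kn [ke keta]]] := filter_ex
  (filterI Unear (filterI (U_invS_lt Uoo e160) (U_invS_lt Uoo eta20))).
have [r1 r2 r3 _] := h k.
apply: (le_trans (r3 (A n) (thickening e C) (mAn n) (measurable_thickening e C) _)).
  move=> x y [[_ Cx] [i /= im bi]] sx sy xy; exists (psi x) => //=.
  have [sy' _] := psiP x sx; have [a _] := r2 x (psi x) y sx sy' sy.
  have := kn i x im sx bi; move: ke xy; move: (k.+1%:R^-1 : R) => t; lra.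
rewrite leeD2l// lee_fin; move: keta; move: (k.+1%:R^-1 : R) => t; lra.
Qed.

End limit_isometry.

(** [psi] inverts [psi'] because both are limits along the same ultrafilter. The inequality on
    closed sets, used for both maps, becomes an equality; complements carry it to the open sets,
    which generate. *)
Lemma mm_close_iso (R : realType) (X Y : mm_space R) :
  (forall e, 0 < e -> mm_close X Y e) -> mm_iso X Y.
Proof.
move=> h; have [rho vc] := vanishing_couplings_exist h.
have vc' := vanishing_couplings_flip vc.
have [U [UU Uoo]] := ultraFilterLemma (F := \oo) _.
have [psi psiP] := coupling_limit_exists UU Uoo vc.
have [psi' psiP'] := coupling_limit_exists UU Uoo vc'.
have iso := coupling_limit_isometric UU vc psiP.
have psiK y : mm_support y -> psi (psi' y) = y.
  move=> sy; have [sx yU] := psiP' y sy; have [sy' xU] := psiP _ sx.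
  apply: mdist_positivity; apply/eqP; rewrite eq_le mdist_ge0 andbT.
  apply/ler_addgt0Pl => e e0; have e20 : 0 < e / 2 by rewrite divr_gt0.
  have [k [/= k1 k2]] := filter_ex (filterI (yU _ e20) (xU _ e20)).
  have [_ r2 _ _] := vc k; have [a _] := r2 _ _ _ sx sy' sy; lra.
have massE : mm_measure X setT = mm_measure Y setT.
  rewrite !massE; congr EFin; apply/eqP; rewrite -subr_eq0 -normr_le0.
  by apply/ler_addgt0Pl => e e0; rewrite addr0 ltW// mm_close_mass//; exact: h.
exists (IsometricEmbedding iso); split.
  apply/seteqP; split=> [_ [x sx <-]|y sy]; first by have [] := psiP x sx.
  by exists (psi' y); [have [] := psiP' y sy|exact: psiK].
have closedE (C : set Y) : closed C -> mm_push (IsometricEmbedding iso) C = mm_measure Y C.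
  move=> cC; rewrite mm_pushE; apply/eqP; rewrite eq_le; apply/andP; split.
    exact: (coupling_limit_measure_le UU Uoo vc psiP cC).
  pose D := mm_support (X := X) `&` psi @^-1` C.
  have cD : closed D.
    rewrite -openC; apply/open_mballP => x nDx.
    have [sx|nsx] := pselect (mm_support x); last first.
      have [r r0 rS] := (open_mballP (~` mm_support (X := X))).1
        (closed_openC (@closed_msupport _ _ (mm_measure X))) x nsx.
      by exists r => // x' /rS h' [].
    have nC : (~` C) (psi x) by move=> Cx; exact: nDx.
    have [r r0 rC] := (open_mballP (~` C)).1 (closed_openC cC) _ nC.
    exists r => // x' xx' [sx' Cx']; apply: (rC (psi x')) => //.
    by rewrite iso ?inE.
  have := coupling_limit_measure_le UU Uoo vc' psiP' cD.
  rewrite -[in X in (_ <= X)%E -> _]/D; apply: le_trans.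
  rewrite -(mm_measure_setI_support (closed_borel cC)).
  apply: le_measure; rewrite ?inE.
  - by apply: (@measurableI _ (borel Y)); [exact: measurable_mm_support|exact: closed_borel].
  - have iso' := coupling_limit_isometric UU vc' psiP'.
    apply: (isometric_on_borel (@measurable_mm_support R Y) iso').
      exact: measurable_mm_support.
    exact: closed_borel.
  - by move=> y [sy Cy]; split=> //; split; [have [] := psiP' y sy|rewrite /= psiK].
move=> A mA.
apply: (@measure_unique _ R (borel Y) (@open Y) (fun=> setT) erefl _ _ _
  (mm_push (IsometricEmbedding iso)) (mm_measure Y)) => //.
- by move=> O O'; exact: openI.
- by move=> _; exact: openT.
- by rewrite bigcup_const//; exists 0%N.
- move=> O oO; have cO : closed (~` O) by rewrite closedC.
  have mO := open_borel oO; have mC := closed_borel cO.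
  have := closedE _ cO => /eqP.
  have mT : mm_push (IsometricEmbedding iso) setT = mm_measure Y setT by exact: closedE closedT.
  have e1 : (mm_push (IsometricEmbedding iso) setT = mm_push (IsometricEmbedding iso) O +
    mm_push (IsometricEmbedding iso) (~` O))%E by rewrite -measureU ?setUv// setICr.
  have e2 : (mm_measure Y setT = mm_measure Y O + mm_measure Y (~` O))%E.
    by rewrite -measureU ?setUv// setICr.
  rewrite e1 e2 in mT; move=> /eqP h1; rewrite h1 in mT.
  have mfin : mm_measure Y (~` O) \is a fin_num by rewrite fin_num_measure.
  by have := congr1 (fun z => z - mm_measure Y (~` O))%E mT; rewrite !addeK.
- by move=> _; rewrite ltey_eq fin_num_measure.
Qed.

(** * Realisation of plans on the line *)

Section lebesgue_splitting.
Context (R : realType).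
Local Notation lam := (@lebesgue_measure R).

Lemma lebesgue_measureT : lam setT = +oo%E.
Proof. by rewrite -(set_itvNyy R) lebesgue_measure_itv. Qed.

Lemma lebesgue_le (A B : set R) : measurable A -> measurable B -> A `<=` B ->
  (lam A <= lam B)%E.
Proof. by move=> mA mB AB; apply: le_measure => //; rewrite inE. Qed.

Lemma lebesgueU2 (A B : set R) : measurable A -> measurable B ->
  (lam (A `|` B) <= lam A + lam B)%E.
Proof. by move=> mA mB; exact: measureU2. Qed.

Lemma lebesgueU (A B : set R) : measurable A -> measurable B -> A `&` B = set0 ->
  (lam (A `|` B) = lam A + lam B)%E.
Proof. by move=> mA mB AB; exact: measureU. Qed.

Lemma lebesgueD (A B : set R) : measurable A -> measurable B -> B `<=` A ->
  lam A = (lam B + lam (A `\` B))%E.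
Proof.
move=> mA mB BA; rewrite -lebesgueU ?setDIK ?setDUK//.
exact: measurableD.
Qed.

(** The measure of the part of [E] to the left of [t] is 1-Lipschitz in [t], and the intermediate
    value theorem reaches [c]. *)
Let lebesgue_bounded_subset (E : set R) (a b c : R) : measurable E -> a <= b ->
  E `<=` `]a, b] -> 0 <= c -> (c%:E <= lam E)%E ->
  exists A, [/\ measurable A, A `<=` E & lam A = c%:E].
Proof.
move=> mE ab Eab c0 cE.
have mI t : measurable (E `&` `]-oo, t]) by exact: measurableI.
have EIab t : (lam (E `&` `]-oo, t]) < +oo)%E.
  apply: (@le_lt_trans _ _ (lam `]a, b])).
    by apply: lebesgue_le => // x [/Eab].
  by rewrite lebesgue_measure_itv/=; case: ifP => _; rewrite -?EFinB ltry.
pose f t := fine (lam (E `&` `]-oo, t])).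
have fE t : lam (E `&` `]-oo, t]) = (f t)%:E by rewrite fineK// ge0_fin_numE.
have flip s t : s <= t -> f s <= f t <= f s + (t - s).
  move=> st; rewrite -!lee_fin EFinD -!fE; apply/andP; split.
    apply: lebesgue_le => // x [Ex] /=; rewrite !in_itv/= => xs.
    by split=> //=; rewrite ?in_itv/= (le_trans xs).
  apply: (@le_trans _ _ (lam ((E `&` `]-oo, s]) `|` `]s, t]))).
    apply: lebesgue_le => //; first exact: measurableU.
    move=> x [Ex] /=; rewrite !in_itv/= => xt.
    have [xs|sx] := leP x s; first by left; split=> //=; rewrite ?in_itv/=.
    by right; rewrite /= ?in_itv/=.
  apply: (le_trans (lebesgueU2 _ _)) => //.
  rewrite leeD2l// lebesgue_measure_itv/= lte_fin.
  by case: ltP => // _; rewrite ?lee_fin ?subr_ge0// -EFinB.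
have fcont : continuous f.
  move=> x; apply/cvgrPdist_le => e e0; near=> y.
  have xy : `|x - y| < e by near: y; apply: filterS (nbhsx_ballx x e e0) => z; rewrite -ball_normE.
  have [h|/ltW h] := leP x y; have /andP[h1 h2] := flip _ _ h.
    by move: xy; rewrite ler_norml ltr_norml => /andP[u v]; apply/andP; split; lra.
  by move: xy; rewrite ler_norml ltr_norml => /andP[u v]; apply/andP; split; lra.
have fa : f a = 0.
  rewrite /f (_ : E `&` _ = set0) ?measure0//.
  apply/seteqP; split=> // x [/Eab /=]; rewrite !in_itv/= => /andP[ax _] xa.
  by move: ax; rewrite ltNge xa.
have fb : (f b)%:E = lam E.
  rewrite -fE; congr (lam _); apply/seteqP; split=> [x []//|x Ex]; split => //=.
  by move: (Eab _ Ex) => /=; rewrite !in_itv/= => /andP[].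
have [||t _ ft] := @IVT R f a b c ab.
- exact: continuous_subspaceT.
- rewrite fa -fb lee_fin in cE *.
  by rewrite ge_min c0/= le_max cE orbT.
exists (E `&` `]-oo, t]); split => //; last by rewrite fE ft.
Unshelve. all: by end_near. Qed.

(** Bounded truncations exhaust [E], so one of them has measure at least any [c] strictly below
    [lam E]; the value [lam E] itself is attained by [E]. *)
Lemma lebesgue_subset (E : set R) (c : R) : measurable E -> 0 <= c -> (c%:E <= lam E)%E ->
  exists A, [/\ measurable A, A `<=` E & lam A = c%:E].
Proof.
move=> mE c0 cE.
have [ceq|cne] := eqVneq c%:E (lam E); first by exists E; split; rewrite ?ceq.
have {cne}clt : (c%:E < lam E)%E by rewrite lt_neqAle cne.
pose F n := E `&` `](- n%:R : R), n%:R].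
have mF n : measurable (F n) by exact: measurableI.
have FE : \bigcup_n F n = E.
  apply/seteqP; split=> [x [n _ []]//|x Ex].
  exists (Num.truncn `|x|).+1 => //; split=> //=; rewrite ?in_itv/=.
  have := Num.Theory.truncnS_gt `|x|; rewrite ltr_norml => /andP[h1 h2].
  by rewrite h1 ltW.
have cv : lam \o F @ \oo --> lam E.
  rewrite -[in X in _ --> X]FE; apply: nondecreasing_cvg_mu => //.
    exact: bigcupT_measurable.
  move=> m n mn; apply/subsetPset => x [Ex] /=; rewrite !in_itv/= => /andP[h1 h2].
  have mnR : (m%:R : R) <= n%:R by rewrite ler_nat.
  by split=> //=; rewrite ?in_itv/= (le_trans h2 mnR) (le_lt_trans _ h1)// lerN2.
have [n cn] : exists n, (c%:E <= lam (F n))%E.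
  apply: contrapT => /forallNP h; move: clt; rewrite ltNge => /negP; apply.
  rewrite -(cvg_lim _ cv)//; apply: lime_le; first by apply/cvg_ex; eexists; exact: cv.
  by apply: nearW => k; have /negP := h k; rewrite -ltNge => /ltW.
have [||A [mA AF lA]] := @lebesgue_bounded_subset (F n) (- n%:R) n%:R c (mF n) _ _ c0 cn.
- by rewrite ge0_cp.
- by move=> x [].
by exists A; split=> // x /AF[].
Qed.

(** Nested sets whose measures are the partial sums are built one at a time; the pieces are their
    successive differences. *)
Lemma lebesgue_countable_split (E : set R) (c : nat -> R) : measurable E ->
  (forall j, 0 <= c j) -> (forall n, (\sum_(j < n) c j)%:E <= lam E)%E ->
  exists A : nat -> set R, [/\ forall j, measurable (A j), forall j, A j `<=` E,
    forall i j x, A i x -> A j x -> i = j & forall j, lam (A j) = (c j)%:E].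
Proof.
move=> mE c0 cE.
pose St n := {B : set R | [/\ measurable B, B `<=` E & lam B = (\sum_(j < n) c j)%:E]}.
have step n (B : St n) : {B' : St n.+1 | sval B `<=` sval B'}.
  case: B => B [mB BE lB] /=.
  have mD : measurable (E `\` B) by exact: measurableD.
  have lE : lam E = (lam B + lam (E `\` B))%E.
    by rewrite -lebesgueU// ?setDIK// setDUK.
  have cD : ((c n)%:E <= lam (E `\` B))%E.
    have := cE n.+1; rewrite lE big_ord_recr/= EFinD lB leeD2lE//.
  have [A [mA AD lA]] := cid (lebesgue_subset mD (c0 n) cD).
  have h : [/\ measurable (B `|` A), B `|` A `<=` E & lam (B `|` A) = (\sum_(j < n.+1) c j)%:E].
    split.
    - exact: measurableU.
    - by move=> x [/BE //|/AD []].
    - rewrite lebesgueU//; first by rewrite lB lA big_ord_recr/= EFinD.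
      by apply/seteqP; split=> // x [Bx /AD[_]].
  by exists (exist _ (B `|` A) h : St n.+1) => x /=; left.
have St0 : St 0%N by exists set0; split=> //; rewrite measure0 big_ord0.
pose B := nat_rect St St0 (fun n B => sval (step n B)).
have BS n : sval (B n) `<=` sval (B n.+1) by exact: (svalP (step n (B n))).
have Bmono m n : (m <= n)%N -> sval (B m) `<=` sval (B n).
  elim: n => [|n IH]; first by rewrite leqn0 => /eqP ->.
  rewrite leq_eqVlt => /orP[/eqP -> //|]; rewrite ltnS => /IH h.
  by apply: (subset_trans h).
exists (fun n => sval (B n.+1) `\` sval (B n)); split.
- by move=> n; have [m1 _ _] := svalP (B n.+1); have [m2 _ _] := svalP (B n); exact: measurableD.
- by move=> n x [+ _]; have [_ h _] := svalP (B n.+1); exact: h.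
- move=> i j x [Bi nBi] [Bj nBj]; case: (ltngtP i j) => // ij; exfalso.
    by apply: nBj; exact: (Bmono i.+1 j).
  by apply: nBi; exact: (Bmono j.+1 i).
- move=> n; have [m1 _ l1] := svalP (B n.+1); have [m2 _ l2] := svalP (B n).
  have : ((\sum_(j < n.+1) c j)%:E =
      (\sum_(j < n) c j)%:E + lam (sval (B n.+1) `\` sval (B n)))%E.
    by rewrite -[LHS]l1 -[X in (X + _)%E]l2; exact: lebesgueD.
  move: (lam (_ `\` _)) => D; rewrite big_ord_recr/= EFinD.
  by case: D => [d| |] //; rewrite -?EFinD => -[] /addrI ->.
Qed.

End lebesgue_splitting.

(** Countable additivity along the enumeration [pickle]. It carries equalities for single labels,
    between two different spaces, over to unions of cells. *)
Lemma label_measure_eq d1 d2 (Om1 : measurableType d1) (Om2 : measurableType d2)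
    (R : realType) (P1 : {measure set Om1 -> \bar R}) (P2 : {measure set Om2 -> \bar R})
    (C : countType) (l1 : Om1 -> C) (l2 : Om2 -> C) (B : set C) :
  (forall c, B c -> measurable (l1 @^-1` [set c])) ->
  (forall c, B c -> measurable (l2 @^-1` [set c])) ->
  (forall c, B c -> P1 (l1 @^-1` [set c]) = P2 (l2 @^-1` [set c])) ->
  P1 (l1 @^-1` B) = P2 (l2 @^-1` B).
Proof.
move=> m1 m2 E.
pose D n : set C := [set c | B c /\ @choice.pickle C c = n].
have BD : B = \bigcup_n D n.
  by apply/seteqP; split=> [c Bc|c [n _ []//]]; exists (choice.pickle c).
have tD : trivIset setT D.
  apply/trivIsetP => m n _ _ mn; apply/seteqP; split=> // c [[_ cm] [_ cn]].
  by move: mn; rewrite -cm -cn eqxx.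
have DE n : D n = set0 \/ exists2 c, B c & D n = [set c].
  have [[c [Bc cn]]|/forallNP none] := pselect (exists c, D n c); last first.
    by left; apply/seteqP; split=> // c /none.
  right; exists c => //; apply/seteqP; split=> [c' [_ c'n]|_ ->]; last by split.
  by apply: (pcan_inj (@choice.pickleK C)); rewrite c'n.
have tl T (l : T -> C) : trivIset setT (fun n => l @^-1` D n).
  apply/trivIsetP => m n _ _ mn; rewrite -preimage_setI.
  by move/trivIsetP : tD => -> //; rewrite preimage_set0.
rewrite BD !preimage_bigcup !measure_bigcup//; last 2 first.
- by move=> n _; have [->|[c Bc ->]] := DE n; [rewrite preimage_set0|exact: m2].
- by move=> n _; have [->|[c Bc ->]] := DE n; [rewrite preimage_set0|exact: m1].
apply: eq_eseriesr => n _.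
by have [->|[c Bc ->]] := DE n; [rewrite !preimage_set0 !measure0|exact: E].
Qed.

Lemma label_prefix_sum d (Om : measurableType d) (R : realType)
    (P : {finite_measure set Om -> \bar R}) (E : set Om) (l : Om -> nat) n :
  measurable E -> measurable_fun setT l ->
  (\sum_(j < n) fine (P (E `&` l @^-1` [set (j : nat)])))%:E = P (E `&` l @^-1` `I_n).
Proof.
move=> mE ml; elim: n => [|n IH].
  by rewrite big_ord0 II0 preimage_set0 setI0 measure0.
have mj B : measurable (E `&` l @^-1` B).
  by apply: measurableI => //; exact: measurable_preimage_nat.
rewrite big_ord_recr/= EFinD IH -(fin_measureE P)// -measureU//.
  by rewrite -setIUr -preimage_setU -IIS.
rewrite setIACA -preimage_setI; apply/seteqP; split=> // x [_ [/=]].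
by move=> + lx; rewrite lx ltnn.
Qed.

Section relabelling.
Context (R : realType).
Local Notation lam := (@lebesgue_measure R).

(** Each cell of [L] is split separately, and what remains of it receives the label 0, whose measure
    is therefore not prescribed. *)
Lemma lebesgue_relabel (L : R -> nat) (W : nat -> nat -> R) :
  measurable_fun setT L -> (forall i j, 0 <= W i j) ->
  (forall i n, ((\sum_(j < n) W i j)%:E <= lam (L @^-1` [set i]))%E) ->
  exists L' : R -> nat, measurable_fun setT L' /\
    forall i j, j != 0%N -> lam (L @^-1` [set i] `&` L' @^-1` [set j]) = (W i j)%:E.
Proof.
move=> mL W0 Wle.
have /choice[A AP] i := lebesgue_countable_split
  (measurable_preimage_nat [set i] mL) (W0 i) (Wle i).
pose L' t := xget 0%N [set j | j != 0%N /\ A (L t) j t].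
have L'E i j : j != 0%N -> L @^-1` [set i] `&` L' @^-1` [set j] = A i j.
  move=> j0; have [_ AL Ainj _] := AP i; apply/seteqP; split=> [t [/= Li L'j]|t Aij].
    move: L'j j0; rewrite /L'; case: xgetP => [j' _ /= [_ +] <- _|_ <- //]; first by rewrite Li.
  have Li : L t = i by exact: AL Aij.
  split => //=; rewrite /L' Li; case: xgetP => [j' _ /= [_ Aij']|/(_ j) []]; first exact: Ainj Aij.
  by [].
exists L'; split; last by move=> i j j0; rewrite L'E//; have [_ _ _ ->] := AP i.
have mL'j j : j != 0%N -> measurable (L' @^-1` [set j]).
  move=> j0; rewrite (_ : _ @^-1` _ = \bigcup_i A i j); last first.
    apply/seteqP; split=> [t tj|t [i _]]; last by rewrite -L'E// => -[].
    by exists (L t) => //; rewrite -L'E.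
  by apply: bigcupT_measurable => i; have [m _ _ _] := AP i; exact: m.
apply: measurable_fun_nat => -[|j]; last exact: mL'j.
rewrite (_ : _ @^-1` _ = ~` \bigcup_j L' @^-1` [set j.+1]).
  by apply: measurableC; apply: bigcupT_measurable => j; exact: mL'j.
apply/seteqP; split=> [t /= t0 [j _ /=]|t]; first by rewrite t0.
move=> h /=; case e : (L' t) => [//|j]; exfalso; apply: h; by exists j.
Qed.

End relabelling.

Section plan_realisation.
Context (R : realType) (Z : polishMetricType R).
Local Notation lam := (@lebesgue_measure R).
Implicit Types (mu : fin_borel_measure R Z).

(* Label 0 is kept for the points outside of the realised mass. *)
Definition realises (L : R -> nat) mu (q : Z -> nat) :=
  measurable_fun setT L /\
  forall i, i != 0%N -> lam (L @^-1` [set i]) = mu (q @^-1` [set i]).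

Lemma realises_measure L mu q (B : set nat) : realises L mu q ->
  measurable_fun setT (q : borel Z -> nat) -> ~ B 0%N ->
  lam (L @^-1` B) = mu (q @^-1` B).
Proof.
move=> [mL LE] mq B0; apply: (label_measure_eq (C := nat)) => i Bi.
- exact: measurable_preimage_nat.
- exact: measurable_preimage_nat.
- by apply: LE; apply: contra_notN B0 => /eqP <-.
Qed.

(** A finite mass is realised on a line of infinite measure; this is the room from which new mass is
    taken. *)
Lemma realises_outside L mu q : realises L mu q ->
  measurable_fun setT (q : borel Z -> nat) -> lam (L @^-1` [set 0%N]) = +oo%E.
Proof.
move=> h mq; have [mL _] := h.
have m0 : measurable (L @^-1` [set 0%N]) by exact: measurable_preimage_nat.
have m1 : measurable (L @^-1` [set i | i != 0%N]) by exact: measurable_preimage_nat.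
have := @lebesgue_measureT R.
rewrite (_ : setT = L @^-1` [set 0%N] `|` L @^-1` [set i | i != 0%N]); last first.
  by apply/seteqP; split=> // t _; case e : (L t) => [|i]; [left|right; rewrite /= e].
rewrite lebesgueU//; last by apply/seteqP; split=> // t [/= ti]; rewrite ti.
rewrite (realises_measure (B := [set i | i != 0%N]) h mq)//.
rewrite (fin_measureE mu); last exact: measurable_preimage_nat.
by case: (lam _) => [x| |].
Qed.

(** In the cell [i] of [L] the new labels follow [g], and the mass that [g] drops gets label 0. The
    mass of [mu'] that [g] does not reach is taken from the outside, the cell 0 of [L]. *)
Lemma realise_plan mu mu' (q q' : Z -> nat) (g : fin_borel_measure R (Z * Z)%type) L :
  measurable_fun setT (q : borel Z -> nat) -> measurable_fun setT (q' : borel Z -> nat) ->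
  (forall x, q x != 0%N) -> (forall x, q' x != 0%N) ->
  subplan g mu mu' -> realises L mu q ->
  exists L', realises L' mu' q' /\ forall i j, i != 0%N -> j != 0%N ->
    lam (L @^-1` [set i] `&` L' @^-1` [set j]) =
    g ((fun z => (q z.1, q' z.2)) @^-1` [set (i, j)]).
Proof.
move=> mq mq' q0 q'0 [g1 g2] h; have [mL LE] := h.
have mq1 : measurable_fun setT ((fun z => q z.1) : borel (Z * Z)%type -> nat).
  by apply: (measurableT_comp mq); exact: measurable_fst_borel.
have mq2 : measurable_fun setT ((fun z => q' z.2) : borel (Z * Z)%type -> nat).
  by apply: (measurableT_comp mq'); exact: measurable_snd_borel.
pose G i j : set (borel (Z * Z)%type) := (fun z => q z.1) @^-1` [set i] `&` (fun z => q' z.2) @^-1` [set j].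
have GE i j : (fun z => (q z.1, q' z.2)) @^-1` [set (i, j)] = G i j.
  by apply/seteqP; split=> [z [h1 h2]|z [/= -> ->]].
have mG i j : measurable (G i j).
  by apply: measurableI; exact: measurable_preimage_nat.
pose G2 j : set (borel (Z * Z)%type) := (fun z => q' z.2) @^-1` [set j].
have mG2 j : measurable (G2 j) by exact: measurable_preimage_nat.
have G2le j : (g (G2 j) <= mu' (q' @^-1` [set j]))%E.
  have := g2 (q' @^-1` [set j]) (measurable_preimage_nat [set j] mq').
  by rewrite marginal2E.
have mq'j j : measurable (q' @^-1` [set j] : set (borel Z)) by exact: measurable_preimage_nat.
pose W i j : R := if j == 0%N then 0 else
  if i == 0%N then fine (mu' (q' @^-1` [set j])) - fine (g (G2 j)) else fine (g (G i j)).
have W0 i j : 0 <= W i j.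
  rewrite /W; case: eqP => // _; case: eqP => _; last by rewrite fine_ge0.
  by rewrite subr_ge0 -lee_fin -!fin_measureE.
have Wle i n : ((\sum_(j < n) W i j)%:E <= lam (L @^-1` [set i]))%E.
  have [->|i0] := eqVneq i 0%N; first by rewrite (realises_outside h mq) leey.
  rewrite LE//; apply: (@le_trans _ _ (g ((fun z => q z.1) @^-1` [set i]))); last first.
    by have := g1 (q @^-1` [set i]) (measurable_preimage_nat [set i] mq); rewrite marginal1E.
  have mi : measurable ((fun z => q z.1) @^-1` [set i] : set (borel (Z * Z)%type)).
    exact: measurable_preimage_nat.
  apply: (@le_trans _ _ (g ((fun z => q z.1) @^-1` [set i] `&` (fun z => q' z.2) @^-1` `I_n))); last first.
    apply: le_measure; rewrite ?inE//.
    by apply: measurableI => //; exact: measurable_preimage_nat.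
  rewrite -(label_prefix_sum g n mi mq2) lee_fin; apply: ler_sum => j _.
  by rewrite /W (negbTE i0); case: ifP => // _; rewrite fine_ge0.
have [L' [mL' L'E]] := lebesgue_relabel mL W0 Wle.
have pairE i j : i != 0%N -> j != 0%N ->
    lam (L @^-1` [set i] `&` L' @^-1` [set j]) =
    g ((fun z => (q z.1, q' z.2)) @^-1` [set (i, j)]).
  move=> i0 j0; rewrite L'E// GE /W (negbTE i0) (negbTE j0).
  by rewrite -(fin_measureE g).
exists L'; split => //; split => // j j0.
have mL0 i : measurable (L @^-1` [set i]) by exact: measurable_preimage_nat.
have mL'j : measurable (L' @^-1` [set j]) by exact: measurable_preimage_nat.
rewrite -(setTI (L' @^-1` [set j])) -(setUv (L @^-1` [set 0%N])) setIUl lebesgueU; last 3 first.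
- exact: measurableI.
- by apply: measurableI => //; exact: measurableC.
- by rewrite setIACA setICr set0I.
rewrite L'E// /W (negbTE j0) eqxx.
(* The nonzero cells of [L] together give the second marginal of [g]; the part taken from outside
   completes it to [mu']. *)
have -> : lam (~` (L @^-1` [set 0%N]) `&` L' @^-1` [set j]) = g (G2 j).
  have := @label_measure_eq _ _ _ _ R lam g (nat * nat)%type (fun t => (L t, L' t))
    (fun z => (q z.1, q' z.2)) [set p | p.1 != 0%N /\ p.2 = j].
  rewrite (_ : (fun t => (L t, L' t)) @^-1` _ = ~` (L @^-1` [set 0%N]) `&` L' @^-1` [set j]); last first.
    by apply/seteqP; split=> t [/= /eqP h1 h2].
  rewrite (_ : (fun z => (q z.1, q' z.2)) @^-1` [set p | p.1 != 0%N /\ p.2 = j] = G2 j); last first.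
    by apply/seteqP; split=> z /=; [case|move=> ->; split].
  have pE (T1 : Type) (l1 l2 : T1 -> nat) c : (fun t => (l1 t, l2 t)) @^-1` [set c] =
      l1 @^-1` [set c.1] `&` l2 @^-1` [set c.2].
    by case: c => a b; apply/seteqP; split=> [t [h1 h2]|t [/= -> ->]].
  apply.
  - by move=> c _; rewrite pE; apply: measurableI; exact: measurable_preimage_nat.
  - by move=> c _; rewrite pE; exact: mG.
  - by move=> [i k] [/= i0 ->]; rewrite pE /= pairE.
by rewrite (fin_measureE g (mG2 j)) -EFinD subrK -(fin_measureE mu' (mq'j j)).
Qed.

(** A relabelling of the constant label 0, whose cell is the whole line. *)
Lemma realises_exists mu (q : Z -> nat) :
  measurable_fun setT (q : borel Z -> nat) -> (forall x, q x != 0%N) ->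
  exists L, realises L mu q.
Proof.
move=> mq q0; pose W i j : R := if i == 0%N then fine (mu (q @^-1` [set j])) else 0.
have T0 : (fun _ : R => 0%N) @^-1` [set 0%N] = setT by apply/seteqP; split.
have [||L [mL LE]] := @lebesgue_relabel R (fun _ => 0%N) W (@measurable_cst _ _ _ _ setT 0%N).
- by move=> i j; rewrite /W; case: ifP => // _; rewrite fine_ge0.
- move=> i n; have [->|i0] := eqVneq i 0%N; last first.
    by rewrite big1// => j _; rewrite /W (negbTE i0).
  by rewrite T0 lebesgue_measureT leey.
exists L; split=> // j j0.
have := LE 0%N j j0; rewrite T0 setTI.
by move=> ->; rewrite /W eqxx -fin_measureE//; exact: measurable_preimage_nat.
Qed.

End plan_realisation.

(** * Completeness *)

Section geometric.
Context (R : realType).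

Definition half_pow k : R := (2^-1) ^+ k.
Local Notation t := half_pow.

Lemma half_pow_gt0 k : 0 < t k. Proof. by rewrite exprn_gt0. Qed.

Lemma half_powS k : t k = 2 * t k.+1.
Proof. by rewrite /half_pow exprS mulVKf. Qed.

Lemma half_pow_le k n : (k <= n)%N -> t n <= t k.
Proof.
move=> /subnK <-; elim: (n - k)%N => [//|m IH].
by rewrite addSn; have := half_powS (m + k); have := half_pow_gt0 (m + k).+1; lra.
Qed.

Lemma half_pow_le1 k : t k <= 1.
Proof. by have := half_pow_le (leq0n k); rewrite {2}/half_pow expr0. Qed.

Lemma half_pow_small (e : R) : 0 < e -> exists N, forall k, (N <= k)%N -> t k < e.
Proof.
move=> e0; have : t @ \oo --> (0 : R).
  by apply: cvg_expr; rewrite ger0_norm// invf_lt1// ltr1n.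
by move=> /cvgrPdist_lt/(_ e e0)[N _ h]; exists N => k /h; rewrite sub0r normrN ger0_norm// ltW// half_pow_gt0.
Qed.

Lemma geometric_tail d (T : measurableType d) (P : {measure set T -> \bar R})
    (F : nat -> set T) k (a : R) : (forall n, measurable (F n)) -> 0 <= a ->
  (forall n, P (F n) <= (a * t n)%:E)%E -> (P (\bigcup_n F (k + n)%N) <= (2 * a * t k)%:E)%E.
Proof.
move=> mF a0 hF.
(* The subtracted term makes the bound telescope. *)
have partial n : (\sum_(0 <= i < n) P (F (k + i)%N) <= (2 * a * t k - 2 * a * t (k + n)%N)%:E)%E.
  elim: n => [|n IH]; first by rewrite big_nil addn0 subrr.
  rewrite big_nat_recr//=; apply: le_trans (leeD IH (hF _)) _.
  by rewrite -EFinD lee_fin addnS (half_powS (k + n)); nra.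
apply: (@le_trans _ _ (\sum_(0 <= i <oo) P (F (k + i)%N))%E).
  apply: measure_sigma_subadditive => //; first exact: bigcupT_measurable.
apply: lime_le; first exact: is_cvg_nneseries.
apply: nearW => n; apply: le_trans (partial n) _.
by rewrite lee_fin gerBl !mulr_ge0// ltW// half_pow_gt0.
Qed.

Lemma complete_geometric_limit (Z : polishMetricType R) (y : nat -> Z) N :
  (forall k, (N <= k)%N -> mdist (y k) (y k.+1) <= t k) ->
  exists z, forall k, (N <= k)%N -> mdist (y k) z <= 2 * t k.
Proof.
move=> h.
have hn k n : (N <= k)%N -> mdist (y k) (y (n + k)%N) <= 2 * t k - 2 * t (n + k)%N.
  move=> Nk; elim: n => [|n IH]; first by rewrite mdistrr subrr.
  have := mdist_tri (y (n + k)%N) (y k) (y (n.+1 + k)%N).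
  have := h (n + k)%N (leq_trans Nk (leq_addl _ _)).
  by rewrite addSn; have := half_powS (n + k); lra.
have hk k n : (N <= k)%N -> (k <= n)%N -> mdist (y k) (y n) <= 2 * t k.
  move=> Nk /subnK <-; have := hn k (n - k)%N Nk.
  have := half_pow_gt0 (n - k + k). lra.
have /cvg_ex[z yz] : cvg (y @ \oo).
  apply/cauchy_cvgP/cauchy_exP => e e0.
  have [M hM] := half_pow_small (e := e / 2) ltac:(by rewrite divr_gt0).
  exists (y (maxn N M)); change (\forall n \near \oo, ball (y (maxn N M)) e (y n)).
  exists (maxn N M) => // n /= Mn; rewrite ballEmdist /=.
  have := hk _ n (leq_maxl N M) Mn; have := hM _ (leq_maxr N M); lra.
exists z => k Nk; apply/ler_addgt0Pl => e e0.
have /metricType_numDomainType.cvgrPdist_lt/(_ e e0)[M _ hM] := yz.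
have := hM (maxn M k) (leq_maxl _ _); have := hk _ _ Nk (leq_maxr M k).
have := mdist_tri (y (maxn M k)) (y k) z; rewrite /= (mdistC z); lra.
Qed.

End geometric.

Section limit_measure.
Context (R : realType) (Z : polishMetricType R).
Local Notation lam := (@lebesgue_measure R).
Local Notation t := (@half_pow R).
Context (mu : nat -> fin_borel_measure R Z) (z : nat -> nat -> Z) (q : nat -> Z -> nat)
  (g : nat -> fin_borel_measure R (Z * Z)%type) (c : nat -> R) (L : nat -> R -> nat).
Hypothesis mq : forall k, measurable_fun setT (q k : borel Z -> nat).
Hypothesis q0 : forall k x, q k x != 0%N.
Hypothesis zq : forall k x, mdist (z k (q k x)) x < t k / 8.
Hypothesis sub : forall k, subplan (g k) (mu k) (mu k.+1).
Hypothesis gc : forall k, (\int[g k]_x metric_cost x.1 x.2 <= (c k)%:E)%E.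
Hypothesis gcost : forall k,
  mass (mu k) + mass (mu k.+1) - 2 * mass (g k) + c k < t k ^+ 2.
Hypothesis Lreal : forall k, realises (L k) (mu k) (q k).
Hypothesis Lpair : forall k i j, i != 0%N -> j != 0%N ->
  lam (L k @^-1` [set i] `&` L k.+1 @^-1` [set j]) =
  g k ((fun w => (q k w.1, q k.+1 w.2)) @^-1` [set (i, j)]).

Let mL k B : measurable (L k @^-1` B).
Proof. by apply: measurable_preimage_nat; exact: (Lreal k).1. Qed.

Let phi k x : Z := z k (L k x).
Let P k x : Z := z k (q k x).

Let inside k : set R := L k @^-1` [set i | i != 0%N].

Let inside_mass k : lam (inside k) = (mass (mu k))%:E.
Proof.
rewrite (realises_measure (Lreal k))//.
by rewrite (_ : _ @^-1` _ = setT) ?massE//; apply/seteqP; split=> // x _; exact: q0.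
Qed.

Let lam_pair k (B : set (nat * nat)) :
  (forall p, B p -> p.1 != 0%N /\ p.2 != 0%N) ->
  lam ((fun x => (L k x, L k.+1 x)) @^-1` B) =
  g k ((fun w => (q k w.1, q k.+1 w.2)) @^-1` B).
Proof.
move=> B0.
have pE (T1 : Type) (l1 l2 : T1 -> nat) p : (fun x => (l1 x, l2 x)) @^-1` [set p] =
    l1 @^-1` [set p.1] `&` l2 @^-1` [set p.2].
  by case: p => a b; apply/seteqP; split=> [x [h1 h2]|x [/= -> ->]].
apply: label_measure_eq => p Bp.
- by rewrite pE; apply: measurableI; exact: mL.
- rewrite pE; apply: measurableI; apply: measurable_preimage_nat.
    by apply: (measurableT_comp (mq k)); exact: measurable_fst_borel.
  by apply: (measurableT_comp (mq k.+1)); exact: measurable_snd_borel.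
- rewrite pE; have [p1 p2] := B0 p Bp; have := Lpair k p1 p2.
  by case: p {Bp p1 p2}.
Qed.

Let both k : set R := inside k `&` inside k.+1.

Let both_mass k : lam (both k) = (mass (g k))%:E.
Proof.
have := @lam_pair k [set p | p.1 != 0%N /\ p.2 != 0%N] (fun p h => h).
rewrite (_ : _ @^-1` _ = both k)// => ->.
by rewrite (_ : _ @^-1` _ = setT) ?massE//; apply/seteqP; split=> // x _; split; exact: q0.
Qed.

Let mpair k (B : set (nat * nat)) : measurable ((fun x => (L k x, L k.+1 x)) @^-1` B).
Proof.
have h : measurable_fun setT (fun x : R => `[< B (L k x, L k.+1 x) >]).
  exact: (measurable_fun_nat2 (fun i j => `[< B (i, j) >]) (Lreal k).1 (Lreal k.+1).1).
have := h measurableT [set true] I; rewrite setTI.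
by congr measurable; apply/seteqP; split=> x /=; [move=> /asboolP|move=> ?; apply/asboolP].
Qed.

Let farB k : set (nat * nat) :=
  [set p | [/\ p.1 != 0%N, p.2 != 0%N & t k < mdist (z k p.1) (z k.+1 p.2)]].
Let far k : set R := (fun x => (L k x, L k.+1 x)) @^-1` farB k.

Let cost_c k : 0 <= c k /\ c k < t k ^+ 2.
Proof.
have [g1 g2] := subplan_mass (sub k); have c0 := cost_integral_ge0 (gc k).
by split => //; have := gcost k; lra.
Qed.

(** Representatives are within t_k/8 and t_(k+1)/8 of their points, 3 t_k/16 in total, so a jump of
    representatives beyond t_k forces a displacement of at least t_k/2. Markov with a cost below
    t_k^2 then gives 2 t_k. *)
Let far_le k : (lam (far k) <= (2 * t k)%:E)%E.
Proof.
rewrite lam_pair; last by move=> p [].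
have t20 : 0 < t k / 2 by rewrite divr_gt0// half_pow_gt0.
have [mfar] := cost_markov (gc k) t20; set F := [set _ | _] => gF.
have [c0 ct] := cost_c k.
apply: (@le_trans _ _ (g k F)).
  apply: le_measure; rewrite ?inE//.
    have h : measurable_fun setT ((fun w => `[< farB k (q k w.1, q k.+1 w.2) >]) : borel (Z * Z)%type -> bool).
      apply: (measurable_fun_nat2 (fun i j => `[< farB k (i, j) >])).
        by apply: (measurableT_comp (mq k)); exact: measurable_fst_borel.
      by apply: (measurableT_comp (mq k.+1)); exact: measurable_snd_borel.
    have := h measurableT [set true] I; rewrite setTI.
    by congr measurable; apply/seteqP; split=> x /=; [move=> /asboolP|move=> ?; apply/asboolP].
  move=> w [_ _ /= tw]; rewrite /F /=.
  have := zq k w.1; have := zq k.+1 w.2.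
  have := half_powS R k; have := half_pow_gt0 R k.+1.
  have := mdist_tri w.1 (z k (q k w.1)) (z k.+1 (q k.+1 w.2)).
  have := mdist_tri w.2 w.1 (z k.+1 (q k.+1 w.2)).
  by rewrite (mdistC w.2); lra.
apply: (le_trans gF); rewrite lee_fin ler_pdivrMr//.
have tp := half_pow_gt0 R k; rewrite expr2 in ct; lra.
Qed.

Let bad k : set R := (inside k `\` inside k.+1) `|` (inside k.+1 `\` inside k) `|` far k.

Let mbad k : measurable (bad k).
Proof.
apply: measurableU; last exact: mpair.
by apply: measurableU; apply: measurableD; exact: mL.
Qed.

(** The symmetric difference of the two realised sets has measure |mu_k| + |mu_(k+1)| - 2 |g_k| <
    t_k^2 <= t_k, and the far points add 2 t_k. *)
Let bad_le k : (lam (bad k) <= (3 * t k)%:E)%E.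
Proof.
have mi := mL k [set i | i != 0%N]; have mi' := mL k.+1 [set i | i != 0%N].
have mD : measurable (inside k `\` inside k.+1) by exact: measurableD.
have mD' : measurable (inside k.+1 `\` inside k) by exact: measurableD.
have mb : measurable (both k) by exact: measurableI.
have e1 : (lam (inside k) = lam (both k) + lam (inside k `\` inside k.+1))%E.
  rewrite (lebesgueD mi mb); last by move=> x [].
  by rewrite /both setDIr setDv set0U.
have e2 : (lam (inside k.+1) = lam (both k) + lam (inside k.+1 `\` inside k))%E.
  rewrite (lebesgueD mi' mb); last by move=> x [].
  by rewrite /both setDIr setDv setU0.
have mfar : measurable (far k) by exact: mpair.
apply: le_trans (lebesgueU2 (measurableU _ _ mD mD') mfar) _.
apply: le_trans (leeD (lebesgueU2 mD mD') (far_le k)) _.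
move: e1 e2; rewrite !inside_mass both_mass.
case: (lam (inside k `\` inside k.+1)) => [a| |] //.
case: (lam (inside k.+1 `\` inside k)) => [b| |] //.
rewrite -!EFinD => -[e1] [e2]; rewrite lee_fin.
have [c0 _] := cost_c k; have := gcost k.
have := half_pow_le1 R k; have := half_pow_gt0 R k; rewrite expr2; nra.
Qed.

Let tail k : set R := \bigcup_n bad (k + n)%N.
(** The points that realise mass of [mu k] and are never bad from [k] on, along which the maps [phi]
    form a Cauchy sequence; [E] collects the points where this happens eventually. *)
Let H k : set R := inside k `\` tail k.
Let E : set R := \bigcup_k H k.

Let mtail k : measurable (tail k).
Proof. by apply: bigcupT_measurable => n; exact: mbad. Qed.

Let mH k : measurable (H k).
Proof. by apply: measurableD; [exact: mL|exact: mtail]. Qed.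

Let mE : measurable E.
Proof. exact: bigcupT_measurable. Qed.

Let tail_le k : (lam (tail k) <= (6 * t k)%:E)%E.
Proof.
have := @geometric_tail R _ _ lam bad k 3 mbad ltac:(by []) bad_le.
by rewrite (_ : 2 * 3 * t k = 6 * t k)//; ring.
Qed.

Let inside_step k l x : (k <= l)%N -> ~ tail k x -> (inside k x <-> inside l x).
Proof.
move=> kl nt; rewrite -(subnK kl) addnC; elim: (l - k)%N => [|n IH]; first by rewrite addn0.
rewrite addnS; apply: (iff_trans IH); split=> h; apply: contrapT => h'; apply: nt; exists n => //.
  by left; left.
by left; right.
Qed.

Let H_mono k l x : (k <= l)%N -> H k x -> H l x.
Proof.
move=> kl [ik nt]; split; first exact/(inside_step kl nt).
move=> [n _ b]; apply: nt; exists (l - k + n)%N => //.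
by rewrite addnA (subnKC kl).
Qed.

Let H_close k x : H k x -> mdist (phi k x) (phi k.+1 x) <= t k.
Proof.
move=> [ik nt]; rewrite leNgt; apply/negP => far_x; apply: nt; exists 0%N => //.
rewrite addn0; have [ik'|nik'] := pselect (inside k.+1 x); last by left; left.
by right; split.
Qed.

Let E_tail k x : E x -> ~ H k x -> tail k x.
Proof.
move=> [N _ HN] nH; apply: contrapT => nt.
have [Nk|kN] := leqP N k; first by apply: nH; exact: H_mono HN.
apply: nH; split => //; apply/(inside_step (ltnW kN) nt).
by have [] := HN.
Qed.

(** One limit has to serve every [k] with [H k x], so it is built from the least such index. The
    constant value off [E] keeps the map measurable. *)
Let limit_map : exists psi : R -> Z,
  (forall x k, H k x -> mdist (phi k x) (psi x) <= 2 * t k) /\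
  forall x, ~ E x -> psi x = point.
Proof.
have /choice[psi psiP] : forall x, exists w,
    (forall k, H k x -> mdist (phi k x) w <= 2 * t k) /\ (~ E x -> w = point).
  move=> x; have [[N0 _ HN0]|nE] := pselect (E x); last first.
    by exists point; split=> // k Hk; exfalso; apply: nE; exists k.
  have ex : exists N, `[< H N x >] by exists N0; apply/asboolP.
  case: (ex_minnP ex) => N /asboolP HN Nmin.
  have [w wP] : exists w, forall k, (N <= k)%N -> mdist (phi k x) w <= 2 * t k.
    by apply: complete_geometric_limit => k Nk; apply: H_close; exact: H_mono HN.
  exists w; split=> [k Hk|nE]; last by exfalso; apply: nE; exists N.
  by apply: wP; apply: Nmin; apply/asboolP.
by exists psi; split=> x; have [] := psiP x.
Qed.

(** For [x] in [E], [psi x] lies in the open set [V] if and only if, for some [k] with [H k x], the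
    closed ball of radius [2 * t k] around [phi k x] is included in [V]; this inclusion depends on
    the label alone. *)
Let measurable_limit_map psi :
  (forall x k, H k x -> mdist (phi k x) (psi x) <= 2 * t k) ->
  (forall x, ~ E x -> psi x = point) ->
  measurable_fun setT (psi : R -> borel Z).
Proof.
move=> psiP psi0; apply: (@measurability _ _ R (borel Z) _ _ _ erefl).
move=> _ [V oV <-].
rewrite setTI.
pose G k := [set i | forall w, mdist (z k i) w <= 2 * t k -> V w].
pose O' : set R := if `[< V point >] then ~` E else set0.
have -> : psi @^-1` V = \bigcup_k (H k `&` L k @^-1` G k) `|` O'.
  apply/seteqP; split=> x /=.
    have [[N _ HN] Vx|nE] := pselect (E x); last first.
      by rewrite psi0// => Op; right; rewrite /O' asboolT.
    left; have [r r0 rO] := (open_mballP V).1 oV _ Vx.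
    have r40 : 0 < r / 4 by rewrite divr_gt0.
    have [M hM] := half_pow_small r40.
    have Hk : H (maxn N M) x by apply: H_mono HN; exact: leq_maxl.
    exists (maxn N M) => //; split=> // w zw; apply: rO.
    have := hM _ (leq_maxr N M); have := psiP _ _ Hk; rewrite (mdistC (phi _ _)).
    by have := mdist_tri (phi (maxn N M) x) (psi x) w; rewrite /phi; lra.
  move=> [[k _ [Hk Gk]]|]; first by apply: Gk; exact: psiP.
  by rewrite /O'; case: asboolP => // Op nE; rewrite psi0.
apply: measurableU.
  by apply: bigcupT_measurable => k; apply: measurableI; [exact: mH|exact: mL].
by rewrite /O'; case: ifP => _ //; exact: measurableC.
Qed.

Let measurable_P k : measurable_fun setT (P k : borel Z -> borel Z).
Proof. exact: (measurable_fun_nat1 (z k : nat -> borel Z) (mq k)). Qed.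

Let measurable_phi k : measurable_fun setT (phi k : R -> borel Z).
Proof. exact: (measurable_fun_nat1 (z k : nat -> borel Z) (Lreal k).1). Qed.

Let H_inside_le k A : (lam (H k `&` phi k @^-1` A) <= mu k (P k @^-1` A))%E.
Proof.
have h := realises_measure (B := [set i | i != 0%N /\ A (z k i)]) (Lreal k) (mq k).
rewrite (_ : P k @^-1` A = q k @^-1` [set i | i != 0%N /\ A (z k i)]); last first.
  by apply/seteqP; split=> x /=; [move=> ?; split => //; exact: q0|case].
rewrite -h; last by case.
apply: lebesgue_le.
- apply: measurableI; first exact: mH.
  by apply: (measurable_preimage_nat [set i | A (z k i)]); exact: (Lreal k).1.
- exact: mL.
- by move=> x [[ix _] Ax]; split.
Qed.

Let inside_H k : (lam (inside k) <= lam (H k) + (6 * t k)%:E)%E.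
Proof.
apply: (@le_trans _ _ (lam (H k `|` tail k))).
  apply: lebesgue_le; [exact: mL|exact: measurableU|].
  by move=> x ix; have [tx|nt] := pselect (tail k x); [right|left].
by apply: (le_trans (lebesgueU2 (mH k) (mtail k))); rewrite leeD2l// tail_le.
Qed.

Let E_H k : (lam E <= lam (H k) + (6 * t k)%:E)%E.
Proof.
apply: (@le_trans _ _ (lam (H k `|` tail k))).
  apply: lebesgue_le; [exact: mE|exact: measurableU|].
  by move=> x Ex; have [Hx|nH] := pselect (H k x); [left|right; exact: E_tail].
by apply: (le_trans (lebesgueU2 (mH k) (mtail k))); rewrite leeD2l// tail_le.
Qed.

Let H_fin k : (lam (H k) <= (mass (mu k))%:E)%E.
Proof.
by rewrite -inside_mass; apply: lebesgue_le; [exact: mH|exact: mL|move=> x []].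
Qed.

(** [nu] is the image under [psi] of Lebesgue measure on [E]. [mu k] is coupled with its
    discretisation [muP], and [muP] with [nu] through [phi k] and [psi] on [H k], a set that misses
    at most [6 * t k] of either mass. *)
Lemma limit_measure_exists : exists nu : fin_borel_measure R Z,
  forall k, coupled (mu k) nu ((3 * mass nu + 20) * t k).
Proof.
have [psi [psiP psi0]] := limit_map.
have mpsi := measurable_limit_map psiP psi0.
have lamE_fin : (lam E < +oo)%E.
  apply: le_lt_trans (E_H 0%N) _; apply: (@le_lt_trans _ _ ((mass (mu 0%N))%:E + (6 * t 0%N)%:E)%E).
    by rewrite leeD2r.
  by rewrite -EFinD ltry.
have indE (A B : set R) : measurable A -> measurable B ->
    (\int[lam]_(x in B) (\1_A x)%:E = lam (A `&` B))%E.
  by move=> mA mB; rewrite integral_indic.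
have [nu [nuE _]] := @weighted_pushforward _ _ (measurableTypeR R) (borel Z) R lam (\1_E) psi
  (measurable_indic mE) (indic_ge0 _ _) ltac:(by rewrite indE// setIT) mpsi.
have mpre (f : R -> Z) (A : set Z) : measurable_fun setT (f : R -> borel Z) ->
    measurable (A : set (borel Z)) -> measurable (f @^-1` A).
  by move=> mf mA; rewrite -[X in measurable X]setTI; exact: mf.
have massnu : (mass nu)%:E = lam E.
  by rewrite -massE nuE// preimage_setT indE// setIT.
exists nu => k.
have tk := half_pow_gt0 R k; have tk1 := half_pow_le1 R k.
pose muP : fin_borel_measure R Z := image_measure (mu k) measurableT (measurable_P k).
have muPE A : muP A = mu k (P k @^-1` A) by rewrite /muP /= /image_measure setTI.
have mass_muP : mass muP = mass (mu k) by rewrite /mass muPE preimage_setT.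
have mu0 := mass_ge0 (mu k).
have [h [hE h0]] : exists h : R, lam (H k) = h%:E /\ 0 <= h.
  have := H_fin k; have : (0 <= lam (H k))%E by [].
  by case: (lam (H k)) => [h| |] //; exists h.
have h_nu : h <= mass nu.
  rewrite -lee_fin massnu -hE; apply: lebesgue_le; [exact: mH|exact: mE|].
  by move=> x Hx; exists k.
have h_mu : mass (mu k) <= h + 6 * t k.
  by rewrite -lee_fin EFinD -hE -inside_mass inside_H.
have nu_h : mass nu <= h + 6 * t k by rewrite -lee_fin EFinD -hE massnu.
have c1 : coupled (mu k) muP (t k / 8 * mass (mu k) + t k).
  apply: (@weighted_coupling _ _ _ (borel Z) (mu k) (cst 1) id (P k) _ _
    (mass (mu k)) (t k / 8 * mass (mu k))) => //.
  - by move=> A mA; rewrite integral_one.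
  - move=> A mA; rewrite integral_one ?muPE//.
    by rewrite -[X in measurable X]setTI; exact: measurable_P.
  - by rewrite integral_one// -massE.
  - apply: (@le_trans _ _ (\int[mu k]_x (cst (t k / 8)%:E x))%E).
      apply: ge0_le_integral => //.
      + by move=> x _; rewrite lee_fin mulr1 mdist_ge0.
      + apply/measurable_EFinP; apply: measurable_funM => //.
        by apply: (@measurable_mdist _ _ (borel Z) Z id (P k)).
      + by move=> x _; rewrite /= lee_fin mulr1 mdistC; exact: ltW (zq k x).
    have -> : (\int[mu k]_x (cst (t k / 8)%:E x) = (t k / 8)%:E * mu k setT)%E.
      exact: (integral_cst (mu k) measurableT _).
    by rewrite massE.
  - by rewrite mass_muP; lra.
(* Here 12 t_k bounds the mass missed on the two sides, one more t_k makes the inequality strict,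
   and points of [H k] move by at most 2 t_k. *)
have c2 : coupled muP nu (13 * t k + 2 * t k * mass nu).
  apply: (@weighted_coupling _ _ _ (measurableTypeR R) lam (\1_(H k)) (phi k) psi _ _ h (2 * t k * h)) => //.
  - exact: (measurable_indic (mH k)).
  - exact: measurable_phi.
  - move=> A mA; rewrite indE// ?muPE; last exact: mpre.
    exact: H_inside_le.
  - move=> A mA; rewrite indE//; last exact: mpre.
    rewrite nuE// indE//; last exact: mpre.
    apply: lebesgue_le.
    + by apply: measurableI; [exact: mH|exact: mpre].
    + by apply: measurableI; [exact: mE|exact: mpre].
    + by move=> x [Hx Ax]; split=> //; exists k.
  - by rewrite indE// setIT hE.
  - apply: (@le_trans _ _ (\int[lam]_x ((2 * t k)%:E * (\1_(H k) x)%:E))%E).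
      apply: ge0_le_integral => //.
      + by move=> x _; rewrite lee_fin mulr_ge0// mdist_ge0.
      + apply/measurable_EFinP; apply: measurable_funM; last exact: (measurable_indic (mH k)).
        exact: (@measurable_mdist _ _ (measurableTypeR R) Z (phi k) psi (measurable_phi k) mpsi).
      + by apply/measurable_EFinP; apply: measurable_funM => //; exact: (measurable_indic (mH k)).
      move=> x _; rewrite -EFinM lee_fin indicE.
      have [xH|nxH] := boolP (x \in H k); last by rewrite !mulr0.
      by rewrite !mulr1; apply: psiP; rewrite inE in xH.
    rewrite ge0_integralZl_EFin//; last 2 first.
    + by apply/measurable_EFinP; exact: (measurable_indic (mH k)).
    + by rewrite mulr_ge0// ltW.
    by rewrite indE// setIT hE.
  - rewrite mass_muP.
    have : t k * h <= t k * mass nu by rewrite ler_pM2l.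
    lra.
(* As [mass (mu k) <= mass nu + 6], the constants 3 and 20 round up 2 + 1/8 and 14 + 3/4. *)
apply: coupled_mono (coupled_triangle c1 c2).
have : t k * mass (mu k) <= t k * (mass nu + 6) by rewrite ler_pM2l//; lra.
have := mass_ge0 nu; nra.
Qed.

End limit_measure.

Lemma coupled_complete (R : realType) (Z : polishMetricType R)
    (mu : nat -> fin_borel_measure R Z) :
  (forall k, coupled (mu k) (mu k.+1) (half_pow R k ^+ 2)) ->
  exists nu, forall e, 0 < e -> exists N, forall k, (N <= k)%N -> coupled (mu k) nu e.
Proof.
move=> h.
have /choice[sq sqP] : forall k, exists sq : (nat -> Z) * (Z -> nat),
    measurable_fun setT (sq.2 : borel Z -> nat) /\
    forall x, mdist (sq.1 (sq.2 x)) x < half_pow R k / 8.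
  move=> k; have [|s [q [mq sq]]] := @fine_labelling R Z (half_pow R k / 8).
    by rewrite divr_gt0// half_pow_gt0.
  by exists (s, q).
(* The successor keeps label 0 free for the outside; the predecessor in [z] undoes it. *)
pose q k x := ((sq k).2 x).+1.
have /choice[gc gcP] : forall k, exists gc : fin_borel_measure R (Z * Z)%type * R,
    [/\ subplan gc.1 (mu k) (mu k.+1), (\int[gc.1]_x metric_cost x.1 x.2 <= gc.2%:E)%E &
     mass (mu k) + mass (mu k.+1) - 2 * mass gc.1 + gc.2 < half_pow R k ^+ 2].
  by move=> k; have [g [sg [c gcle lt]]] := h k; exists (g, c).
pose z k i := (sq k).1 i.-1.
have mq k : measurable_fun setT (q k : borel Z -> nat).
  exact: (measurable_fun_nat1 S (sqP k).1).
have q0 k x : q k x != 0%N by [].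
(* The recursion carries the proof of [realises], on which the choice of the next realisation
   depends. *)
pose St k := {L : R -> nat | realises L (mu k) (q k)}.
have step k (L : St k) : {L' : St k.+1 | forall i j, i != 0%N -> j != 0%N ->
    lebesgue_measure (sval L @^-1` [set i] `&` sval L' @^-1` [set j]) =
    (gc k).1 ((fun w => (q k w.1, q k.+1 w.2)) @^-1` [set (i, j)])}.
  have [sg _ _] := gcP k.
  have [L' [rL' pL']] := cid (realise_plan (mq k) (mq k.+1) (q0 k) (q0 k.+1) sg (svalP L)).
  by exists (exist _ L' rL').
have [L0 rL0] := cid (realises_exists (mu 0%N) (mq 0%N) (q0 0%N)).
pose L := nat_rect St (exist _ L0 rL0) (fun k L => sval (step k L)).
have zq k x : mdist (z k (q k x)) x < half_pow R k / 8 by exact: (sqP k).2.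
have sub k : subplan (gc k).1 (mu k) (mu k.+1) by have [] := gcP k.
have cost k : (\int[(gc k).1]_x metric_cost x.1 x.2 <= (gc k).2%:E)%E by have [] := gcP k.
have gap k : mass (mu k) + mass (mu k.+1) - 2 * mass (gc k).1 + (gc k).2 < half_pow R k ^+ 2.
  by have [] := gcP k.
have [nu nuP] := limit_measure_exists mq q0 zq sub cost gap
  (fun k => svalP (L k)) (fun k => svalP (step k (L k))).
exists nu => e e0.
have m0 := mass_ge0 nu.
have [N hN] := @half_pow_small R (e / (3 * mass nu + 20)) ltac:(by rewrite divr_gt0//; lra).
exists N => k /hN; rewrite ltr_pdivlMr; last by lra.
by move=> lt; apply: coupled_mono (nuP k); rewrite mulrC ltW.
Qed.

Lemma mm_close_complete (R : realType) (u : nat -> mm_space R) :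
  (forall e, 0 < e -> exists N, forall m n, (N <= m)%N -> (N <= n)%N -> mm_close (u m) (u n) e) ->
  exists X, forall e, 0 < e -> exists N, forall n, (N <= n)%N -> mm_close (u n) X e.
Proof.
move=> uc.
have t20 k : 0 < half_pow R k ^+ 2 by rewrite exprn_gt0// half_pow_gt0.
have /choice[N NP] := fun k => uc _ (t20 k).
(* A sum bounds every [N i] with [i <= k], so that [M k] and [M k.+1] both lie beyond [N k]. *)
pose M k := (\sum_(i < k.+1) N i)%N.
have NM i k : (i <= k)%N -> (N i <= M k)%N.
  by move=> ik; rewrite /M (bigD1 (Ordinal (ik : (i < k.+1)%N)))//= leq_addr.
pose v k := u (M k).
have step k : mm_close (v k) (v k.+1) (half_pow R k ^+ 2).
  by apply: NP; apply: NM.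
(* The ambient spaces and embeddings are needed as data for the gluing, hence dependent pairs in
   place of [exists]. *)
have step' k : {T : polishMetricType R & {f : isometric_embedding T (mm_support (X := v k)) &
    {g : isometric_embedding T (mm_support (X := v k.+1)) |
      coupled (mm_push f) (mm_push g) (half_pow R k ^+ 2)}}}.
  have [T' h] := cid (step k); exists T'.
  by have [f h'] := cid h; exists f; have [g h''] := cid h'; exists g.
pose W k := projT1 (step' k).
pose f k : isometric_embedding (W k) (mm_support (X := v k)) := projT1 (projT2 (step' k)).
pose g k : isometric_embedding (W k) (mm_support (X := v k.+1)) :=
  sval (projT2 (projT2 (step' k))).
have fg k : coupled (mm_push (f k)) (mm_push (g k)) (half_pow R k ^+ 2).
  exact: svalP (projT2 (projT2 (step' k))).
(* [W k] and [W k.+1] both contain a copy of the support of [v k.+1], along which they are glued. *)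
have [|Z [e [iso_e glue]]] := @chain_gluing R W (fun k => v k.+1)
  (fun k => mm_support (X := v k.+1)) (fun k => g k) (fun k => f k.+1).
  by move=> k s s' Ds Ds'; rewrite !emb_isometric ?inE.
pose mu k := mm_push (emb_comp (f k) (iso_e k)).
have [|nu nuP] := @coupled_complete R Z mu.
  move=> k; apply: (coupled_map (iso_e k) _ _ (fg k)) => // A mA.
  rewrite !mm_pushE /=; congr (mm_measure _ _); apply/seteqP.
  by split => y [Dy] /=; rewrite glue.
exists (MMSpace nu) => d d0.
have d20 : 0 < d / 2 by rewrite divr_gt0.
have [K1 hK1] := nuP _ d20.
have [K3 hK3] := half_pow_small d20.
pose k := maxn K1 K3.
have vk : mm_close (v k) (MMSpace nu) (d / 2).
  exists Z, (emb_comp (f k) (iso_e k)), (emb_id (MMSpace nu)).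
  apply: (coupled_ext _ _ (hK1 k (leq_maxl _ _))) => // A mA.
  by rewrite mm_push_id.
exists (N k) => n Nn; rewrite (splitr d); apply: mm_close_triangle vk.
apply: mm_close_mono (NP k n (M k) Nn (NM _ _ (leqnn k))).
have := hK3 k (leq_maxr _ _); have := half_pow_gt0 R k; have := half_pow_le1 R k.
rewrite expr2; nra.
Qed.

(** * The metric on isomorphism classes *)

Section mm_metric.
Context (R : realType).
Implicit Types X Y Z : mm_space R.

Definition mm_dist X Y : R := fine (embedding_inf (@piccoli_rossi R) X Y).

(** An extended real is determined by the reals strictly above it, which are the same for every such
    [D]. The value is finite because [mm_close] forces [e > 0] and holds for some [e]. *)
Lemma mm_distE (D : forall T : polishMetricType R,
    fin_borel_measure R T -> fin_borel_measure R T -> \bar R) X Y :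
  (forall T mu1 mu2 e, (D T mu1 mu2 < e%:E)%E <-> coupled mu1 mu2 e) ->
  (mm_dist X Y)%:E = embedding_inf D X Y.
Proof.
move=> DP; have DcP e : (embedding_inf D X Y < e%:E)%E <-> mm_close X Y e.
  by apply: embedding_inf_ltP => T mu1 mu2; exact: DP.
have PcP e : (embedding_inf (@piccoli_rossi R) X Y < e%:E)%E <-> mm_close X Y e.
  by apply: embedding_inf_ltP => T mu1 mu2; exact: piccoli_rossi_ltP.
have sup_eq (a b : \bar R) : (forall e, (a < e%:E)%E -> (b < e%:E)%E) -> (b <= a)%E.
  move=> ab; case: a ab => [r| |] ab; [|by rewrite leey|].
    by apply/lee_addgt0Pr => e e0; rewrite -EFinD ltW// ab// lte_fin ltrDl.
  have b_lt e : (b < e%:E)%E by exact: ab (ltNyr e).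
  by case: b b_lt {ab} => [r /(_ r)| /(_ 0)|] //; rewrite lte_fin ltxx.
rewrite /mm_dist fineK.
  by apply/eqP; rewrite eq_le; apply/andP; split; apply: sup_eq => e; rewrite DcP PcP.
rewrite fin_numElt; apply/andP; split.
  rewrite ltNge; apply/negP; rewrite leeNy_eq => /eqP E.
  by have := (PcP 0).1; rewrite E ltNyr => /(_ isT)/mm_close_gt0; rewrite ltxx.
by apply: lt_trans (ltry _); apply/PcP; exact: mm_close_exists.
Qed.

Lemma mm_dist_ltP X Y e : mm_dist X Y < e <-> mm_close X Y e.
Proof.
rewrite -lte_fin (mm_distE _ _ (fun T mu1 mu2 e => piccoli_rossi_ltP mu1 mu2 e)).
by apply: embedding_inf_ltP => T mu1 mu2; exact: piccoli_rossi_ltP.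
Qed.

Lemma mm_dist_ge0 X Y : 0 <= mm_dist X Y.
Proof. by rewrite leNgt; apply/negP => /mm_dist_ltP/mm_close_gt0; rewrite ltxx. Qed.

Lemma mm_distC X Y : mm_dist X Y = mm_dist Y X.
Proof.
wlog XY : X Y / mm_dist X Y < mm_dist Y X => [W|].
  by have [/W->|/W->|->] := ltgtP (mm_dist X Y) (mm_dist Y X).
by move/mm_dist_ltP/mm_close_sym/mm_dist_ltP: XY; rewrite ltxx.
Qed.

Lemma mm_dist_triangle Y X Z : mm_dist X Z <= mm_dist X Y + mm_dist Y Z.
Proof.
apply/ler_addgt0Pr => e e0; apply/ltW/mm_dist_ltP.
rewrite (splitr e) addrACA; apply: (@mm_close_triangle _ _ Y); apply/mm_dist_ltP;
  by rewrite ltrDl divr_gt0.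
Qed.

Lemma mm_dist0P X Y : mm_dist X Y = 0 <-> mm_iso X Y.
Proof.
split=> [XY|iso].
  by apply: mm_close_iso => e e0; apply/mm_dist_ltP; rewrite XY.
apply/eqP; rewrite eq_le mm_dist_ge0 andbT.
by apply/ler_addgt0Pr => e e0; rewrite add0r; apply/ltW/mm_dist_ltP; exact: mm_iso_close.
Qed.

Lemma mm_iso_refl X : mm_iso X X.
Proof. by apply/mm_close_iso => e e0; exists X, (emb_id X), (emb_id X); exact: coupled_refl. Qed.

Lemma mm_dist_iso X X' Y : mm_iso X X' -> mm_dist X Y = mm_dist X' Y.
Proof.
move=> /mm_dist0P XX'; have := mm_dist_triangle X' X Y; have := mm_dist_triangle X X' Y.
by rewrite (mm_distC X' X) XX' => h1 h2; apply/eqP; rewrite eq_le; apply/andP; split; lra.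
Qed.

(** Symmetry and transitivity of [mm_iso] are read off [mm_dist], which vanishes exactly on
    isomorphic pairs. *)
Lemma class_of_eqP X Y : class_of X = class_of Y <-> mm_iso X Y.
Proof.
split=> [E|XY].
  have : mm_members (class_of X) Y by rewrite E; exact: mm_iso_refl.
  by [].
have E : mm_iso X = mm_iso Y.
  by apply/funext => Z; apply/propext; rewrite -!mm_dist0P (mm_dist_iso Z XY).
rewrite /class_of; move: (ex_intro _ X _) (ex_intro _ Y _).
by rewrite E => p q; congr MMClass; exact: Prop_irrelevance.
Qed.

Definition repr (x : mm_class R) : mm_space R := sval (cid (mm_membersE x)).

Lemma class_of_repr x : class_of (repr x) = x.
Proof.
rewrite /repr; case: cid => X /= XE; case: x XE => m mE /= XE.
by subst m; congr MMClass; exact: Prop_irrelevance.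
Qed.

Lemma mm_dist_repr X Y : mm_dist (repr (class_of X)) (repr (class_of Y)) = mm_dist X Y.
Proof.
have rX Z : mm_iso (repr (class_of Z)) Z by apply/class_of_eqP; exact: class_of_repr.
by rewrite (mm_dist_iso _ (rX X)) mm_distC (mm_dist_iso _ (rX Y)) mm_distC.
Qed.

End mm_metric.

Theorem theorem8 (R : realType) :
  exists BL : mm_class R -> mm_class R -> R,
    [/\ (forall (n : nat), (2 <= n)%N -> forall X1 X2 : mm_space R,
           ((BL (class_of X1) (class_of X2))%:E
             = embedding_inf (@approx_ET R n) X1 X2)%E),
        is_metric BL,
        is_complete BL &
        forall X1 X2 : mm_space R,
          ((BL (class_of X1) (class_of X2))%:E
            = embedding_inf (@piccoli_rossi R) X1 X2)%E].
Proof.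
exists (fun x y => mm_dist (repr x) (repr y)); split.
- move=> n n2 X1 X2; rewrite mm_dist_repr; apply: mm_distE => T mu1 mu2 e.
  exact: approx_ET_ltP.
- split.
  + by move=> x y; exact: mm_dist_ge0.
  + by move=> x y; rewrite mm_dist0P -class_of_eqP !class_of_repr.
  + by move=> x y; exact: mm_distC.
  + by move=> x y z; exact: mm_dist_triangle.
- move=> u uc; have [|X XP] := @mm_close_complete R (fun n => repr (u n)).
    move=> e /uc[N NP]; exists N => m n mN nN; apply/mm_dist_ltP; exact: NP.
  exists (class_of X) => e /XP[N NP]; exists N => n /NP/mm_dist_ltP.
  by rewrite -{1}(mm_dist_repr _ X) class_of_repr.
- move=> X1 X2; rewrite mm_dist_repr; apply: mm_distE => T mu1 mu2 e.
  exact: piccoli_rossi_ltP.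
Qed.
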